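(* Let $V$ be a vector space of finite dimension $\ell$ over a field $\mathbf{K}$ of characteristic zero, and let $\Delta$ be a finite set of nonzero elements of $V^*$, no two of which are proportional. If $\mathcal{A}(\Delta)=\{\ker\alpha\mid\alpha\in\Delta\}$ is a free arrangement with exponents $(d_1,\dots,d_\ell)$, then, as formal power series in $s,t$, $$\mathrm{Poin}(\overline{R}(\Delta),s,t)=(1-s)^{-\ell}(1-t)^{-\ell}\prod_{i=1}^{\ell}\{1+(d_i-1-s\,d_i)t\}.$$
   Context: Let $S=S(V^* )$ be the symmetric algebra of $V^*$, regarded as the ring of polynomial functions on $V$, and let $S^p$ be its homogeneous part of degree $p$. Let $R=R(\Delta)=S[\Delta^{-1}]$ with $\Delta^{-1}=\{1/\alpha\mid\alpha\in\Delta\}$. For $p,q\in\mathbb{Z}$, let $R^p_q$ be the $\mathbf{K}$-linear span of all elements $f/g\in R$ with $f,g$ polynomials ($g\neq 0$), $\deg f\le p$ and $\deg g\le q$; $R^p_q=0$ if $p<0$ or $q<0$. Put $$\overline{R^p_q}=R^p_q/(R^{p-1}_q+R^p_{q-1}),\qquad \overline{R}(\Delta)=\bigoplus_{p,q}\overline{R^p_q},\qquad \mathrm{Poin}(\overline{R}(\Delta),s,t)=\sum_{p,q}\dim_{\mathbf{K}}(\overline{R^p_q})\,s^pt^q .$$ Let $\mathrm{Der}$ be the $S$-module of $\mathbf{K}$-linear derivations $\theta:S\to S$, and let $D(\Delta)=\{\theta\in\mathrm{Der}\mid\theta(\alpha)\in\alpha S\text{ for all }\alpha\in\Delta\}$,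 an $S$-submodule of $\mathrm{Der}$. The arrangement $\mathcal{A}(\Delta)$ is called free if $D(\Delta)$ is a free $S$-module. An element $\theta\in D(\Delta)$ is homogeneous of degree $p$ if $\theta(x)\in S^p$ for all $x\in V^*$. If $\mathcal{A}(\Delta)$ is free, and $\theta_1,\dots,\theta_\ell$ is a homogeneous basis of $D(\Delta)$, the nonnegative integers $\deg\theta_1,\dots,\deg\theta_\ell$ are the exponents of $\mathcal{A}(\Delta)$. *)

(* Defs.v *)
From HB Require Import structures.
From mathcomp Require Import all_boot all_order all_algebra.
From mathcomp Require Import finmap boolp classical_sets functions.
From mathcomp Require Import mpoly.

Set Implicit Arguments.
Unset Strict Implicit.
Unset Printing Implicit Defensive.

Import GRing.Theory.
Local Open Scope ring_scope.
Local Open Scope classical_set_scope.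

(** * Formal power series over a commutative ring, as coefficient functions

    The product on [fps R] is the Cauchy product, not the pointwise product that
    [functions] puts on maps: terms must be typed in [fps R], not [nat -> R]. *)

Definition fps (R : comNzRingType) : Type := nat -> R.

Section FormalPowerSeries.
Variable R : comNzRingType.
Implicit Types f g h : fps R.

HB.instance Definition _ := gen_eqMixin (fps R).
HB.instance Definition _ := gen_choiceMixin (fps R).

Definition fpsC (a : R) : fps R := fun n => if n == 0%N then a else 0.
Definition fpsX : fps R := fun n => (n == 1%N)%:R.
Definition fps_geom : fps R := fun=> 1.
Definition fps_opp f : fps R := fun n => - f n.
Definition fps_add f g : fps R := fun n => f n + g n.
Definition fps_mul f g : fps R := fun n => \sum_(i < n.+1) f i * g (n - i)%N.

Fact fps_addA : associative fps_add.
Proof. by move=> f g h; apply/funext => n; rewrite /fps_add addrA. Qed.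

Fact fps_addC : commutative fps_add.
Proof. by move=> f g; apply/funext => n; rewrite /fps_add addrC. Qed.

Fact fps_add0 : left_id (fpsC 0) fps_add.
Proof. by move=> f; apply/funext => n; rewrite /fps_add /fpsC if_same add0r. Qed.

Fact fps_addN : left_inverse (fpsC 0) fps_opp fps_add.
Proof.
by move=> f; apply/funext => n; rewrite /fps_add /fps_opp /fpsC if_same addNr.
Qed.

HB.instance Definition _ :=
  GRing.isZmodule.Build (fps R) fps_addA fps_addC fps_add0 fps_addN.

Fact fps_mulC : commutative fps_mul.
Proof.
move=> f g; apply/funext => n; rewrite /fps_mul (reindex_inj rev_ord_inj) /=.
by apply: eq_bigr => j _; rewrite subSS subKn ?leq_ord // mulrC.
Qed.

Fact fps_mulA : associative fps_mul.
Proof.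
move=> f g h; apply/funext => n.
have revE (u v : fps R) m : fps_mul u v m = \sum_(j < m.+1) u (m - j)%N * v j.
  by rewrite fps_mulC; apply: eq_bigr => j _; rewrite mulrC.
rewrite [RHS]revE [LHS]/fps_mul.
pose coef3 j k := f j * (g (n - j - k)%N * h k).
transitivity (\sum_(j < n.+1) \sum_(k < n.+1 | (k <= n - j)%N) coef3 j k).
  apply: eq_bigr => /= j _; rewrite revE big_distrr /=.
  by rewrite (big_ord_narrow_leq (leq_subr _ _)).
rewrite (exchange_big_dep predT) //=; apply: eq_bigr => k _.
transitivity (\sum_(j < n.+1 | (j <= n - k)%N) coef3 j k).
  apply: eq_bigl => j; rewrite -ltnS -(ltnS j) -!subSn ?leq_ord //.
  by rewrite -subn_gt0 -(subn_gt0 j) -!subnDA addnC.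
rewrite (big_ord_narrow_leq (leq_subr _ _)) /fps_mul big_distrl /=.
by apply: eq_bigr => j _; rewrite /coef3 -!subnDA addnC mulrA.
Qed.

Fact fps_mul1 : left_id (fpsC 1) fps_mul.
Proof.
move=> f; apply/funext => n; rewrite /fps_mul big_ord_recl subn0 mul1r.
by rewrite big1 ?addr0 // => j _; rewrite mul0r.
Qed.

Fact fps_mulDl : left_distributive fps_mul fps_add.
Proof.
move=> f g h; apply/funext => n; rewrite /fps_mul /fps_add -big_split.
by apply: eq_bigr => j _; rewrite mulrDl.
Qed.

Fact fps_oner_neq0 : fpsC 1 != 0.
Proof. by apply/eqP => /(congr1 (fun f : fps R => f 0%N))/eqP; rewrite oner_eq0. Qed.

HB.instance Definition _ := GRing.Zmodule_isComNzRing.Build (fps R)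
  fps_mulA fps_mulC fps_mul1 fps_mulDl fps_oner_neq0.

Definition fps_unit : {pred fps R} := fun f => `[< exists g, g * f = 1 >].
Definition fps_inv f : fps R := xget f [set g | g * f = 1].

Fact fps_mulVr : {in fps_unit, left_inverse 1 fps_inv *%R}.
Proof.
by move=> f /asboolP [g gf1]; apply: (@xgetPex _ _ [set g | g * f = 1]); exists g.
Qed.

Fact fps_unitP f g : g * f = 1 -> fps_unit f.
Proof. by move=> gf1; apply/asboolP; exists g. Qed.

Fact fps_inv_out : {in [predC fps_unit], fps_inv =1 id}.
Proof.
move=> f /negP nf; rewrite /fps_inv; case: xgetP => // g _ gf1.
by case: nf; exact: fps_unitP gf1.
Qed.

HB.instance Definition _ :=
  GRing.ComNzRing_hasMulInverse.Build (fps R) fps_mulVr fps_unitP fps_inv_out.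

Lemma coef_fpsB f g n : (f - g) n = f n - g n. Proof. by []. Qed.

Lemma coef_fpsM f g n : (f * g) n = \sum_(i < n.+1) f i * g (n - i)%N.
Proof. by []. Qed.

Lemma fps_sub1X_geom : fps_geom * (1 - fpsX) = 1.
Proof.
rewrite mulrC mulrBl mul1r; apply/funext => -[|n].
  by rewrite coef_fpsB coef_fpsM big_ord1 mul0r subr0.
rewrite coef_fpsB coef_fpsM !big_ord_recl big1 => [|j _]; last by rewrite mul0r.
by rewrite /fpsX /= mul0r mulr1 add0r addr0 subrr.
Qed.

Lemma fps_sub1X_unit : (1 - fpsX : fps R) \is a GRing.unit.
Proof. exact: fps_unitP fps_sub1X_geom. Qed.

Lemma fpsC1 : fpsC 1 = 1. Proof. by []. Qed.

Lemma fpsCB a b : fpsC (a - b) = fpsC a - fpsC b.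
Proof. by apply/funext => -[|n] //; exact/esym/subr0. Qed.

Lemma fpsCM a b : fpsC (a * b) = fpsC a * fpsC b.
Proof.
apply/funext => n; rewrite coef_fpsM big_ord_recl subn0.
rewrite big1 => [|j _]; last by rewrite mul0r.
by case: n => [|n] /=; rewrite addr0 // mulr0.
Qed.

End FormalPowerSeries.

(** Z[[s, t]] is encoded as Z[[s]][[t]]: the coefficient of s^p t^q in F is
    F q p. *)
Definition fps2 : Type := fps (fps int).
HB.instance Definition _ := GRing.ComUnitRing.on fps2.

Definition s_ : fps2 := fpsC (fpsX int).
Definition t_ : fps2 := fpsX (fps int).

(** The inverse is a default value off the units; these two elements are
    units. *)
Lemma sub1s_unit : (1 - s_ : fps2) \is a GRing.unit.
Proof.
apply: (@fps_unitP _ _ (fpsC (fps_geom int))).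
by rewrite /s_ -[X in X - _]fpsC1 -fpsCB -fpsCM fps_sub1X_geom.
Qed.

Lemma sub1t_unit : (1 - t_ : fps2) \is a GRing.unit.
Proof. exact: fps_sub1X_unit. Qed.

(** * Spans, bases and free submodules of an arbitrary module *)

Section Modules.
Variables (A : nzRingType) (E : lmodType A).

Definition lspan (G : set E) : set E :=
  [set x | exists m (c : 'I_m -> A) (y : 'I_m -> E),
     (forall i, G (y i)) /\ x = \sum_i c i *: y i].

Definition lin_indep (B : set E) : Prop :=
  forall m (c : 'I_m -> A) (y : 'I_m -> E),
    injective y -> (forall i, B (y i)) ->
    \sum_i c i *: y i = 0 -> forall i, c i = 0.

Definition module_basis (M B : set E) : Prop :=
  [/\ B `<=` M, M `<=` lspan B & lin_indep B].

Definition free_module (M : set E) : Prop := exists B, module_basis M B.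

Definition sum_set (M N : set E) : set E :=
  [set x | exists u v, [/\ M u, N v & x = u + v]].

(** For submodules U of W, the images of the b i form a basis of W / U. *)
Definition quotient_basis (W U : set E) n (b : 'I_n -> E) : Prop :=
  [/\ forall i, W (b i),
      forall w, W w -> exists c : 'I_n -> A, U (w - \sum_i c i *: b i)
    & forall c : 'I_n -> A, U (\sum_i c i *: b i) -> forall i, c i = 0].

End Modules.

Section QuotientDimension.
Variables (K : fieldType) (E : lmodType K).

Definition quotient_dim_is (W U : set E) (n : nat) : Prop :=
  exists b : 'I_n -> E, quotient_basis W U b.

Definition quotient_findim (W U : set E) : Prop :=
  exists n, quotient_dim_is W U n.

(** The value is 0 when W / U is infinite-dimensional. *)
Definition quotient_dim (W U : set E) : nat := xget 0%N (quotient_dim_is W U).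

End QuotientDimension.

(** * The field of rational functions as a vector space over K *)

Definition ratfun (K : fieldType) (n : nat) : Type := {fraction {mpoly K[n]}}.
HB.instance Definition _ K n := GRing.Field.on (ratfun K n).

Section RatFun.
Variables (K : fieldType) (n : nat).

Definition ratfun_of (f : {mpoly K[n]}) : ratfun K n := tofrac f.

Definition ratfun_scale (c : K) (x : ratfun K n) : ratfun K n :=
  ratfun_of c%:MP * x.

Fact ratfun_scaleA c e x :
  ratfun_scale c (ratfun_scale e x) = ratfun_scale (c * e) x.
Proof. by rewrite /ratfun_scale /ratfun_of mpolyCM tofracM mulrA. Qed.

Fact ratfun_scale1 : left_id 1 ratfun_scale.
Proof. by move=> x; rewrite /ratfun_scale /ratfun_of mpolyC1 tofrac1 mul1r. Qed.

Fact ratfun_scaleDr : right_distributive ratfun_scale +%R.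
Proof. by move=> c x y; rewrite /ratfun_scale mulrDr. Qed.

Fact ratfun_scaleDl x : {morph ratfun_scale^~ x : c e / c + e}.
Proof. by move=> c e; rewrite /ratfun_scale /ratfun_of mpolyCD tofracD mulrDl. Qed.

HB.instance Definition _ := GRing.Zmodule_isLmodule.Build K (ratfun K n)
  ratfun_scaleA ratfun_scale1 ratfun_scaleDr ratfun_scaleDl.

(** deg f <= p, for p in Z: msize f is deg f + 1 if f != 0 and 0 if f = 0, so
    that the zero polynomial has degree -oo. *)
Definition deg_le (f : {mpoly K[n]}) (p : int) : bool :=
  ((msize f)%:Z <= p + 1)%R.

End RatFun.

(** * Arrangements *)

Section Arrangement.
Variables (K : fieldType) (V : vectType K).

Local Notation ell := (\dim {:V}).

(** S(V^* ) is realised as the polynomial ring in the coordinates 'X_i dual to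
    the basis [vbasis {:V}] of V; the element of S(V^* ) given by a linear form
    a is then the sum of the a(e_i) 'X_i. *)
Definition linform (a : 'Hom(V, K^o)) : {mpoly K[ell]} :=
  \sum_(i < ell) (a (vbasis {:V})`_i : K) *: 'X_i.

Variable Delta : {fset 'Hom(V, K^o)}.

Inductive locring : set (ratfun K ell) :=
| locring_poly f : locring (ratfun_of f)
| locring_inv a : a \in Delta -> locring (ratfun_of (linform a))^-1
| locring_add x y : locring x -> locring y -> locring (x + y)
| locring_mul x y : locring x -> locring y -> locring (x * y).

Definition Rfilt (p q : int) : set (ratfun K ell) :=
  lspan [set x | locring x /\
    exists f g, [/\ g != 0, x = ratfun_of f / ratfun_of g,
                    deg_le f p & deg_le g q]].

Definition Rfilt_lower (p q : int) : set (ratfun K ell) :=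
  sum_set (Rfilt (p - 1) q) (Rfilt p (q - 1)).

Definition dimRbar (p q : int) : nat :=
  quotient_dim (Rfilt p q) (Rfilt_lower p q).

(** The terms with p < 0 or q < 0 are zero, cf. [Rfilt_neg] below. *)
Definition Poin : fps2 := fun q p => (dimRbar p q)%:R.

(** Der is an S-submodule of the S-module of all maps S -> S. *)
Definition vfield : Type := {mpoly K[ell]} -> ({mpoly K[ell]}^o).
HB.instance Definition _ := GRing.Lmodule.on vfield.

Definition is_derivation (theta : {mpoly K[ell]} -> {mpoly K[ell]}) : Prop :=
  (forall (c : K) f g, theta (c *: f + g) = c *: theta f + theta g) /\
  (forall f g, theta (f * g) = theta f * g + f * theta g).

Definition Dmod : set vfield :=
  [set theta | is_derivation theta /\
     forall a, a \in Delta -> exists h, theta (linform a) = linform a * h].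

Definition free_arrangement : Prop := free_module Dmod.

Definition homogeneous_der (p : nat) (theta : vfield) : Prop :=
  forall a : 'Hom(V, K^o), (theta (linform a) : {mpoly K[ell]}) \is p.-homog.

Definition exponents (d : 'I_ell -> nat) : Prop :=
  exists theta : 'I_ell -> vfield,
    [/\ injective theta, module_basis Dmod (range theta)
      & forall i, homogeneous_der (d i) (theta i)].

Lemma Rfilt_neg (p q : int) : (p < 0)%R || (q < 0)%R -> Rfilt p q = [set 0].
Proof.
have msize_neg (f : {mpoly K[ell]}) (m : int) : (m < 0)%R -> deg_le f m -> f = 0.
  rewrite /deg_le -lezD1 => m0 fm.
  apply/eqP; rewrite -msize_poly_eq0 -leqn0.
  by rewrite -(lez_nat _ 0); exact: Order.le_trans fm m0.
move=> pq; apply/seteqP; split => x /=; last first.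
  by move=> ->; exists 0%N, (fun=> 0), (fun=> 0); rewrite big_ord0; split => // -[].
move=> [m [c [y [Gy ->]]]]; rewrite big1 // => i _.
have [_ [f [g [g0 yE fp gq]]]] := Gy i; rewrite yE.
case/orP: pq => [/msize_neg/(_ fp) ->|/msize_neg/(_ gq) g00].
  by rewrite /ratfun_of tofrac0 mul0r scaler0.
by rewrite g00 eqxx in g0.
Qed.

End Arrangement.

(* Main.v *)
Require Import Defs.
From HB Require Import structures.
From mathcomp Require Import all_boot all_order all_algebra.
From mathcomp Require Import all_fingroup all_solvable all_field all_character.
From mathcomp Require Import finmap boolp classical_sets functions.
From mathcomp Require Import mpoly.
From mathcomp Require Import ring zify.

Set Implicit Arguments.
Unset Strict Implicit.
Unset Printing Implicit Defensive.

Import GRing.Theory.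
Local Open Scope ring_scope.

(** The piece [R^p_q] of the localization consists of the combinations of the
    fractions f / (a_1 ... a_k) with deg f <= p, k <= q and all a_i in Delta:
    linear forms are prime, so a reduced fraction has no other denominators
    ([RfiltE]). An iterated partial fraction expansion, along one form at a
    time, rewrites every such fraction in terms of normal forms
    ([filt_span]), and iterated residues show that the normal forms are
    linearly independent ([ncomb_indep]). Hence the Poincare series counts
    normal forms. Allowing no pole along a form v deletes v from the
    arrangement, while prescribing a pole along v restricts the arrangement to
    the hyperplane of v. The series thus obeys the deletion-restriction
    recursion [chi], and it is the homogenized characteristic polynomial
    chi(A, B) at A = 1/(1-s) and B = 1 - 1/(1-t) ([hilbE], [Poin_chi]).

    For a free arrangement Terao's theorem ([chi_free]) factors chi(A, B) as
    the product of the A - d_i B, and at these values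
    A - d_i B = (1-s)^-1 (1-t)^-1 (1 + (d_i - 1 - s d_i) t)
    ([series_factor]); this is the formula.

    Terao's theorem is proved by counting points. Over a field F with q
    elements, chi(q, 1) is the number of points of F^n outside the arrangement
    ([card_complement]), and chi depends only on the ranks of the sets of forms
    ([chi_rank]). By Saito's criterion ([saito_det]), the coefficient matrix
    of a basis theta_1, ..., theta_n of the logarithmic derivations has for
    determinant a nonzero multiple of the product of the forms. This identity,
    the logarithmic conditions and the ranks all amount to polynomial
    identities between finitely many elements of K, so they persist over
    arbitrarily large finite fields ([specialization], [free_reduction]).

    Over F, the derivation mapping X_j to X_j^q - X_j is logarithmic for every
    arrangement, because a |-> a^q is additive. Cramer's rule writes it as
    f_1 theta_1 + ... + f_n theta_n with deg f_i <= q - d_i. The common zeros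
    of the f_i are exactly the F-rational points outside the arrangement:
    there the matrix of the theta_i is invertible and the X_j^q - X_j vanish;
    conversely, differentiating X_j^q - X_j = sum_i f_i theta_i(X_j) at a
    common zero shows that both this matrix and the Jacobian of the f_i are
    invertible. So all the zeros are simple; none lies at infinity, since the
    leading forms of the f_i generate an ideal containing the X_j^q; and Bezout
    gives the product of the q - d_i as their number ([bezout_count],
    [free_complement_card]). That form of Bezout is proved by comparing the
    growth, degree by degree, of the polynomial ring in X_1, ..., X_n with
    that of the module over F[f_1, ..., f_n] generated by the delta functions
    of the zeros. As q is arbitrarily large, chi(X, 1) and the product of the
    X - d_i are equal. *)

(** * Linear forms and linear substitutions *)

(** Linear forms are handled through their row vectors of coordinates, so that
    subspaces of linear forms are row spaces of matrices. *)
Definition lform (R : nzRingType) n (v : 'rV[R]_n) : {mpoly R[n]} :=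
  \sum_i v 0 i *: 'X_i.

Section LinearForms.
Variable K : fieldType.

Lemma lformP n a (u v : 'rV[K]_n) : lform (a *: u + v) = a *: lform u + lform v.
Proof.
rewrite /lform scaler_sumr -big_split; apply: eq_bigr => i _ /=.
by rewrite !mxE scalerDl scalerA.
Qed.

Lemma lform0 n : lform (0 : 'rV[K]_n) = 0.
Proof. by rewrite /lform big1 // => i _; rewrite mxE scale0r. Qed.

Lemma lformD n (u v : 'rV[K]_n) : lform (u + v) = lform u + lform v.
Proof. by rewrite -[u]scale1r lformP !scale1r. Qed.

Lemma lformZ n a (v : 'rV[K]_n) : lform (a *: v) = a *: lform v.
Proof. by rewrite -[a *: v]addr0 lformP lform0 addr0. Qed.

Lemma lformN n (v : 'rV[K]_n) : lform (- v) = - lform v.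
Proof. by rewrite -scaleN1r lformZ scaleN1r. Qed.

Lemma lformB n (u v : 'rV[K]_n) : lform (u - v) = lform u - lform v.
Proof. by rewrite lformD lformN. Qed.

Lemma lform_sum n I (r : seq I) (F : I -> 'rV[K]_n) :
  lform (\sum_(i <- r) F i) = \sum_(i <- r) lform (F i).
Proof. by apply: (big_morph _ (@lformD n) (@lform0 n)). Qed.

Lemma lform_coef n (v : 'rV[K]_n) i : (lform v)@_(U_(i)%MM) = v 0 i.
Proof.
rewrite /lform raddf_sum (bigD1 i) //= big1 => [|j ji].
  by rewrite mcoeffZ mcoeffXU eqxx mulr1 addr0.
by rewrite mcoeffZ mcoeffXU (negPf ji) mulr0.
Qed.

Lemma lform_eq0 n (v : 'rV[K]_n) : (lform v == 0) = (v == 0).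
Proof.
apply/eqP/eqP => [v0|->]; last exact: lform0.
by apply/rowP => i; rewrite -lform_coef v0 mcoeff0 mxE.
Qed.

Lemma lform_delta n (i : 'I_n) : lform (delta_mx 0 i : 'rV[K]_n) = 'X_i.
Proof.
rewrite /lform (bigD1 i) //= mxE !eqxx scale1r big1 ?addr0 // => j ji.
by rewrite mxE (negPf ji) andbF scale0r.
Qed.

Lemma msize_lform n (v : 'rV[K]_n) : (msize (lform v) <= 2)%N.
Proof.
apply: leq_trans (msize_sum _ _ _) _; apply/bigmax_leqP => i _.
by apply: leq_trans (msizeZ_le _ _) _; rewrite msizeX mdeg1.
Qed.

(** The algebra morphism that extends the linear map [v |-> v *m P] on linear
    forms. *)
Definition msubst n m (P : 'M[K]_(n, m)) (f : {mpoly K[n]}) : {mpoly K[m]} :=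
  f \mPo [tuple lform (row i P) | i < n].

HB.instance Definition _ n m P := GRing.LRMorphism.copy (@msubst n m P)
  (comp_mpoly [tuple lform (row i P) | i < n]).

Lemma msubstX n m (P : 'M_(n, m)) i : msubst P 'X_i = lform (row i P).
Proof. by rewrite /msubst comp_mpolyXU -tnth_nth tnth_mktuple. Qed.

Lemma msubst_lform n m (P : 'M_(n, m)) v : msubst P (lform v) = lform (v *m P).
Proof.
rewrite mulmx_sum_row lform_sum {1}/lform linear_sum /=.
by apply: eq_bigr => i _; rewrite linearZ /= msubstX lformZ.
Qed.

Lemma msubstE n m (P : 'M_(n, m)) f :
  msubst P f = \sum_(mm <- msupp f) f@_mm *: msubst P 'X_[mm].
Proof.
rewrite {1}[f]mpolyE (linear_sum (msubst P)).
by apply: eq_bigr => mm _; rewrite linearZ.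
Qed.

Lemma msubst_ext n m (g : {lrmorphism {mpoly K[n]} -> {mpoly K[m]}}) (P : 'M_(n, m)) :
  (forall i, g 'X_i = lform (row i P)) -> g =1 msubst P.
Proof.
move=> gX f; rewrite [f]mpolyE !linear_sum; apply: eq_bigr => mm _.
rewrite !linearZ; congr (_ *: _) => /=.
rewrite mpolyXE_id !rmorph_prod; apply: eq_bigr => i _.
by rewrite !rmorphXn /= gX msubstX.
Qed.

Lemma msubst_comp n m l (P : 'M_(n, m)) (Q : 'M_(m, l)) f :
  msubst Q (msubst P f) = msubst (P *m Q) f.
Proof.
apply: (msubst_ext (g := msubst Q \o msubst P)) => i /=.
by rewrite msubstX msubst_lform -row_mul.
Qed.

Lemma msubst1 n f : msubst (1%:M : 'M_n) f = f.
Proof.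
apply/esym/(msubst_ext (g := idfun)) => i /=.
by rewrite row1 lform_delta.
Qed.

Lemma msizeM_bound n (f g : {mpoly K[n]}) a b :
  (msize f <= a -> msize g <= b -> msize (f * g) <= (a + b).-1)%N.
Proof.
have [->|f0] := eqVneq f 0; first by rewrite mul0r msize0.
have [->|g0] := eqVneq g 0; first by rewrite mulr0 msize0.
by move=> fa gb; rewrite msizeM // -!subn1 leq_sub2r // leq_add.
Qed.

Lemma msize_prod_bound n I (r : seq I) (F : I -> {mpoly K[n]}) (d : I -> nat) :
  (forall i, msize (F i) <= (d i).+1)%N ->
  (msize (\prod_(i <- r) F i) <= (\sum_(i <- r) d i).+1)%N.
Proof.
move=> Fd; elim: r => [|i r IH]; first by rewrite !big_nil msize1.
by rewrite !big_cons; apply: leq_trans (msizeM_bound (Fd i) IH) _; lia.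
Qed.

Lemma msize_exp_bound n (f : {mpoly K[n]}) k d :
  (msize f <= d.+1)%N -> (msize (f ^+ k) <= (d * k).+1)%N.
Proof.
move=> fd; have := @msize_prod_bound n _ (iota 0 k) (fun=> f) (fun=> d) (fun=> fd).
by rewrite !big_const_seq !count_predT !size_iota iter_mulr_1 iter_addn_0.
Qed.

Lemma msize_sum_bound n I (r : seq I) (P : pred I) (F : I -> {mpoly K[n]}) d :
  (forall i, P i -> msize (F i) <= d)%N -> (msize (\sum_(i <- r | P i) F i) <= d)%N.
Proof.
move=> Fd; elim/big_ind: _ => //; first by rewrite msize0.
by move=> x y xd yd; apply: leq_trans (msizeD_le _ _) _; rewrite geq_max xd.
Qed.

Lemma msize_supp_bound n (f : {mpoly K[n]}) d :
  (forall m, m \in msupp f -> mdeg m < d)%N -> (msize f <= d)%N.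
Proof.
move=> fd; rewrite [f]mpolyE big_seq; apply: msize_sum_bound => m /fd mf.
by apply: leq_trans (msizeZ_le _ _) _; rewrite msizeX.
Qed.

Lemma msize_msubst n m (P : 'M_(n, m)) f : (msize (msubst P f) <= msize f)%N.
Proof.
rewrite msubstE big_seq; apply: msize_sum_bound => mm mf.
apply: leq_trans (msizeZ_le _ _) _.
rewrite /= mpolyXE_id rmorph_prod.
apply: leq_trans (_ : _ <= (mdeg mm).+1)%N _; last exact: msize_mdeg_lt.
rewrite mdegE; apply: msize_prod_bound => i; rewrite rmorphXn /= msubstX.
by rewrite -[X in (_ <= X.+1)%N]mul1n; apply/msize_exp_bound/msize_lform.
Qed.

(** A monomial is moved to its image by replacing one variable at a time. The
    cofactors have smaller degree because that variable is split off. *)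
Lemma msubst_sub n (P : 'M[K]_n) (f : {mpoly K[n]}) :
  exists w : 'I_n -> {mpoly K[n]},
    f - msubst P f = \sum_i lform (delta_mx 0 i - row i P) * w i /\
    forall i, (msize (w i) <= (msize f).-1)%N.
Proof.
have mono m : exists w : 'I_n -> {mpoly K[n]},
    'X_[m] - msubst P 'X_[m] = \sum_i lform (delta_mx 0 i - row i P) * w i /\
    forall i, (msize (w i) <= mdeg m)%N.
  have [k] := ubnP (mdeg m); elim: k m => // k IH m mk.
  have [m0|] := eqVneq (mdeg m) 0%N.
    have -> : m = 0%MM by apply/eqP; rewrite -mdeg_eq0 m0.
    exists (fun=> 0); split; last by move=> i; rewrite msize0.
    by rewrite mpolyX0 rmorph1 subrr big1 // => i _; rewrite mulr0.
  rewrite mdeg_eq0 => m0.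
  have [j mj] : exists j, m j != 0%N.
    apply/existsP; apply: contraR m0 => /existsPn m0; apply/eqP/mnmP => i.
    by rewrite mnm0E; apply/eqP; move: (m0 i); rewrite negbK.
  set m' := (m - U_(j))%MM; have mE : m = (U_(j) + m')%MM.
    by rewrite addmC submK // lep1mP.
  have dm : mdeg m = (mdeg m').+1 by rewrite mE mdegD mdeg1.
  have [|w [wE wm]] := IH m'; first by rewrite dm in mk.
  exists (fun i => (i == j)%:R *: 'X_[m'] + lform (row j P) * w i); split.
    rewrite mE mpolyXD rmorphM /= msubstX.
    under eq_bigr => i _ do rewrite mulrDr mulrCA.
    rewrite big_split -mulr_sumr -wE (bigD1 j) //= big1 => [|i ij].
      rewrite eqxx scale1r addr0 lformB lform_delta; ring.
    by rewrite (negPf ij) scale0r mulr0.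
  move=> i; apply: leq_trans (msizeD_le _ _) _; rewrite geq_max; apply/andP; split.
    by apply: leq_trans (msizeZ_le _ _) _; rewrite msizeX dm.
  by apply: leq_trans (msizeM_bound (msize_lform _) (wm i)) _; rewrite dm.
pose w m := projT1 (cid (mono m)).
have wE m := projT2 (cid (mono m)).
exists (fun i => \sum_(m <- msupp f) f@_m *: w m i); split; last first.
  move=> i; rewrite big_seq; apply: msize_sum_bound => m mf.
  apply: leq_trans (msizeZ_le _ _) _; apply: leq_trans ((wE m).2 i) _.
  by have := msize_mdeg_lt mf; lia.
have -> : f - msubst P f = \sum_(m <- msupp f) f@_m *: ('X_[m] - msubst P 'X_[m]).
  rewrite (msubstE P f) {1}[f]mpolyE -sumrB.
  by apply: eq_bigr => m _; rewrite scalerBr.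
under [RHS]eq_bigr => i _ do rewrite mulr_sumr.
rewrite exchange_big /=; apply: eq_bigr => m _.
rewrite (wE m).1 scaler_sumr.
by apply: eq_bigr => i _; rewrite scalerAr.
Qed.

End LinearForms.

(** * Restriction to a subspace, and the filtration by degree and poles *)

Section Restriction.
Variables (K : fieldType) (n : nat).
Implicit Types (U : 'M[K]_n) (v : 'rV[K]_n) (f g h : {mpoly K[n]}).

(** The projection of the space of linear forms onto its quotient by [U]; the
    quotient has the coordinates of the zero locus of [U]. *)
Definition quo_mx U : 'M_(n, \rank (cokermx U)) := col_base (cokermx U).

Lemma quo_mxE U v : (v *m quo_mx U == 0) = (v <= U)%MS.
Proof.
rewrite submxE; apply/eqP/eqP => [v0|v0].
  by rewrite -(mulmx_base (cokermx U)) mulmxA v0 mul0mx.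
have := row_base_free (cokermx U) => /row_freeP [B RB].
rewrite -[_ *m _]mulmx1 -RB mulmxA -(mulmxA v).
by rewrite mulmx_base v0 mul0mx.
Qed.

Definition mrestr U f := msubst (quo_mx U) f.
HB.instance Definition _ U := GRing.LRMorphism.copy (mrestr U) (msubst (quo_mx U)).

(** A section of the restriction, given by a choice of complement to [U]. *)
Definition mlift U (g : {mpoly K[\rank (cokermx U)]}) : {mpoly K[n]} := msubst (pinvmx (quo_mx U)) g.
Arguments mlift : clear implicits.
HB.instance Definition _ U := GRing.LRMorphism.copy (mlift U) (msubst (pinvmx (quo_mx U))).

Lemma mliftK U : cancel (mlift U) (mrestr U).
Proof.
move=> g; rewrite /mrestr /mlift msubst_comp mulVpmx ?msubst1 //.
exact: col_base_full.
Qed.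

Lemma mrestr_lform U v : (mrestr U (lform v) == 0) = (v <= U)%MS.
Proof. by rewrite /mrestr msubst_lform lform_eq0 quo_mxE. Qed.

Lemma msize_mrestr U f : (msize (mrestr U f) <= msize f)%N.
Proof. exact: msize_msubst. Qed.

Lemma msize_mlift U (g : {mpoly K[\rank (cokermx U)]}) : (msize (mlift U g) <= msize g)%N.
Proof. exact: msize_msubst. Qed.

Lemma mlift_sub U f : exists w : 'I_n -> {mpoly K[n]},
  f - mlift U (mrestr U f) = \sum_i lform (row i U) * w i /\
  forall i, (msize (w i) <= (msize f).-1)%N.
Proof.
set P := quo_mx U *m pinvmx (quo_mx U).
have [w [fE wd]] := msubst_sub P f.
have PU i : (delta_mx 0 i - row i P <= U)%MS.
  rewrite -quo_mxE mulmxBl row_mul -mulmxA mulVpmx ?mulmx1 ?col_base_full //.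
  by rewrite -rowE subrr.
pose a i := (delta_mx 0 i - row i P) *m pinvmx U.
exists (fun j => \sum_i a i 0 j *: w i); split; last first.
  move=> j; apply: msize_sum_bound => i _.
  by apply: leq_trans (msizeZ_le _ _) _.
rewrite /mlift /mrestr msubst_comp fE.
under [RHS]eq_bigr => j _ do rewrite mulr_sumr.
rewrite exchange_big /=; apply: eq_bigr => i _.
rewrite -(mulmxKpV (PU i)) -/(a i) mulmx_sum_row lform_sum mulr_suml.
by apply: eq_bigr => j _; rewrite lformZ -scalerAr scalerAl.
Qed.

Lemma mrestr_sub U U' f : (U <= U')%MS -> mrestr U f = 0 -> mrestr U' f = 0.
Proof.
move=> UU' f0; have [w [fE _]] := mlift_sub U f.
rewrite f0 rmorph0 subr0 in fE; rewrite fE rmorph_sum big1 // => i _.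
rewrite rmorphM /=; apply/eqP; rewrite mulf_eq0 mrestr_lform.
by rewrite (submx_trans (row_sub i U) UU').
Qed.

(** The ideal of the hyperplane of [v] is principal. Since the ring of the
    hyperplane is a domain, [v] is then a prime element, which gives all the
    unique factorization needed. *)
Lemma mrestr_gen v f : mrestr <<v>>%MS f = 0 -> exists w, f = lform v * w.
Proof.
move=> f0; have [w [fE _]] := mlift_sub <<v>>%MS f.
rewrite f0 rmorph0 subr0 in fE.
have rv i : (row i <<v>>%MS <= v)%MS.
  by rewrite (submx_trans (row_sub i _)) ?genmxE.
have /all_sig [a aE] i : {a | row i <<v>>%MS = a *: v}.
  by apply: cid; have /sub_rVP [a ->] := rv i; exists a.
exists (\sum_i a i *: w i); rewrite fE mulr_sumr; apply: eq_bigr => i _.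
by rewrite aE lformZ -scalerAl scalerAr.
Qed.

Definition pdvd (f g : {mpoly K[n]}) := exists w, g = f * w.

Lemma lform_dvdP v f : pdvd (lform v) f <-> mrestr <<v>>%MS f = 0.
Proof.
split=> [[w ->]|/mrestr_gen //]; rewrite rmorphM /=.
by apply/eqP; rewrite mulf_eq0 mrestr_lform genmxE submx_refl.
Qed.

Lemma lform_prime v f g :
  pdvd (lform v) (f * g) -> pdvd (lform v) f \/ pdvd (lform v) g.
Proof.
rewrite !lform_dvdP rmorphM /= => /eqP; rewrite mulf_eq0.
by case/orP => /eqP; [left|right].
Qed.

Lemma lform_dvd_lform v w : pdvd (lform v) (lform w) -> (w <= v)%MS.
Proof. by rewrite lform_dvdP => /eqP; rewrite mrestr_lform genmxE. Qed.

End Restriction.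
Arguments mlift {K n}.

HB.instance Definition _ (K : fieldType) n :=
  GRing.RMorphism.copy (@ratfun_of K n) (@tofrac {mpoly K[n]}).

Section Filtration.
Variables (K : fieldType) (n : nat).
Notation E := (ratfun K n).
Notation i_ := (@ratfun_of K n).
Implicit Types (U : 'M[K]_n) (v : 'rV[K]_n) (f g h : {mpoly K[n]}) (x y z : E).
Implicit Types (L : seq 'rV[K]_n).

Lemma ratfun_of_inj : injective i_.
Proof. by move=> f g /eqP; rewrite /ratfun_of tofrac_eq => /eqP. Qed.

Lemma ratfun_of_eq0 f : (i_ f == 0) = (f == 0).
Proof. exact: tofrac_eq0. Qed.

Lemma ratfun_scaleE (c : K) y : c *: y = i_ c%:MP * y.
Proof. by []. Qed.

Lemma ratfun_ofZ c f : i_ (c *: f) = c *: i_ f.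
Proof. by rewrite ratfun_scaleE -rmorphM mul_mpolyC. Qed.

Lemma ratfun_scaleAr (c : K) x y : x * (c *: y) = c *: (x * y).
Proof. by rewrite !ratfun_scaleE mulrCA. Qed.

Lemma ratfun_scaleAl (c : K) x y : (c *: x) * y = c *: (x * y).
Proof. by rewrite !ratfun_scaleE mulrA. Qed.

Notation "\l v" := (i_ (lform v)) (at level 9).

(** Rational functions whose poles are along [L], of total order less than
    [Q], with numerators of [msize] at most [P]; both bounds are strict (recall
    that [msize] is the degree plus one), so that the space is zero when [P] or
    [Q] is. The recursion on [L] expands with respect to the pole order [k]
    along the first form. The factor [0 < Q] makes the space zero for [Q = 0]
    when no form is left. *)
Fixpoint filt L (P Q : nat) (y : E) : Prop :=
  if L is v :: L' then
    exists Y : nat -> E, (forall k, (k < Q)%N -> filt L' P (Q - k) (Y k)) /\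
      y = \sum_(k < Q) (\l v) ^- k * Y k
  else exists2 f, (msize f <= (0 < Q) * P)%N & y = i_ f.

Lemma filt0 L P Q : filt L P Q 0.
Proof.
elim: L P Q => [|v L IH] P Q /=; first by exists 0; rewrite ?msize0 ?rmorph0.
by exists (fun=> 0); split=> // ; rewrite big1 // => k _; rewrite mulr0.
Qed.

Lemma filtD L P Q x y : filt L P Q x -> filt L P Q y -> filt L P Q (x + y).
Proof.
elim: L P Q x y => [|v L IH] P Q x y /=.
  move=> [f fd ->] [g gd ->]; exists (f + g); rewrite ?rmorphD //.
  by apply: leq_trans (msizeD_le _ _) _; rewrite geq_max fd.
move=> [X [Xd ->]] [Y [Yd ->]]; exists (fun k => X k + Y k); split.
  by move=> k kQ; apply: IH; auto.
by rewrite -big_split; apply: eq_bigr => k _; rewrite mulrDr.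
Qed.

Lemma filtZ L P Q c x : filt L P Q x -> filt L P Q (c *: x).
Proof.
elim: L P Q x => [|v L IH] P Q x /=.
  move=> [f fd ->]; exists (c *: f); rewrite ?ratfun_ofZ //.
  exact: leq_trans (msizeZ_le _ _) fd.
move=> [X [Xd ->]]; exists (fun k => c *: X k); split; first by auto.
by rewrite scaler_sumr; apply: eq_bigr => k _; rewrite ratfun_scaleAr.
Qed.

Lemma filt_sum L P Q I (r : seq I) (A : pred I) (F : I -> E) :
  (forall i, A i -> filt L P Q (F i)) -> filt L P Q (\sum_(i <- r | A i) F i).
Proof.
move=> FF; elim/big_ind: _ => //; first exact: filt0.
exact: filtD.
Qed.

Lemma filt_Q0 L P y : filt L P 0 y -> y = 0.
Proof.
case: L => [|v L] /=; last by move=> [Y [_ ->]]; rewrite big_ord0.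
by move=> [f]; rewrite leqn0 msize_poly_eq0 => /eqP -> ->; rewrite rmorph0.
Qed.

Lemma filt_term v L P Q k y :
  filt L P Q y -> filt (v :: L) P (Q + k) ((\l v) ^- k * y).
Proof.
case: Q => [/filt_Q0 ->|Q yd]; first by rewrite mulr0; exact: filt0.
exists (fun j => if j == k then y else 0); split=> [j jQ|].
  by case: eqP => [->|_]; [rewrite addnK|exact: filt0].
have kQ : (k < Q.+1 + k)%N by lia.
rewrite (bigD1 (Ordinal kQ)) //= eqxx big1 ?addr0 // => j.
by rewrite -val_eqE /= => /negPf ->; rewrite mulr0.
Qed.

Lemma filt_cons v L P Q y : filt L P Q y -> filt (v :: L) P Q y.
Proof.
by move=> yd; have := @filt_term v L P Q 0 y yd; rewrite addn0 expr0 invr1 mul1r.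
Qed.

Lemma filt_le L P Q P' Q' y :
  (P <= P')%N -> (Q <= Q')%N -> filt L P Q y -> filt L P' Q' y.
Proof.
elim: L P Q P' Q' y => [|v L IH] P Q P' Q' y PP QQ.
  move=> [f fd ->]; exists f => //; apply: leq_trans fd _.
  by rewrite leq_mul //; case: Q QQ => // Q; case: Q'.
move=> [Y [Yd ->]]; apply: filt_sum => k _.
have -> : Q' = ((Q' - k) + k)%N by have := ltn_ord k; lia.
by apply: filt_term; apply: IH (Yd k (ltn_ord k)); lia.
Qed.

Lemma filt_pole L P Q v y :
  v \in L -> filt L P Q y -> filt L P Q.+1 ((\l v)^-1 * y).
Proof.
elim: L P Q y => // u L IH P Q y; rewrite inE => /predU1P [<-|vL] [Y [Yd ->]];
  rewrite mulr_sumr; apply: filt_sum => k _; have kQ := ltn_ord k.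
  rewrite mulrA -invfM -exprS.
  have -> : Q.+1 = ((Q - k) + k.+1)%N by lia.
  by apply: filt_term; apply: Yd.
rewrite mulrCA; have -> : Q.+1 = ((Q - k).+1 + k)%N by lia.
by apply/filt_term/IH => //; apply: Yd.
Qed.

Lemma filt_poly L P Q f : (msize f <= P)%N -> (0 < Q)%N -> filt L P Q (i_ f).
Proof.
move=> fP Q0; elim: L => [|v L IH]; last exact: filt_cons.
by exists f => //; rewrite Q0 mul1n.
Qed.

(** Membership in the local ring of the generic point of the zero locus of
    [U]. *)
Definition regular_at U y :=
  exists g h, mrestr U g != 0 /\ i_ g * y = i_ h.

Definition vanish_at U y :=
  exists g h, [/\ mrestr U g != 0, i_ g * y = i_ h & mrestr U h = 0].

Lemma regular_at_poly U f : regular_at U (i_ f).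
Proof. by exists 1, f; rewrite rmorph1 oner_neq0 rmorph1 mul1r. Qed.

Lemma regular_atD U x y : regular_at U x -> regular_at U y -> regular_at U (x + y).
Proof.
move=> [g [h [g0 E1]]] [g' [h' [g0' E2]]]; exists (g * g'), (h * g' + h' * g).
split; first by rewrite rmorphM /= mulf_neq0.
by rewrite rmorphD !rmorphM /= -E1 -E2; ring.
Qed.

Lemma regular_atM U x y : regular_at U x -> regular_at U y -> regular_at U (x * y).
Proof.
move=> [g [h [g0 E1]]] [g' [h' [g0' E2]]]; exists (g * g'), (h * h').
split; first by rewrite rmorphM /= mulf_neq0.
by rewrite !rmorphM /= -E1 -E2; ring.
Qed.

Lemma regular_at0 U : regular_at U 0.
Proof. by rewrite -(rmorph0 i_); exact: regular_at_poly. Qed.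

Lemma regular_at_sum U I (r : seq I) (A : pred I) (F : I -> E) :
  (forall i, A i -> regular_at U (F i)) -> regular_at U (\sum_(i <- r | A i) F i).
Proof.
move=> FF; elim/big_ind: _ => //; [exact: regular_at0|exact: regular_atD].
Qed.

Lemma regular_at_pole U v k : ~~ (v <= U)%MS -> regular_at U ((\l v) ^- k).
Proof.
rewrite -mrestr_lform => v0; exists (lform v ^+ k), 1; split.
  by rewrite rmorphXn expf_neq0.
rewrite rmorph1 rmorphXn mulfV // expf_neq0 // ratfun_of_eq0.
by apply: contraNneq v0 => ->; rewrite rmorph0.
Qed.

Fact clear_pole (F : fieldType) (a b c l r x y : F) : r != 0 ->
  c * (b * (a * x) + l * (a * (b * y))) = a * b * r * (c * (r^-1 * (x + l * y))).
Proof. by move=> r0; field. Qed.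

(** This plays the role of a residue. After clearing denominators the relation
    holds between polynomials; modulo [U] its right-hand side vanishes and the
    unit [g''] can be cancelled, and modulo [U + v] the term with the factor
    [v] disappears as well, so that only the term of [x] remains. *)
Lemma vanish_top U v k x y : v != 0 ->
  regular_at (U + v)%MS x -> regular_at (U + v)%MS y ->
  vanish_at U ((\l v) ^- k * (x + \l v * y)) -> vanish_at (U + v)%MS x.
Proof.
move=> v0 [g [h [g0 E1]]] [g' [h' [g0' E2]]] [g'' [h'' [g0'' E3 h0'']]].
exists g, h; split=> //.
have lv0 : \l v != 0 by rewrite ratfun_of_eq0 lform_eq0.
have EE : g'' * (g' * h + lform v * (g * h')) = g * g' * lform v ^+ k * h''.
  apply: ratfun_of_inj; rewrite !(rmorphM, rmorphD) /= -E1 -E2 -E3 rmorphXn.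
  by apply: clear_pole; rewrite expf_neq0.
have := congr1 (mrestr U) EE.
rewrite [in RHS]rmorphM /= h0'' mulr0 rmorphM /= => /eqP.
rewrite mulf_eq0 (negPf g0'') => /eqP /(mrestr_sub (addsmxSl U v)) /eqP.
have v_0 : mrestr (U + v)%MS (lform v) = 0.
  by apply/eqP; rewrite mrestr_lform addsmxSr.
rewrite rmorphD !rmorphM /= v_0 mul0r addr0.
by rewrite mulf_eq0 (negPf g0') => /eqP.
Qed.

End Filtration.

(** * Normal forms of rational functions *)

(** The exponent vectors of the monomials of degree [p] in [m] variables. *)
Fixpoint comps (m p : nat) : seq (seq nat) :=
  if m is m'.+1 then
    flatten [seq [seq k :: s | s <- comps m' (p - k)] | k <- iota 0 p.+1]
  else if p == 0%N then [:: [::]] else [::].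

Lemma compsS m p : comps m.+1 p =
  flatten [seq [seq k :: s | s <- comps m (p - k)] | k <- iota 0 p.+1].
Proof. by []. Qed.

Lemma mem_comps m p s : (s \in comps m p) = (size s == m) && (sumn s == p).
Proof.
elim: m p s => [|m IH] p s; first by case: p => [|p]; case: s.
rewrite compsS; apply/flatten_mapP/idP => [[k]|].
  rewrite mem_iota => /andP [_ kp] /mapP [s' s's ->] /=.
  by move: s's; rewrite IH => /andP [/eqP -> /eqP ->]; rewrite eqxx subnKC //; lia.
case: s => [|k s] // /andP [sm /eqP <-]; exists k; first by rewrite mem_iota /= add0n ltnS leq_addr.
rewrite mem_map; last by move=> ? ? [].
by rewrite IH /= addKn eqxx andbT.
Qed.

Lemma uniq_cons_family (F : nat -> seq (seq nat)) r :
  uniq r -> (forall k, uniq (F k)) ->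
  uniq (flatten [seq [seq k :: s | s <- F k] | k <- r]).
Proof.
move=> ur uF; elim: r ur => //= k r IH /andP [kr /IH ur].
rewrite cat_uniq map_inj_uniq ?uF ?ur ?andbT /=; last by move=> ? ? [].
apply/hasPn => _ /flatten_mapP [j jr /mapP [s _ ->]].
by apply: contraNN kr => /mapP [s' _ [<- _]].
Qed.

Lemma uniq_comps m p : uniq (comps m p).
Proof.
elim: m p => [|m IH] p; first by rewrite /=; case: ifP.
by rewrite compsS; apply: (@uniq_cons_family (fun k => comps m (p - k))) => //; exact: iota_uniq.
Qed.

Lemma sum_triangle (V : nmodType) (G : nat -> nat -> V) Q :
  \sum_(q < Q) \sum_(k < q.+1) G k (q - k)%N =
  \sum_(k < Q) \sum_(q < Q - k) G k q.
Proof.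
elim: Q => [|Q IH]; first by rewrite !big_ord0.
rewrite big_ord_recr IH /= [RHS]big_ord_recr /= subSnn big_ord1.
rewrite [\sum_(k < Q.+1) _]big_ord_recr /= subnn addrA; congr (_ + _).
rewrite -big_split; apply: eq_bigr => k _ /=.
by rewrite subSn ?(ltnW (ltn_ord k)) // big_ord_recr.
Qed.

Section NormalForms.
Variables (K : fieldType) (n : nat).
Notation E := (ratfun K n).
Notation i_ := (@ratfun_of K n).
Implicit Types (U : 'M[K]_n) (v : 'rV[K]_n) (f g h : {mpoly K[n]}) (x y z : E).
Implicit Types (L : seq 'rV[K]_n) (s : seq nat) (c : seq nat -> K).
Notation "\l v" := (i_ (lform v)) (at level 9).

Definition mnm_of m s : 'X_{1..m} := [multinom nth 0%N s i | i < m].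

(** The space of forms to which one restricts after choosing the pole order
    [k] along [v]: without a pole the form [v] is deleted, with a pole the
    remaining factors only matter on the hyperplane of [v]. *)
Definition adjoin_row U v (k : nat) : 'M[K]_n := if k == 0%N then U else (U + v)%MS.

(** A form of [L] in [U] has its pole along the whole zero locus of [U], so that
    nothing can be restricted to this locus. The results on normal forms
    exclude this case. *)
Definition hits L U := has (fun v => (v <= U)%MS) L.

(** The list [s] starts with the pole orders along the forms of [L], and ends
    with the exponents of a monomial on the zero locus of [U] enlarged by all
    the forms along which there is a pole. *)
Fixpoint nform L U s : E :=
  if L is v :: L' then
    (\l v) ^- head 0%N s * nform L' (adjoin_row U v (head 0%N s)) (behead s)
  else i_ (mlift U 'X_[mnm_of _ s]).

(** The number of admissible pole orders along [v]: a pole is excluded when a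
    later form vanishes on the zero locus of [U + v], since it could be traded
    for a pole along that form. *)
Definition npole L U v q := if hits L (U + v)%MS then 1%N else q.+1.

(** The normal forms of degree exactly [p] and total pole order exactly [q]. *)
Fixpoint nidx L U (p q : nat) : seq (seq nat) :=
  if L is v :: L' then
    flatten [seq [seq k :: s | s <- nidx L' (adjoin_row U v k) p (q - k)]
            | k <- iota 0 (npole L' U v q)]
  else if q == 0%N then comps (\rank (cokermx U)) p else [::].

Lemma nidx_cons v L U p q : nidx (v :: L) U p q =
  flatten [seq [seq k :: s | s <- nidx L (adjoin_row U v k) p (q - k)]
          | k <- iota 0 (npole L U v q)].
Proof. by []. Qed.

Definition ncomb L U c P Q : E :=
  \sum_(p < P) \sum_(q < Q) \sum_(s <- nidx L U p q) c s *: nform L U s.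

Lemma uniq_nidx L U p q : uniq (nidx L U p q).
Proof.
elim: L U p q => [|v L IH] U p q; first by rewrite /=; case: ifP => // _; apply: uniq_comps.
by rewrite nidx_cons; apply: (@uniq_cons_family (fun k => nidx L _ p (q - k))) => //; exact: iota_uniq.
Qed.

Lemma nidx_inj L U p q p' q' s :
  s \in nidx L U p q -> s \in nidx L U p' q' -> p = p' /\ q = q'.
Proof.
elim: L U p q p' q' s => [|v L IH] U p q p' q' s.
  rewrite /=; case: q => //=; case: q' => //=; rewrite !mem_comps.
  by move=> /andP [_ /eqP <-] /andP [_ /eqP].
have kq k r : k \in iota 0 (npole L U v r) -> (k <= r)%N.
  by rewrite /npole mem_iota; case: ifP; lia.
rewrite !nidx_cons => /flatten_mapP [k /kq k1 /mapP [t t1 ->]].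
move=> /flatten_mapP [k' /kq k2 /mapP [t' t2 [ek et]]].
rewrite -ek -et in k2 t2; have [-> qq] := IH _ _ _ _ _ _ t1 t2; split=> //; lia.
Qed.

Lemma nform_filt L U p q s : s \in nidx L U p q -> filt L p.+1 q.+1 (nform L U s).
Proof.
elim: L U p q s => [|v L IH] U p q s.
  rewrite /=; case: q => //= /[!mem_comps] /andP [/eqP sm /eqP sp].
  exists (mlift U 'X_[mnm_of _ s]) => //; rewrite mul1n.
  apply: leq_trans (msize_mlift _) _; rewrite msizeX mdegE ltnS.
  rewrite (eq_bigr (fun i : 'I_ _ => nth 0%N s i)); last by move=> i _; rewrite mnmE.
  by rewrite -(big_mkord xpredT (nth 0%N s)) -sm -(big_nth 0%N xpredT id) -sumnE sp.
rewrite nidx_cons => /flatten_mapP [k]; rewrite mem_iota => kk /mapP [t tt ->] /=.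
have -> : q.+1 = ((q - k).+1 + k)%N by move: kk; rewrite /npole; case: ifP; lia.
exact/filt_term/IH.
Qed.

(** Sorting the normal forms by their pole order along the first form. *)
Lemma ncomb_cons v L U c P Q : ncomb (v :: L) U c P Q =
  \sum_(k < if hits L (U + v)%MS then minn 1 Q else Q)
     (\l v) ^- k * ncomb L (adjoin_row U v k) (c \o cons (val k)) P (Q - k).
Proof.
pose G p k q : E :=
  \sum_(s <- nidx L (adjoin_row U v k) p q) (c (k :: s)) *: ((\l v) ^- k * nform L (adjoin_row U v k) s).
have GE p q : \sum_(s <- nidx (v :: L) U p q) c s *: nform (v :: L) U s =
    \sum_(k < npole L U v q) G p k (q - k)%N.
  rewrite nidx_cons big_flatten big_map -{1}[npole _ _ _ _]subn0 -/(index_iota _ _) big_mkord.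
  by apply: eq_bigr => k _; rewrite big_map.
rewrite /ncomb; under eq_bigr => p _ do under eq_bigr => q _ do rewrite GE.
set N := (if _ then minn _ _ else _).
have GN p : \sum_(q < Q) \sum_(k < npole L U v q) G p k (q - k)%N =
    \sum_(k < N) \sum_(q < Q - k) G p k q.
  rewrite /N /npole; case: ifP => _; last exact: sum_triangle.
  under eq_bigr => q _ do rewrite big_ord1.
  have [->|Q0] := posnP Q; first by rewrite minn0 !big_ord0.
  rewrite (minn_idPl _) // big_ord1.
  by rewrite subn0; apply: eq_bigr => q _; rewrite subn0.
under eq_bigr => p _ do rewrite GN.
rewrite exchange_big; apply: eq_bigr => k _ /=.
rewrite mulr_sumr; apply: eq_bigr => p _.
rewrite mulr_sumr; apply: eq_bigr => q _.
by rewrite mulr_sumr; apply: eq_bigr => s _; rewrite ratfun_scaleAr.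
Qed.

(** The error terms of the expansion into normal forms: elements of the ideal
    generated by [U], where the factor in [U] compensates for one more pole.
    For [U = 0] there is no error at all. *)
Definition span_rem L U P Q y := exists w : 'I_n -> E,
  (forall i, filt L P Q.+1 (w i)) /\ y = \sum_i \l (row i U) * w i.

Lemma addsmx_row U v i : exists a (b : K), row i (U + v)%MS = a *m U + b *: v.
Proof.
have /sub_addsmxP [[a b] /= ->] := row_sub i (U + v)%MS.
by exists a, (b 0 0); rewrite [in LHS](mx11_scalar b) mul_scalar_mx.
Qed.

Lemma span_rem_lform L U P Q (a : 'rV_n) w :
  filt L P Q.+1 w -> span_rem L U P Q (\l (a *m U) * w).
Proof.
move=> wd; exists (fun j => a 0 j *: w); split; first by move=> j; exact: filtZ.
rewrite mulmx_sum_row lform_sum rmorph_sum mulr_suml.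
by apply: eq_bigr => j _; rewrite /= lformZ ratfun_ofZ ratfun_scaleAl ratfun_scaleAr.
Qed.

Lemma span_rem0 L U P Q : span_rem L U P Q 0.
Proof.
exists (fun=> 0); split; first by move=> i; exact: filt0.
by rewrite big1 // => i _; rewrite mulr0.
Qed.

Lemma span_remD L U P Q y z :
  span_rem L U P Q y -> span_rem L U P Q z -> span_rem L U P Q (y + z).
Proof.
move=> [w [wd ->]] [w' [wd' ->]]; exists (fun i => w i + w' i); split.
  by move=> i; apply: filtD.
by rewrite -big_split; apply: eq_bigr => i _; rewrite /= mulrDr.
Qed.

Lemma span_rem_sum L U P Q I (r : seq I) (A : pred I) (F : I -> E) :
  (forall i, A i -> span_rem L U P Q (F i)) ->
  span_rem L U P Q (\sum_(i <- r | A i) F i).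
Proof.
by move=> FF; elim/big_ind: _ => //; [exact: span_rem0|exact: span_remD].
Qed.

Lemma span_rem_term v L U P Q k y :
  span_rem L U P Q y -> span_rem (v :: L) U P (Q + k) ((\l v) ^- k * y).
Proof.
move=> [w [wd ->]]; exists (fun i => (\l v) ^- k * w i); split.
  by move=> i; rewrite -addSn; exact: filt_term.
by rewrite mulr_sumr; apply: eq_bigr => i _; rewrite mulrCA.
Qed.

Lemma span_rem_add L U v P Q y : span_rem L (U + v)%MS P Q y ->
  exists z w, [/\ span_rem L U P Q z, filt L P Q.+1 w & y = z + \l v * w].
Proof.
move=> [w [wd ->]].
have /all_sig [a aE] i : {ab : 'rV_n * K | row i (U + v)%MS = ab.1 *m U + ab.2 *: v}.
  by apply: cid; have [a [b ab]] := addsmx_row U v i; exists (a, b).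
exists (\sum_i \l ((a i).1 *m U) * w i), (\sum_i (a i).2 *: w i); split.
- by apply: span_rem_sum => i _; apply: span_rem_lform.
- by apply: filt_sum => i _; apply: filtZ.
rewrite mulr_sumr -big_split; apply: eq_bigr => i _ /=.
by rewrite aE lformD lformZ rmorphD /= mulrDl ratfun_ofZ ratfun_scaleAl ratfun_scaleAr.
Qed.

(** Without poles, the normal forms are the lifts of the monomials on the zero
    locus of [U]. *)
Lemma mlift_ncomb U f P : (msize f <= P)%N ->
  exists c, i_ (mlift U (mrestr U f)) = ncomb [::] U c P 1.
Proof.
move=> fP; set g := mrestr U f; set m := \rank _ in g *.
have gP : (msize g <= P)%N by apply: leq_trans (msize_mrestr _ _) fP.
exists (fun s => g@_(mnm_of m s)).
rewrite /ncomb; under eq_bigr => p _ do rewrite big_ord1 /=.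
pose t (mm : 'X_{1..m}) := tval mm.
transitivity (\sum_(p < P) \sum_(s <- [seq t mm | mm <- msupp g] | sumn s == p)
   g@_(mnm_of m s) *: i_ (mlift U 'X_[mnm_of m s])).
  rewrite (exchange_big_dep xpredT) //= big_map.
  have tE mm : mnm_of m (t mm) = mm.
    by apply/mnmP => i; rewrite mnmE (mnm_nth 0%N).
  rewrite {1}[g]mpolyE linear_sum rmorph_sum big_seq [RHS]big_seq.
  apply: eq_bigr => mm mg; rewrite tE linearZ /= ratfun_ofZ.
  have dP : (mdeg mm < P)%N by apply: leq_trans gP; exact: msize_mdeg_lt.
  have sE : sumn (t mm) = mdeg mm by rewrite sumnE.
  rewrite sE (bigD1 (Ordinal dP)) //= big1 ?addr0 // => i /andP [/eqP iE].
  by rewrite -val_eqE /= iE eqxx.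
apply: eq_bigr => p _; rewrite -[LHS]big_filter.
pose r := [seq s <- [seq t mm | mm <- msupp g] | sumn s == p]; rewrite -/r.
have rs s : s \in r -> s \in comps m p.
  rewrite mem_filter mem_comps => /andP [sp /mapP [mm _ sE]].
  by rewrite sp andbT sE size_tuple.
rewrite [RHS](bigID (mem r)) /= [X in _ + X]big1_seq ?addr0; last first.
  move=> s /andP [sr]; rewrite mem_comps => /andP [sm sp].
  suff -> : g@_(mnm_of m s) = 0 by rewrite scale0r.
  apply/eqP; rewrite mcoeff_eq0; apply: contra sr => sg.
  rewrite mem_filter sp; apply/mapP; exists (mnm_of m s) => //.
  apply: (@eq_from_nth _ 0%N) => [|i im]; first by rewrite size_tuple (eqP sm).
  rewrite (eqP sm) in im; rewrite -[i]/(val (Ordinal im)).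
  by rewrite -(mnm_nth 0%N) mnmE.
rewrite -[RHS]big_filter; apply: perm_big; apply: uniq_perm.
- rewrite filter_uniq // map_inj_uniq ?msupp_uniq // => mm mm' /val_inj.
  by move/val_inj.
- by rewrite filter_uniq // uniq_comps.
by move=> s; rewrite [RHS]mem_filter /=; apply/idP/andP => [sr|[]//]; split=> //; apply: rs.
Qed.

End NormalForms.

(** * The normal forms are a basis *)

Section NormalFormBasis.
Variables (K : fieldType) (n : nat).
Notation E := (ratfun K n).
Notation i_ := (@ratfun_of K n).
Implicit Types (U : 'M[K]_n) (v : 'rV[K]_n) (f g h : {mpoly K[n]}) (x y z : E).
Implicit Types (L : seq 'rV[K]_n) (s : seq nat) (c : seq nat -> K).
Notation "\l v" := (i_ (lform v)) (at level 9).

Lemma ncomb_nil U c P Q : ncomb [::] U c P Q.+1 =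
  i_ (mlift U (\sum_(p < P) \sum_(s <- comps (\rank (cokermx U)) p)
                 c s *: 'X_[mnm_of _ s])).
Proof.
rewrite /ncomb !linear_sum rmorph_sum; apply: eq_bigr => p _.
rewrite big_ord_recl [X in _ + X]big1 ?addr0 => [|q _]; last by rewrite /= big_nil.
rewrite /= !linear_sum rmorph_sum; apply: eq_bigr => s _.
by rewrite linearZ /= ratfun_ofZ.
Qed.

(** The exchange of a pole along [g] for a pole along [b], where [b] is a
    multiple of [g] up to an element [u] of the ideal. *)
Lemma split_pole (F : fieldType) (g b u a y : F) k : g != 0 -> b != 0 ->
  b = u + a * g -> g ^- k.+1 * y = g ^- k * (a * (b^-1 * y)) + u * (g ^- k.+1 * (b^-1 * y)).
Proof.
move=> g0 b0 bE; rewrite exprS invfM.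
have -> : u = b - a * g by rewrite bE addrK.
have : g ^+ k != 0 by rewrite expf_neq0.
by move: (g ^+ k) => G G0; field; rewrite ?g0 ?b0 ?G0.
Qed.

Lemma expN_split (F : fieldType) (a : F) k N : a != 0 -> (k <= N)%N ->
  a ^- N * a ^+ (N - k) = a ^- k.
Proof.
move=> a0 kN; rewrite -{1}(subnK kN) exprD invfM mulrAC mulVf ?mul1r //.
by rewrite expf_neq0.
Qed.

Lemma hits_cons v L U : hits (v :: L) U = (v <= U)%MS || hits L U.
Proof. by []. Qed.

(** The partial fraction algorithm. It treats the pole orders along the first
    form [v] in decreasing order. If a later form [b] lies in [U + v], the top
    pole along [v] is traded for a pole along [b]; otherwise the top coefficient
    is expanded into normal forms relative to [U + v], and the error term, a
    combination of [U] and [v], contributes to the error relative to [U] and to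
    a smaller pole order along [v]. *)
Lemma filt_span L U P Q y : ~~ hits L U -> filt L P Q y ->
  exists c, span_rem L U P Q (y - ncomb L U c P Q).
Proof.
elim: L U P Q y => [|v L IH] U P Q y.
  move=> _ [f]; case: Q => [|Q].
    rewrite /= leqn0 msize_poly_eq0 => /eqP -> ->; exists (fun=> 0).
    rewrite /ncomb rmorph0 big1 ?subr0; first exact: span_rem0.
    by move=> p _; rewrite big_ord0.
  rewrite mul1n => fP ->; have [c cE] := mlift_ncomb U fP; exists c.
  have -> : ncomb [::] U c P Q.+1 = ncomb [::] U c P 1 by rewrite !ncomb_nil.
  rewrite -cE -rmorphB; have [w [-> wd]] := mlift_sub U f.
  exists (i_ \o w); split=> [i|]; last first.
    by rewrite rmorph_sum; apply: eq_bigr => i _; rewrite /= rmorphM.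
  by apply: filt_poly => //; apply: leq_trans (wd i) _; lia.
rewrite hits_cons negb_or => /andP [vU LU] [Y [Yd ->]].
have v0 : \l v != 0.
  by rewrite ratfun_of_eq0 lform_eq0; apply: contraNneq vU => ->; rewrite sub0mx.
set T := hits L (U + v)%MS.
(* The pole orders along v up to N, by induction on N; if T holds, only
   the pole order 0 is left in the result. *)
have claim N : (N < Q)%N -> forall Y : nat -> E,
    (forall k, (k <= N)%N -> filt L P (Q - k) (Y k)) ->
    exists C, span_rem (v :: L) U P Q (\sum_(k < N.+1) (\l v) ^- k * Y k -
      \sum_(k < N.+1 | T ==> (val k == 0%N))
         (\l v) ^- k * ncomb L (adjoin_row U v k) (C (val k)) P (Q - k)).
  elim: N => [|N IHN] NQ {}Y {}Yd.
    have := Yd 0%N isT; rewrite subn0 => /(IH U P Q _ LU) [c cd].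
    exists (fun=> c); rewrite big_ord1 big_mkcond big_ord1 /= implybT.
    by rewrite subn0 -mulrBr; have := span_rem_term v 0 cd; rewrite addn0.
  have [c [w [z [wd zd wz]]]] : exists c w z, [/\ filt L P (Q - N) w,
      span_rem (v :: L) U P Q z &
      (\l v) ^- N.+1 * Y N.+1 - (if T then 0 else
         (\l v) ^- N.+1 * ncomb L (U + v)%MS c P (Q - N.+1)) = (\l v) ^- N * w + z].
    case: (boolP T) => [/hasP [b bL bUv]|LUv].
      have b0 : ~~ (b <= U)%MS by move/hasPn: LU; apply.
      have lb0 : \l b != 0.
        by rewrite ratfun_of_eq0 lform_eq0; apply: contraNneq b0 => ->; rewrite sub0mx.
      have [[u a] /= bE] := sub_addsmxP bUv.
      have lbE : \l b = \l (u *m U) + i_ (a 0 0)%:MP * \l v.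
        by rewrite bE [a in LHS]mx11_scalar mul_scalar_mx lformD lformZ rmorphD /= ratfun_ofZ.
      have bY : filt L P (Q - N) ((\l b)^-1 * Y N.+1).
        by have := filt_pole bL (Yd _ (leqnn _)); rewrite (subnSK (ltnW NQ)).
      exists (fun=> 0), (a 0 0 *: ((\l b)^-1 * Y N.+1)),
        (\l (u *m U) * ((\l v) ^- N.+1 * ((\l b)^-1 * Y N.+1))); split.
      - exact: filtZ.
      - apply: span_rem_lform; have := filt_term v N.+1 bY.
        by rewrite addnS subnK // ltnW // ltnW.
      rewrite subr0 ratfun_scaleE.
      exact: (@split_pole E (\l v) (\l b) (\l (u *m U)) (i_ (a 0 0)%:MP) (Y N.+1) N v0 lb0 lbE).
    have [c cd] := IH _ _ _ _ LUv (Yd _ (leqnn _)).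
    have [z [w [zd wd zw]]] := span_rem_add cd.
    exists c, w, ((\l v) ^- N.+1 * z); split.
    - by rewrite (subnSK (ltnW NQ)) in wd.
    - by have := span_rem_term v N.+1 zd; rewrite subnK // ltnW.
    rewrite -mulrBr zw mulrDr addrC; congr (_ + _).
    by rewrite mulrA exprSr invfM -[X in X * w]mulrA mulVf // mulr1.
  have [|C CE] := IHN (ltnW NQ) (fun k => Y k + (if k == N then w else 0)).
    move=> k kN; apply: filtD; first by apply: Yd; lia.
    by case: eqP => [->|_] //; exact: filt0.
  exists (fun k => if k == N.+1 then c else C k).
  have := span_remD CE zd; congr span_rem.
  have -> : \sum_(k < N.+1) \l v ^- k * (Y k + (if val k == N then w else 0)) =
      \sum_(k < N.+1) \l v ^- k * Y k + \l v ^- N * w.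
    under eq_bigr => k _ do rewrite mulrDr.
    rewrite big_split; congr (_ + _); rewrite big_ord_recr /= eqxx big1 ?add0r //.
    by move=> k _; rewrite (ltn_eqF (ltn_ord k)) mulr0.
  have -> : \sum_(k < N.+2 | T ==> (val k == 0%N)) \l v ^- k *
       ncomb L (adjoin_row U v k) (if val k == N.+1 then c else C (val k)) P (Q - k) =
     \sum_(k < N.+1 | T ==> (val k == 0%N))
       \l v ^- k * ncomb L (adjoin_row U v k) (C (val k)) P (Q - k) +
     (if T then 0 else (\l v) ^- N.+1 * ncomb L (U + v)%MS c P (Q - N.+1)).
    rewrite big_mkcond big_ord_recr /= eqxx implybF; congr (_ + _); last by case: (T).
    rewrite [RHS]big_mkcond; apply: eq_bigr => k _.
    by rewrite /= (ltn_eqF (ltn_ord k)).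
  rewrite [\sum_(k < N.+2) _]big_ord_recr /= opprD addrACA wz (addrAC (\sum_(k < N.+1) _)).
  exact/esym/addrA.
case: Q Yd claim => [_ _|Q Yd claim].
  exists (fun=> 0); rewrite big_ord0 sub0r -[- _]mulN1r.
  by rewrite /ncomb big1 ?mulr0 => [|p _]; [exact: span_rem0|rewrite big_ord0].
have [C CE] := claim Q (leqnn _) Y (fun k kQ => Yd k kQ).
exists (fun s => C (head 0%N s) (behead s)).
rewrite ncomb_cons; move: CE; congr span_rem; congr (_ - _).
rewrite -/T; case: (T) => //=.
rewrite big_mkcond big_ord_recl big1 /= ?addr0; last by [].
by rewrite (minn_idPl _) // big_ord1.
Qed.

Lemma filt_regular L U P Q y : ~~ hits L U -> filt L P Q y -> regular_at U y.
Proof.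
elim: L P Q y => [|v L IH] P Q y /=.
  by move=> _ [f _ ->]; exact: regular_at_poly.
rewrite negb_or => /andP [vU LU] [Y [Yd ->]].
apply: regular_at_sum => k _; apply: regular_atM; first exact: regular_at_pole.
exact: IH (Yd k (ltn_ord k)).
Qed.

Lemma ncomb_filt L U c P Q : filt L P Q (ncomb L U c P Q).
Proof.
apply: filt_sum => p _; apply: filt_sum => q _; rewrite big_seq.
apply: filt_sum => s /nform_filt sd; apply: filtZ.
exact: filt_le sd.
Qed.

(** Given a combination of normal forms vanishing on the zero locus of [U], its
    coefficient of top pole order along the first form [v] vanishes on the
    locus of [U + v], by [vanish_top]. By induction this coefficient is zero,
    and the next pole order becomes the top one. *)
Lemma ncomb_indep L U c P Q : ~~ hits L U -> vanish_at U (ncomb L U c P Q) ->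
  forall p q s, (p < P)%N -> (q < Q)%N -> s \in nidx L U p q -> c s = 0.
Proof.
elim: L U c P Q => [|v L IH] U c P Q.
  case: Q => // Q _; rewrite ncomb_nil; set g := \sum_(p < P) _.
  move=> [a [h [a0 ah h0]]].
  have g0 : g = 0.
    move/(congr1 (mrestr U)): (ratfun_of_inj (etrans (rmorphM _ _ _) ah)).
    rewrite h0 rmorphM /= mliftK => /eqP; rewrite mulf_eq0 (negPf a0).
    by move/eqP.
  move=> p [|q] s pP _ //= sp; have := congr1 (mcoeff (mnm_of _ s)) g0.
  rewrite mcoeff0 raddf_sum (bigD1 (Ordinal pP)) //= [X in _ + X]big1 ?addr0.
    rewrite raddf_sum (bigD1_seq s) ?uniq_comps //= mcoeffZ mcoeffX eqxx mulr1.
    rewrite big_seq_cond big1 ?addr0 // => t /andP [tp ts].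
    rewrite mcoeffZ mcoeffX; case: eqP => [ets|]; last by rewrite mulr0.
    case/eqP: ts; move: tp sp; rewrite !mem_comps => /andP [/eqP st _] /andP [/eqP ss _].
    apply: (@eq_from_nth _ 0%N) => [|i]; first by rewrite st ss.
    rewrite st => im; have := congr1 (fun m : 'X_{1.._} => m (Ordinal im)) ets.
    by rewrite !mnmE.
  move=> p' pp'; rewrite raddf_sum big_seq big1 // => t tp'.
  rewrite /= mcoeffZ mcoeffX; case: eqP => [ets|]; last by rewrite mulr0.
  case/eqP: pp'; apply: val_inj => /=.
  move: tp' sp; rewrite !mem_comps => /andP [/eqP st /eqP <-] /andP [/eqP ss /eqP <-].
  congr sumn; apply: (@eq_from_nth _ 0%N) => [|i]; first by rewrite st ss.
  rewrite st => im; have := congr1 (fun m : 'X_{1.._} => m (Ordinal im)) ets.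
  by rewrite !mnmE.
rewrite hits_cons negb_or => /andP [vU LU]; rewrite ncomb_cons.
have v0 : v != 0 by apply: contraNneq vU => ->; rewrite sub0mx.
have lv0 : \l v != 0 by rewrite ratfun_of_eq0 lform_eq0.
set M := (if _ then _ else _).
pose y k := ncomb L (adjoin_row U v k) (c \o cons k) P (Q - k).
(* The top pole order is N - 1; once its coefficients are known to be zero,
   N can be decreased. *)
have claim N : (N <= M)%N -> vanish_at U (\sum_(k < N) (\l v) ^- k * y k) ->
    forall k, (k < N)%N -> forall p q s, (p < P)%N -> (q < Q - k)%N ->
    s \in nidx L (adjoin_row U v k) p q -> c (k :: s) = 0.
  elim: N => // N IHN NM van.
  have cN p q s : (p < P)%N -> (q < Q - N)%N ->
      s \in nidx L (adjoin_row U v N) p q -> c (N :: s) = 0.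
    case: N IHN NM van => [|N] IHN NM van.
      move: van; rewrite big_ord1 expr0 invr1 mul1r => van.
      exact: (IH _ _ _ _ LU van p q s).
    have LUv : ~~ hits L (U + v)%MS.
      by move: NM; rewrite /M; case: ifP => // _; rewrite leq_min.
    suff van' : vanish_at (U + v)%MS (y N.+1) by exact: (IH _ _ _ _ LUv van' p q s).
    have yreg k : filt L P Q (y k).
      by apply: filt_le (ncomb_filt _ _ _ _ _) => //; exact: leq_subr.
    apply: (@vanish_top _ _ U v N.+1 _ (\sum_(k < N.+1) (\l v) ^+ (N - k) * y k)) => //.
    - exact: filt_regular (yreg N.+1).
    - apply: regular_at_sum => k _; apply: regular_atM.
        by rewrite -rmorphXn; exact: regular_at_poly.
      exact: filt_regular (yreg k).
    move: van; congr vanish_at.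
    rewrite big_ord_recr /= addrC mulrDr; congr (_ + _).
    rewrite !mulr_sumr; apply: eq_bigr => k _.
    rewrite !mulrA; congr (_ * _).
    rewrite -mulrA -exprS -subSn; last by rewrite -ltnS.
    by rewrite expN_split // ltnW.
  move=> k; rewrite ltnS leq_eqVlt => /predU1P [->|kN]; first exact: cN.
  apply: IHN kN; first exact: ltnW.
  move: van; rewrite big_ord_recr /= [X in _ + _ * X]big1 ?mulr0 ?addr0 //.
  move=> p _; rewrite big1 // => q _; rewrite big_seq big1 // => s sp.
  by rewrite /= (cN p q s) // scale0r.
move=> van p q s pP qQ; rewrite nidx_cons => /flatten_mapP [k kk /mapP [t tt ->]].
have kq : (k <= q)%N by move: kk; rewrite mem_iota /npole; case: ifP; lia.
apply: (claim M (leqnn _) van k _ p (q - k)%N) => //; last by lia.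
by move: kk; rewrite mem_iota /npole /M; case: ifP => _ /=; rewrite ?leq_min; lia.
Qed.

End NormalFormBasis.

(** * Dimensions of the graded pieces *)

Lemma ker_nontrivial (K : fieldType) n m (C : 'M[K]_(n, m)) :
  (m < n)%N -> exists2 r : 'rV_n, r != 0 & r *m C = 0.
Proof.
move=> mn; have kn0 : kermx C != 0.
  rewrite -mxrank_eq0 mxrank_ker -lt0n subn_gt0.
  exact: leq_ltn_trans (rank_leq_col C) mn.
exists (nz_row (kermx C)); first by rewrite nz_row_eq0.
by apply/sub_kermxP; exact: nz_row_sub.
Qed.

Section LinearSpan.
Variables (A : nzRingType) (E : lmodType A).
Implicit Types (G : set E).

Lemma lspan0 G : lspan G 0.
Proof. by exists 0%N, (fun=> 0), (fun=> 0); split=> [[]//|]; rewrite big_ord0. Qed.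

Lemma lspan_mem G x : G x -> lspan G x.
Proof.
by move=> Gx; exists 1%N, (fun=> 1), (fun=> x); split=> //; rewrite big_ord1 scale1r.
Qed.

Lemma lspanD G x y : lspan G x -> lspan G y -> lspan G (x + y).
Proof.
move=> [m [c [u [Gu ->]]]] [m' [c' [u' [Gu' ->]]]].
exists (m + m')%N.
exists (fun i => match fintype.split i with inl j => c j | inr j => c' j end).
exists (fun i => match fintype.split i with inl j => u j | inr j => u' j end).
split; first by move=> i; case: fintype.split.
by rewrite big_split_ord /=; congr (_ + _); apply: eq_bigr => i _;
  [rewrite (unsplitK (inl _ i))|rewrite (unsplitK (inr _ i))].
Qed.

Lemma lspan_sum G I (r : seq I) (P : pred I) (F : I -> E) :
  (forall i, P i -> lspan G (F i)) -> lspan G (\sum_(i <- r | P i) F i).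
Proof. by move=> FF; elim/big_ind: _ => //; [exact: lspan0|exact: lspanD]. Qed.

End LinearSpan.

Section QuotientDimUniq.
Variables (K : fieldType) (E : lmodType K) (W U : set E).
Hypothesis UD : forall x y, U x -> U y -> U (x + y).
Hypothesis UZ : forall c x, U x -> U (c *: x).
Hypothesis U0 : U 0.

Let quotient_dim_leq n m :
  quotient_dim_is W U n -> quotient_dim_is W U m -> (n <= m)%N.
Proof.
move=> [b [bW _ bU]] [b' [_ b'W _]]; rewrite leqNgt; apply/negP => mn.
have /all_sig [c cE] i : {c : 'I_m -> K | U (b i - \sum_j c j *: b' j)}.
  by apply: cid; exact: b'W.
have [r r0 rC] := ker_nontrivial (\matrix_(i, j) c i j) mn.
case/eqP: r0; apply/rowP => i; rewrite mxE; apply: (bU (fun i => r 0 i)).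
have -> : \sum_i r 0 i *: b i = \sum_i r 0 i *: (b i - \sum_j c i j *: b' j).
  under [RHS]eq_bigr => k _ do rewrite scalerBr scaler_sumr.
  rewrite sumrB exchange_big /= [X in _ - X]big1 ?subr0 // => j _.
  have := congr1 (fun u : 'rV_m => u 0 j) rC; rewrite !mxE => rj.
  rewrite -[RHS](scale0r (b' j)) -rj scaler_suml; apply: eq_bigr => k _.
  by rewrite scalerA !mxE.
elim/big_ind: _ => // k _; exact: UZ.
Qed.

Lemma quotient_dimE n : quotient_dim_is W U n -> quotient_dim W U = n.
Proof.
move=> Wn; have Wq : quotient_dim_is W U (quotient_dim W U).
  by apply: (@xgetPex _ 0%N (quotient_dim_is W U)); exists n.
by apply/eqP; rewrite eqn_leq !quotient_dim_leq.
Qed.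

End QuotientDimUniq.

Section Graded.
Variables (K : fieldType) (n : nat).
Notation E := (ratfun K n).
Notation i_ := (@ratfun_of K n).
Implicit Types (L : seq (matrix K 1 n)) (U : matrix K n n) (s : seq nat).
Implicit Types (c : seq nat -> K) (A : nat -> nat -> bool).
Notation "\l v" := (i_ (lform v)) (at level 9).

(** The coefficients of the normal forms with bidegree selected by [A]. This
    is well defined as a normal form determines its bidegree ([nidx_inj]); it
    turns partial sums into full ones, to which linear independence applies. *)
Definition restrict_coef L U A P Q c s :=
  if [exists p : 'I_P, exists q : 'I_Q, (s \in nidx L U p q) && A p q] then c s else 0.

Lemma restrict_coefE L U A P Q c p q s : (p < P)%N -> (q < Q)%N -> s \in nidx L U p q ->
  restrict_coef L U A P Q c s = if A p q then c s else 0.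
Proof.
move=> pP qQ sp; rewrite /restrict_coef; congr (if _ then _ else _).
apply/existsP/idP => [[p' /existsP [q' /andP [sp']]]|Apq].
  by have [-> ->] := nidx_inj sp sp'.
by exists (Ordinal pP); apply/existsP; exists (Ordinal qQ); rewrite sp.
Qed.

Lemma ncomb_mask L U A P Q c :
  \sum_(p < P) \sum_(q < Q | A p q) \sum_(s <- nidx L U p q) c s *: nform L U s =
  ncomb L U (restrict_coef L U A P Q c) P Q.
Proof.
apply: eq_bigr => p _; rewrite big_mkcond; apply: eq_bigr => q _.
case: ifP => Apq; last first.
  rewrite big_seq big1 // => s sp.
  by rewrite (restrict_coefE A c (ltn_ord p) (ltn_ord q) sp) Apq scale0r.
rewrite big_seq [RHS]big_seq; apply: eq_bigr => s sp.
by rewrite (restrict_coefE A c (ltn_ord p) (ltn_ord q) sp) Apq.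
Qed.

Lemma ncomb_wmaskP L U P Q P' c : (P' <= P)%N ->
  ncomb L U c P' Q = ncomb L U (restrict_coef L U (fun p _ => p < P')%N P Q c) P Q.
Proof.
move=> PP; rewrite -ncomb_mask /ncomb (big_ord_widen _ (fun p : nat =>
  \sum_(q < Q) \sum_(s <- nidx L U p q) c s *: nform L U s) PP) big_mkcond.
apply: eq_bigr => p _; case: ifP => //= pP.
by rewrite big1.
Qed.

Lemma ncomb_wmaskQ L U P Q Q' c : (Q' <= Q)%N ->
  ncomb L U c P Q' = ncomb L U (restrict_coef L U (fun _ q => q < Q')%N P Q c) P Q.
Proof.
move=> QQ; rewrite -ncomb_mask; apply: eq_bigr => p _.
by rewrite (big_ord_widen _ (fun q : nat =>
   \sum_(s <- nidx L U p q) c s *: nform L U s) QQ).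
Qed.

Lemma ncomb_last L U p q c :
  \sum_(s <- nidx L U p q) c s *: nform L U s =
  ncomb L U (restrict_coef L U (fun p' q' => (p' == p) && (q' == q)) p.+1 q.+1 c) p.+1 q.+1.
Proof.
rewrite -ncomb_mask [RHS]big_ord_recr /= [X in _ = X + _]big1 ?add0r => [|p' _].
  rewrite [RHS]big_mkcond [RHS]big_ord_recr /= !eqxx [X in _ = X + _]big1 ?add0r // => q' _.
  by rewrite (ltn_eqF (ltn_ord q')).
by rewrite big1 // => q'; rewrite (ltn_eqF (ltn_ord p')).
Qed.

Lemma ncombB L U c c' P Q :
  ncomb L U c P Q - ncomb L U c' P Q = ncomb L U (fun s => c s - c' s) P Q.
Proof.
rewrite -sumrB; apply: eq_bigr => p _; rewrite -sumrB; apply: eq_bigr => q _.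
by rewrite -sumrB; apply: eq_bigr => s _; rewrite scalerBl.
Qed.

Lemma span_rem_0 L P Q (y : E) : span_rem L 0 P Q y -> y = 0.
Proof.
by move=> [w [_ ->]]; rewrite big1 // => i _; rewrite row0 lform0 rmorph0 mul0r.
Qed.

Lemma hits0 L : 0 \notin L -> ~~ hits L (0 : 'M_n).
Proof.
move=> L0; apply/hasPn => v vL; rewrite submx0.
by apply: contraNneq L0 => <-.
Qed.

Lemma filt_ncomb L P Q y : 0 \notin L -> filt L P Q y ->
  exists c, y = ncomb L 0 c P Q.
Proof.
move=> /hits0 L0 /(filt_span L0) [c /span_rem_0 /eqP].
by rewrite subr_eq0 => /eqP ->; exists c.
Qed.

Lemma ncomb_eq0 L c P Q : 0 \notin L -> ncomb L 0 c P Q = 0 ->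
  forall p q s, (p < P)%N -> (q < Q)%N -> s \in nidx L 0 p q -> c s = 0.
Proof.
move=> /hits0 L0 c0; apply: ncomb_indep L0 _.
by exists 1, 0; rewrite c0 mulr0 !rmorph0 rmorph1 oner_neq0.
Qed.

(** The normal forms of bidegree less than [(p, q)] span the two smaller
    steps of the filtration, so those of bidegree exactly [(p, q)] are a basis
    of the quotient. *)
Lemma filt_quotient_dim L p q : 0 \notin L ->
  quotient_dim_is (filt L p.+1 q.+1 : set E)
    (sum_set (filt L p q.+1) (filt L p.+1 q)) (size (nidx L 0 p q)).
Proof.
move=> L0; pose b (i : 'I_(size (nidx L 0 p q))) := nform L 0 (nth [::] (nidx L 0 p q) i).
have bE (c : seq nat -> K) : \sum_(s <- nidx L 0 p q) c s *: nform L 0 s =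
    \sum_(i < size (nidx L 0 p q)) c (nth [::] (nidx L 0 p q) i) *: b i.
  by rewrite (big_nth [::]) big_mkord.
exists b; split.
- by move=> i; apply: nform_filt; exact: mem_nth.
- move=> w /(filt_ncomb L0) [c ->].
  exists (fun i => c (nth [::] (nidx L 0 p q) i)); rewrite -bE.
  exists (ncomb L 0 c p q.+1), (\sum_(q' < q) \sum_(s <- nidx L 0 p q') c s *: nform L 0 s).
  split; first exact: ncomb_filt.
    apply: filt_sum => q' _; rewrite big_seq; apply: filt_sum => s /nform_filt sd.
    by apply/filtZ; apply: filt_le sd.
  by rewrite {1}/ncomb big_ord_recr /= [X in _ + X - _]big_ord_recr /= addrA addrK.
move=> c [u [u' [/(filt_ncomb L0) [c1 ->] /(filt_ncomb L0) [c2 ->] cE]]] i.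
(* The coefficients, as a function on all the normal forms. *)
pose c' s := if insub (index s (nidx L 0 p q)) is Some j then c j else 0.
have c'E (j : 'I_(size (nidx L 0 p q))) : c' (nth [::] (nidx L 0 p q) j) = c j.
  by rewrite /c' index_uniq ?uniq_nidx // valK.
have {}cE : \sum_(s <- nidx L 0 p q) c' s *: nform L 0 s =
    ncomb L 0 c1 p q.+1 + ncomb L 0 c2 p.+1 q.
  by rewrite bE -cE; apply: eq_bigr => j _; rewrite c'E.
rewrite ncomb_last (ncomb_wmaskP _ _ _ _ (leqnSn p)) (ncomb_wmaskQ _ _ _ _ (leqnSn q)) in cE.
move/eqP: cE; rewrite -subr_eq0 opprD addrA !ncombB => /eqP /(ncomb_eq0 L0) c0.
have := c0 p q (nth [::] (nidx L 0 p q) i) (leqnn _) (leqnn _) (mem_nth _ (ltn_ord i)).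
rewrite !(restrict_coefE _ _ (leqnn _) (leqnn _) (mem_nth _ (ltn_ord i))) !eqxx !ltnn /=.
by rewrite !subr0 c'E.
Qed.

End Graded.

(** * Rational functions with poles on the arrangement *)

Section Dvd.
Variables (K : fieldType) (n : nat).
Implicit Types (s : seq 'rV[K]_n) (f g h : {mpoly K[n]}).

Definition lprod s : {mpoly K[n]} := \prod_(v <- s) lform v.

Lemma lprod_cons v s : lprod (v :: s) = lform v * lprod s.
Proof. by rewrite /lprod big_cons. Qed.

Lemma lprod_neq0 s : 0 \notin s -> lprod s != 0.
Proof.
rewrite prodf_seq_neq0 => s0; apply/allP => v vs /=.
by rewrite lform_eq0; apply: contraNneq s0 => <-.
Qed.

Lemma msize_lform_neq0 (v : 'rV[K]_n) : v != 0 -> msize (lform v) = 2%N.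
Proof.
move=> v0; apply/eqP; rewrite eqn_leq msize_lform /=.
have [i vi] : exists i, v 0 i != 0 by apply/rV0Pn.
rewrite -(mdeg1 i); apply: msize_mdeg_lt.
by rewrite mcoeff_msupp lform_coef.
Qed.

Lemma msize_lprod s : 0 \notin s -> msize (lprod s) = (size s).+1.
Proof.
elim: s => [|v s IH]; first by rewrite /lprod big_nil msize1.
rewrite inE negb_or eq_sym => /andP [v0 s0]; rewrite lprod_cons.
by rewrite msizeM ?lform_eq0 ?lprod_neq0 // msize_lform_neq0 // IH.
Qed.

Lemma lprod_dvd s f g h : 0 \notin s ->
  (forall v, v \in s -> ~ pdvd (lform v) h) ->
  h * g = f * lprod s -> exists g', g = g' * lprod s.
Proof.
elim: s g => [|v s IH] g; first by exists g; rewrite /lprod big_nil mulr1.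
rewrite inE negb_or eq_sym => /andP [v0 s0] sh hg.
have : pdvd (lform v) (h * g).
  by rewrite hg lprod_cons; exists (f * lprod s); rewrite mulrCA.
case/lform_prime => [/sh|[g1 gE]]; first by rewrite mem_head => /(_ isT).
have [||g' g1E] := IH g1 s0.
- by move=> u us; apply: sh; rewrite inE us orbT.
- apply: (@mulfI _ (lform v)); first by rewrite lform_eq0.
  by rewrite mulrCA -gE hg lprod_cons mulrCA.
by exists g'; rewrite gE g1E lprod_cons mulrCA.
Qed.

Lemma msize_dvd f g : g != 0 -> f * g != 0 -> (msize f <= msize (f * g))%N.
Proof.
move=> g0 fg0; have f0 : f != 0 by apply: contraNneq fg0 => ->; rewrite mul0r.
have : msize g != 0%N by rewrite msize_poly_eq0.
by rewrite msizeM //; case: (msize g) => // k _; rewrite addnS /= leq_addr.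
Qed.

End Dvd.

Section RfiltFilt.
Variables (K : fieldType) (V : vectType K) (Delta : {fset 'Hom(V, K^o)}).
Notation n := (\dim {:V}).
Notation E := (ratfun K n).
Notation i_ := (@ratfun_of K n).
Notation "\l v" := (i_ (lform v)) (at level 9).
Implicit Types (s L : seq 'rV[K]_n).

Definition coefs (a : 'Hom(V, K^o)) : 'rV[K]_n := \row_i (a (vbasis {:V})`_i : K).

Lemma linformE a : linform a = lform (coefs a).
Proof. by apply: eq_bigr => i _; rewrite mxE. Qed.

Lemma coefs_inj : injective coefs.
Proof.
move=> a b /rowP ab; apply/lfunP => x.
rewrite (coord_vbasis (memvf x)) !linear_sum; apply: eq_bigr => i _.
by rewrite !linearZ; congr (_ *: _); have := ab i; rewrite !mxE.
Qed.

Lemma coefsZ (c : K) a : coefs (c *: a) = c *: coefs a.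
Proof. by apply/rowP => i; rewrite !mxE lfunE. Qed.

Lemma coefs0 : coefs 0 = 0.
Proof. by rewrite -(scale0r 0) coefsZ scale0r. Qed.

Definition forms : seq 'rV[K]_n := [seq coefs a | a <- enum_fset Delta].

Hypothesis Delta0 : 0 \notin Delta.

Lemma forms0 : 0 \notin forms.
Proof. by apply/mapP => -[a aD]; rewrite -coefs0 => /coefs_inj a0; move: Delta0; rewrite a0 aD. Qed.

Lemma sub_forms0 s : {subset s <= forms} -> 0 \notin s.
Proof. by move=> sD; apply: contraNN forms0; apply: sD. Qed.

Lemma locring_fraction x : locring Delta x ->
  exists (s : seq 'rV[K]_n) h, {subset s <= forms} /\ x = i_ h / i_ (lprod s).
Proof.
elim=> [f|a aD|_ _ _ [s [h [sD ->]]] _ [s' [h' [sD' ->]]]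
        |_ _ _ [s [h [sD ->]]] _ [s' [h' [sD' ->]]]].
- by exists [::], f; split=> //; rewrite /lprod big_nil rmorph1 divr1.
- exists [:: coefs a], 1; rewrite lprod_cons /lprod big_nil mulr1 rmorph1 mul1r linformE.
  by split=> // v; rewrite inE => /eqP ->; exact: map_f.
- exists (s ++ s'), (h * lprod s' + h' * lprod s); split.
    by move=> v; rewrite mem_cat => /orP [/sD|/sD'].
  rewrite /lprod big_cat -!/(lprod _) rmorphD !rmorphM /= addf_div //;
    by rewrite ratfun_of_eq0 lprod_neq0 // sub_forms0.
exists (s ++ s'), (h * h'); split.
  by move=> v; rewrite mem_cat => /orP [/sD|/sD'].
by rewrite /lprod big_cat -!/(lprod _) !rmorphM /= mulf_div.
Qed.

(** The denominators are cancelled one form at a time, by induction on their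
    number. *)
Lemma reduced_fraction x : locring Delta x -> exists (s : seq 'rV[K]_n) h,
  [/\ {subset s <= forms}, x = i_ h / i_ (lprod s) &
      forall v, v \in s -> ~ pdvd (lform v) h].
Proof.
move=> /locring_fraction [s]; have [k] := ubnP (size s).
elim: k s => // k IH s sk [h [sD xE]].
have [[v [vs [w hE]]]|nd] := pselect (exists v, v \in s /\ pdvd (lform v) h); last first.
  by exists s, h; split=> // v vs vh; apply: nd; exists v.
have v0 : \l v != 0.
  by rewrite ratfun_of_eq0 lform_eq0; apply: contraNneq (sub_forms0 sD) => <-.
apply: (IH (rem v s)); first by rewrite size_rem //; case: (s) vs sk.
exists w; split; first by move=> u /mem_rem /sD.
rewrite xE hE; have -> : lprod s = lform v * lprod (rem v s).
  by rewrite -lprod_cons; apply: perm_big; exact: perm_to_rem.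
by rewrite !rmorphM /= -mulf_div divff // mul1r.
Qed.

Lemma filt_lprod s P Q y : {subset s <= forms} ->
  filt forms P Q y -> filt forms P (Q + size s) (y / i_ (lprod s)).
Proof.
elim: s => [|v s IH] sD yd; first by rewrite /lprod big_nil rmorph1 divr1 addn0.
rewrite lprod_cons rmorphM invfM mulrCA addnS; apply: filt_pole.
  by apply: sD; rewrite mem_head.
by apply: IH => // u us; apply: sD; rewrite inE us orbT.
Qed.

Definition Rgen P Q := [set x | locring Delta x /\
    exists f g, [/\ g != 0, x = i_ f / i_ g, (msize f <= P)%N & (msize g <= Q)%N]]%classic.

(** The bounds on [f] and [g] in [x = f / g] pass to the reduced fraction of
    [x]: no form of its denominator divides its numerator, so the numerator
    divides [f] and the denominator divides [g]. *)
Lemma Rgen_filt P Q x : Rgen P Q x -> filt forms P Q x.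
Proof.
move=> [xR [f [g [g0 xE fP gQ]]]].
have [s [h [sD xE' sh]]] := reduced_fraction xR.
have s0 := lprod_neq0 (sub_forms0 sD).
have [h0|h0] := eqVneq h 0; first by rewrite xE' h0 rmorph0 mul0r; exact: filt0.
have fg : h * g = f * lprod s.
  apply: ratfun_of_inj; rewrite !rmorphM /=.
  by apply/eqP; rewrite -eqr_div ?ratfun_of_eq0 // -xE -xE'.
have [g' gE] := lprod_dvd (sub_forms0 sD) sh fg.
have fE : f = h * g' by apply: (mulIf s0); rewrite -fg gE mulrA.
have g'0 : g' != 0 by apply: contraNneq g0 => g'0; rewrite gE g'0 mul0r.
have hP : (msize h <= P)%N.
  by apply: leq_trans fP; rewrite fE msize_dvd // mulf_neq0.
have sQ : (1 + size s <= Q)%N.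
  apply: leq_trans gQ; rewrite gE mulrC add1n -(msize_lprod (sub_forms0 sD)).
  by apply: msize_dvd => //; rewrite mulf_neq0.
rewrite xE'; apply: (filt_le (leqnn P) sQ).
by apply: filt_lprod => //; exact: filt_poly.
Qed.

Lemma locring_lprod s : {subset s <= forms} -> locring Delta (i_ (lprod s))^-1.
Proof.
elim: s => [|v s IH] sD.
  by rewrite /lprod big_nil rmorph1 invr1 -(rmorph1 i_); exact: locring_poly.
rewrite lprod_cons rmorphM invfM; apply: locring_mul.
  have /mapP [a aD ->] : v \in forms by apply: sD; rewrite mem_head.
  by rewrite /= -linformE; exact: locring_inv.
by apply: IH => u us; apply: sD; rewrite inE us orbT.
Qed.

(** The poles are accumulated in the list [s] while the recursion runs through
    [L]. *)
Lemma filt_Rgen L s P Q Q' y : {subset L <= forms} -> {subset s <= forms} ->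
  filt L P Q y -> (Q + size s <= Q')%N -> lspan (Rgen P Q') (y / i_ (lprod s)).
Proof.
elim: L s Q y => [|v L IH] s Q y LD sD /=.
  move=> [f]; case: Q => [|Q].
    rewrite /= leqn0 msize_poly_eq0 => /eqP -> -> _.
    by rewrite rmorph0 mul0r; exact: lspan0.
  rewrite mul1n => fP -> sQ; apply: lspan_mem; split.
    by apply: locring_mul; [exact: locring_poly|exact: locring_lprod].
  exists f, (lprod s); split=> //; first exact/lprod_neq0/sub_forms0.
  by rewrite msize_lprod ?sub_forms0 //; apply: leq_trans sQ; rewrite addSn ltnS leq_addl.
move=> [Y [Yd ->]] sQ; rewrite mulr_suml; apply: lspan_sum => k _.
have -> : (\l v) ^- k * Y k / i_ (lprod s) = Y k / i_ (lprod (nseq k v ++ s)).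
  rewrite /lprod big_cat /= big_nseq iter_mulr_1 rmorphM rmorphXn invfM /=.
  by rewrite -mulrA mulrCA.
have vD : v \in forms by apply: LD; rewrite mem_head.
apply: IH (Yd k (ltn_ord k)) _.
- by move=> u uL; apply: LD; rewrite inE uL orbT.
- by move=> u; rewrite mem_cat => /orP [/nseqP [-> _] //|/sD].
by rewrite size_cat size_nseq; have := ltn_ord k; lia.
Qed.

Lemma RfiltE (P Q : nat) : Rfilt Delta (P%:Z - 1) (Q%:Z - 1) = filt forms P Q.
Proof.
have RE : Rfilt Delta (P%:Z - 1) (Q%:Z - 1) = lspan (Rgen P Q).
  by rewrite /Rfilt /deg_le !subrK.
rewrite RE; apply/seteqP; split=> x.
  move=> [m [c [y [Gy ->]]]]; apply: filt_sum => i _; apply: filtZ.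
  exact: Rgen_filt.
move=> xd; have := @filt_Rgen forms [::] P Q Q x (fun _ => id) (fun _ => _) xd.
by rewrite addn0 /lprod big_nil rmorph1 divr1; apply.
Qed.

Fact succzK (m : nat) : m.+1%:Z - 1 = m%:Z.
Proof. by rewrite -addn1 PoszD addrK. Qed.

Lemma Rfilt_lowerE (p q : nat) :
  Rfilt_lower Delta p q = sum_set (filt forms p q.+1) (filt forms p.+1 q).
Proof. by rewrite /Rfilt_lower -!RfiltE !succzK. Qed.

Lemma Rbar_dim (p q : nat) : quotient_dim_is (Rfilt Delta p q) (Rfilt_lower Delta p q)
  (size (nidx forms 0 p q)).
Proof.
rewrite Rfilt_lowerE; have -> : Rfilt Delta p q = filt forms p.+1 q.+1.
  by rewrite -RfiltE !succzK.
exact/filt_quotient_dim/forms0.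
Qed.

Lemma dimRbarE (p q : nat) : dimRbar Delta p q = size (nidx forms 0 p q).
Proof.
apply: quotient_dimE (Rbar_dim p q); rewrite Rfilt_lowerE.
- move=> _ _ [u [v [ud vd ->]]] [u' [v' [ud' vd' ->]]].
  by exists (u + u'), (v + v'); rewrite addrACA; split=> //; apply: filtD.
- move=> c _ [u [v [ud vd ->]]]; exists (c *: u), (c *: v).
  by rewrite scalerDr; split=> //; apply: filtZ.
by exists 0, 0; rewrite addr0; split=> //; exact: filt0.
Qed.

Lemma Rbar_findim (p q : int) :
  quotient_findim (Rfilt Delta p q) (Rfilt_lower Delta p q).
Proof.
have neg : (p < 0) || (q < 0) -> quotient_findim (Rfilt Delta p q) (Rfilt_lower Delta p q).
  move=> pq; exists 0%N, (fun=> 0); split=> [[]//||c _ []//].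
  rewrite (Rfilt_neg _ pq) => _ ->; exists (fun=> 0).
  have R0 p' q' : Rfilt Delta p' q' 0 by exact: lspan0.
  by rewrite big_ord0 subr0; exists 0, 0; rewrite addr0; split.
case: p neg => [p|p] neg; last exact: neg.
case: q neg => [q|q] neg; last by apply: neg; rewrite orbT.
by exists (size (nidx forms 0 p q)); exact: Rbar_dim.
Qed.

End RfiltFilt.

(** * The characteristic polynomial *)

Section Chi.
Variables (K : fieldType) (n : nat).
Implicit Types (L : seq (matrix K 1 n)) (U : matrix K n n) (p : {poly int}).

(** Deletion-restriction for the arrangement that [L] induces on the zero locus
    of [U]. For [U = 0], [B = 1] and [A] the variable, this is the
    characteristic polynomial of the arrangement; for general [A] and [B], its
    homogenization. *)
Fixpoint chi (R : comNzRingType) (A B : R) L U : R :=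
  if L is v :: L' then
    if (v <= U)%MS then 0 else chi A B L' U - B * chi A B L' (U + v)%MS
  else A ^+ (n - \rank U).

Lemma hits_sub L U U' : (U <= U')%MS -> hits L U -> hits L U'.
Proof.
by move=> UU' /hasP [v vL vU]; apply/hasP; exists v => //; exact: submx_trans vU UU'.
Qed.

Lemma chi_hits (R : comNzRingType) (A B : R) L U : hits L U -> chi A B L U = 0.
Proof.
elim: L U => //= v L IH U; case: ifP => //= vU LU.
by rewrite !IH ?mulr0 ?subr0 // (hits_sub (addsmxSl _ _) LU).
Qed.

Lemma rank_adjoin U (v : 'rV[K]_n) : ~~ (v <= U)%MS ->
  (n - \rank U = (n - \rank (U + v)%MS).+1)%N.
Proof.
move=> vU; have UUv : (U < U + v)%MS by rewrite ltmxE addsmxSl addsmx_sub submx_refl.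
have := rank_ltmx UUv; have := rank_leq_col (U + v)%MS.
have [/= + _] := mxrank_adds_leqif U v; have := rank_leq_row v.
lia.
Qed.

Definition homogenize (R : comNzRingType) (A B : R) m (p : {poly int}) : R :=
  \sum_(k < m.+1) (p`_k)%:~R * A ^+ k * B ^+ (m - k).

Lemma homogenizeB (R : comNzRingType) (A B : R) m (p p' : {poly int}) :
  homogenize A B m (p - p') = homogenize A B m p - homogenize A B m p'.
Proof.
rewrite -sumrB; apply: eq_bigr => k _.
by rewrite coefB rmorphB !mulrBl.
Qed.

Lemma homogenizeS (R : comNzRingType) (A B : R) m p :
  (size p <= m.+1)%N -> homogenize A B m.+1 p = B * homogenize A B m p.
Proof.
move=> pm; rewrite /homogenize big_ord_recr /= nth_default // !mul0r addr0.
rewrite mulr_sumr; apply: eq_bigr => k _.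
by rewrite (subSn (leq_ord k)) exprS; ring.
Qed.

Lemma homogenizeMX (R : comNzRingType) (A B : R) m p :
  homogenize A B m.+1 (p * 'X) = A * homogenize A B m p.
Proof.
rewrite /homogenize big_ord_recl coefMX /= !mul0r add0r.
by rewrite mulr_sumr; apply: eq_bigr => k _; rewrite coefMX /= exprS subSS; ring.
Qed.

Lemma homogenizeZ (R : comNzRingType) (A B : R) m c p :
  homogenize A B m (p * c%:P) = c%:~R * homogenize A B m p.
Proof.
rewrite /homogenize mulr_sumr; apply: eq_bigr => k _.
by rewrite coefMC rmorphM; ring.
Qed.

Lemma homogenize_Xn (R : comNzRingType) (A B : R) m : homogenize A B m 'X^m = A ^+ m.
Proof.
rewrite /homogenize big_ord_recr /= coefXn eqxx mul1r subnn mulr1 big1 ?add0r //.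
by move=> k _; rewrite coefXn (ltn_eqF (ltn_ord k)) !mul0r.
Qed.

Lemma homogenize_prod (R : comNzRingType) (A B : R) m (d : 'I_m -> nat) :
  homogenize A B m (\prod_(i < m) ('X - (d i)%:R%:P)) = \prod_(i < m) (A - (d i)%:R * B).
Proof.
elim: m d => [|m IH] d; first by rewrite !big_ord0; exact: (homogenize_Xn A B 0).
rewrite !big_ord_recr /= -IH mulrBr homogenizeB homogenizeMX homogenizeZ homogenizeS.
  by rewrite natz pmulrn; ring.
by rewrite size_prod_XsubC /index_enum -enumT size_enum_ord.
Qed.

(** Each restriction lowers the dimension by one and brings a factor [B], so
    that [chi] is homogeneous in [A] and [B]. It is enough to know it as an
    integer polynomial. *)
Lemma chi_homogenize (R : comNzRingType) (A B : R) L U :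
  (size (chi 'X (1 : {poly int}) L U) <= (n - \rank U).+1)%N /\
  chi A B L U = homogenize A B (n - \rank U) (chi 'X 1 L U).
Proof.
elim: L U => [|v L IH] U /=; first by rewrite size_polyXn homogenize_Xn.
case: ifPn => [_|vU].
  by rewrite size_poly0 /homogenize big1 // => k _; rewrite coef0 !mul0r.
rewrite mul1r; have [s1 ->] := IH U; have [s2 ->] := IH (U + v)%MS; split.
  apply: leq_trans (size_polyD _ _) _; rewrite size_polyN geq_max s1 /=.
  by apply: leq_trans s2 _; rewrite ltnS (rank_adjoin vU).
by rewrite homogenizeB [in X in _ = _ - X](rank_adjoin vU) homogenizeS.
Qed.

Variable k : nat.
Implicit Types (l : 'I_k -> 'rV[K]_n) (T : {set 'I_k}).

Definition sel_mx l T : 'M[K]_(k, n) := \matrix_i (if i \in T then l i else 0).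

Lemma sel_mx0 l : sel_mx l finset.set0 = 0.
Proof. by apply/matrixP => i j; rewrite !mxE inE mxE. Qed.

Lemma sel_mx_sub l T (m : nat) (W : 'M[K]_(m, n)) :
  (sel_mx l T <= W)%MS = [forall i in T, (l i <= W)%MS].
Proof.
apply/row_subP/'forall_implyP => [H i iT|H i].
  by have := H i; rewrite rowK iT.
by rewrite rowK; case: ifP => [/H //|_]; rewrite sub0mx.
Qed.

Lemma sel_mxU l T i : (sel_mx l (i |: T)%SET :=: sel_mx l T + l i)%MS.
Proof.
apply/eqmxP/andP; split.
  rewrite sel_mx_sub; apply/'forall_implyP => j; rewrite !inE => /predU1P [->|jT].
    exact: addsmxSr.
  apply: submx_trans (addsmxSl _ _); have := submx_refl (sel_mx l T).
  by rewrite sel_mx_sub => /'forall_implyP; apply.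
have := submx_refl (sel_mx l (i |: T)%SET); rewrite {1}sel_mx_sub => /'forall_implyP H.
rewrite addsmx_sub sel_mx_sub H ?setU11 // andbT; apply/'forall_implyP => j jT.
by apply: H; rewrite inE jT orbT.
Qed.

Lemma sel_mx1 l i : (sel_mx l [set i]%SET :=: l i)%MS.
Proof.
rewrite -[[set i]%SET]finset.setU0; apply: eqmx_trans (sel_mxU _ _ _) _.
by rewrite sel_mx0; exact: adds0mx.
Qed.

Lemma submx_rank (m : nat) (W : 'M[K]_(m, n)) (w : 'rV[K]_n) :
  (w <= W)%MS = (\rank (W + w)%MS == \rank W).
Proof.
apply/idP/eqP => [/addsmx_idPl -> //|rW].
have /andP [_] : (W == W + w)%MS.
  by rewrite -(geq_leqif (mxrank_leqif_eq (addsmxSl W w))) rW.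
by apply: submx_trans; exact: addsmxSr.
Qed.

Lemma sub_sel_rank l T i :
  (l i <= sel_mx l T)%MS = (\rank (sel_mx l (i |: T)%SET) == \rank (sel_mx l T)).
Proof. by rewrite submx_rank (sel_mxU l T i). Qed.

End Chi.

(** The two families have the same matroid. *)
Definition same_ranks (K K' : fieldType) n k (l : 'I_k -> 'rV[K]_n) (l' : 'I_k -> 'rV[K']_n) :=
  forall T, \rank (sel_mx l T) = \rank (sel_mx l' T).

Lemma same_ranks_sub (K K' : fieldType) n k (l : 'I_k -> 'rV[K]_n) (l' : 'I_k -> 'rV[K']_n) :
  same_ranks l l' -> forall T i, (l i <= sel_mx l T)%MS = (l' i <= sel_mx l' T)%MS.
Proof. by move=> ll' T i; rewrite !sub_sel_rank !ll'. Qed.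

(** The recursion for [chi] only asks whether a form lies in the span of some
    others, and these questions are settled by ranks. *)
Lemma chi_rank (K K' : fieldType) n k (l : 'I_k -> 'rV[K]_n) (l' : 'I_k -> 'rV[K']_n)
    (R : comNzRingType) (A B : R) (s : seq 'I_k) : same_ranks l l' ->
  chi A B [seq l i | i <- s] 0 = chi A B [seq l' i | i <- s] 0.
Proof.
move=> ll'; suff gen T U U' : (U :=: sel_mx l T)%MS -> (U' :=: sel_mx l' T)%MS ->
    chi A B [seq l i | i <- s] U = chi A B [seq l' i | i <- s] U'.
  by apply: (gen finset.set0); rewrite sel_mx0; apply/eqmx_sym; exact: eqmx0.
elim: s T U U' => [|i s IH] T U U' UE UE' /=; first by rewrite UE UE' ll'.
rewrite UE UE' (same_ranks_sub ll'); case: ifP => // _; rewrite (IH T U U') //.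
congr (_ - _ * _); apply: (IH (i |: T)%SET).
  by apply/eqmx_sym; apply: eqmx_trans (sel_mxU _ _ _) _; apply: adds_eqmx => //; exact: eqmx_sym.
by apply/eqmx_sym; apply: eqmx_trans (sel_mxU _ _ _) _; apply: adds_eqmx => //; exact: eqmx_sym.
Qed.

Section PointCount.
Variables (F : finFieldType) (n : nat).
Implicit Types (L : seq 'rV[F]_n) (U : 'M[F]_n).

(** The points of the zero locus of [U] outside the hyperplanes of [L]. A point
    [x] is on the hyperplane of [v] when [v <= kermx x^T]. *)
Definition complement L U : {set 'rV[F]_n} :=
  [set x : 'rV_n | (U <= kermx x^T)%MS && ~~ hits L (kermx x^T)].

(** The points outside the hyperplanes of [L] are either outside the hyperplane
    of [v], or on it, and counted by the restriction to [U + v]. *)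
Lemma card_complement L U : (#|complement L U|%:R : int) = chi #|F|%:R 1 L U.
Proof.
elim: L U => [|v L IH] U /=.
  have -> : complement [::] U = rowg (kermx U^T).
    apply/setP => x; rewrite inE mem_rowg andbT !sub_kermx.
    by rewrite -[in RHS]trmx_eq0 trmx_mul !trmxK.
  by rewrite card_rowg mxrank_ker mxrank_tr natrX.
case: ifPn => [vU|vU].
  suff -> : complement (v :: L) U = finset.set0 by rewrite cards0.
  apply/setP => x; rewrite !inE hits_cons; case: (boolP (U <= _)%MS) => //= Ux.
  by rewrite (submx_trans vU Ux).
rewrite -!IH mul1r; apply/eqP; rewrite eq_sym subr_eq -natrD; apply/eqP; congr _%:R.
rewrite -(cardsID [set x : 'rV_n | (v <= kermx x^T)%MS] (complement L U)) addnC.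
congr (_ + _)%N; apply: eq_card => x; rewrite !inE ?hits_cons ?addsmx_sub.
  by rewrite negb_or; case: (U <= kermx x^T)%MS; case: (v <= kermx x^T)%MS; case: hits.
by case: (U <= kermx x^T)%MS; case: (v <= kermx x^T)%MS; case: hits.
Qed.

End PointCount.

Section HilbertSeries.
Variables (K : fieldType) (n : nat).
Implicit Types (L : seq 'rV[K]_n) (U : 'M[K]_n).

Lemma size_comps m : (fun p => (size (comps m p))%:R) = fps_geom int ^+ m :> fps int.
Proof.
elim: m => [|m IH]; first by apply/funext => -[|p].
apply/funext => p; rewrite exprS -IH coef_fpsM compsS size_flatten /shape -map_comp.
rewrite sumnE big_map -[p.+1 in LHS]subn0 -/(index_iota 0 p.+1) big_mkord raddf_sum.
by apply: eq_bigr => k _; rewrite /= size_map mul1r.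
Qed.

Lemma fpsCX (R : comNzRingType) (f : R) m : fpsC (f ^+ m) = fpsC f ^+ m.
Proof. by elim: m => [|m IH]; rewrite ?expr0 ?fpsC1 // !exprS fpsCM IH. Qed.

Definition hilb L U : fps2 := fun q p => (size (nidx L U p q))%:R.

(** The pole order along the first form is either zero, which gives the series
    of the deletion, or some [k > 0], which gives the series of the restriction
    multiplied by [t ^ k]; and [1 - 1/(1-t)] is minus the sum of these powers. *)
Lemma hilbE L U : ~~ hits L U ->
  hilb L U = chi (fpsC (fps_geom int) : fps2) (1 - fps_geom (fps int) : fps2) L U.
Proof.
elim: L U => [|v L IH] U.
  move=> _; rewrite /= -fpsCX -size_comps -mxrank_coker.
  by apply/funext => -[|q] //; apply/funext => -[|p].
rewrite hits_cons negb_or => /andP [vU LU] /=; rewrite (negPf vU) -(IH _ LU).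
have sizeE p q : size (nidx (v :: L) U p q) =
    (\sum_(k < npole L U v q) size (nidx L (adjoin_row U v k) p (q - k)))%N.
  rewrite nidx_cons size_flatten /shape -map_comp sumnE big_map.
  rewrite -{1}[npole _ _ _ _]subn0 -/(index_iota _ _) big_mkord.
  by apply: eq_bigr => k _; rewrite /= size_map.
case: (boolP (hits L (U + v)%MS)) => [LUv|LUv].
  rewrite chi_hits // mulr0 subr0; apply/funext => q; apply/funext => p.
  by rewrite /hilb sizeE /npole LUv big_ord1 subn0.
rewrite -(IH _ LUv); apply/funext => q; apply/funext => p.
rewrite coef_fpsB coef_fpsM /hilb sizeE /npole (negPf LUv).
rewrite !big_ord_recl subn0 natrD raddf_sum /=.
have c0 : (1 - fps_geom (fps int)) 0%N = 0 := subrr (1 : fps int).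
have cS k : (1 - fps_geom (fps int)) k.+1 = -1 := sub0r (1 : fps int).
rewrite c0 mul0r add0r; congr (_ + _).
under [in RHS]eq_bigr => k _ do rewrite cS mulN1r.
rewrite sumrN opprK.
by elim/big_rec2: _ => [|k x y _ ->] //; case: (p).
Qed.

End HilbertSeries.

(** * Logarithmic derivations and Saito's criterion *)

(** The value [theta (lform v)] for the derivation [theta] with
    [theta 'X_j = b j]. *)
Definition der_val (R : nzRingType) n (b : 'I_n -> {mpoly R[n]}) (v : 'rV[R]_n) :
  {mpoly R[n]} := \sum_j b j * (v 0 j)%:MP.

Section Saito.
Variables (K : fieldType) (n : nat).
Notation S := {mpoly K[n]}.
Implicit Types (v w : 'rV[K]_n) (b : 'I_n -> S) (L : seq 'rV[K]_n) (f g h : S).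

Definition logder L b := forall v, v \in L -> pdvd (lform v) (der_val b v).

Lemma pdvd_mulr f g h : pdvd f g -> pdvd f (g * h).
Proof. by move=> [w ->]; exists (w * h); rewrite mulrA. Qed.

Lemma pdvd_mull f g h : pdvd f g -> pdvd f (h * g).
Proof. by rewrite mulrC; exact: pdvd_mulr. Qed.

Lemma pdvd_lprod_mem L v : v \in L -> pdvd (lform v) (lprod L).
Proof.
move=> vL; exists (lprod (rem v L)); rewrite -lprod_cons.
by apply: perm_big; exact: perm_to_rem.
Qed.

Lemma pdvd_lprod L v : v != 0 -> pdvd (lform v) (lprod L) -> exists2 w, w \in L & (w <= v)%MS.
Proof.
move=> v0; elim: L => [|w L IH].
  rewrite /lprod big_nil => -[g] /(congr1 (mrestr <<v>>%MS)) /eqP.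
  rewrite rmorph1 rmorphM /= (_ : mrestr _ (lform v) = 0) ?mul0r ?oner_eq0 //.
  by apply/lform_dvdP; exists 1; rewrite mulr1.
rewrite lprod_cons => /lform_prime [/lform_dvd_lform wv|/IH [u uL uv]].
  by exists w; rewrite ?mem_head.
by exists u => //; rewrite inE uL orbT.
Qed.

Lemma der_val_scale g b v : der_val (fun j => g * b j) v = g * der_val b v.
Proof. by rewrite mulr_sumr; apply: eq_bigr => j _; rewrite mulrA. Qed.

Definition nonprop L := forall v w, v \in L -> w \in L -> v != w -> ~~ (v <= w)%MS.

Lemma pdvd_lprod_all L f : uniq L -> 0 \notin L -> nonprop L ->
  (forall v, v \in L -> pdvd (lform v) f) -> pdvd (lprod L) f.
Proof.
elim: L f => [|v L IH] f /=; first by exists f; rewrite /lprod big_nil mul1r.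
rewrite inE negb_or => /andP [vL uL] /andP [v0 L0] LP fL.
have [g fE] := fL v (mem_head _ _).
have [h gE] : pdvd (lprod L) g.
  apply: IH => // [u w uL' wL'|w wL]; first by apply: LP; rewrite inE ?uL' ?wL' orbT.
  have : pdvd (lform w) (lform v * g) by rewrite -fE; apply: fL; rewrite inE wL orbT.
  case/lform_prime => // /lform_dvd_lform vw.
  have /negP : ~~ (v <= w)%MS; last by [].
  apply: LP; rewrite ?mem_head ?inE ?wL ?orbT //.
  by apply: contraNneq vL => ->.
by exists h; rewrite lprod_cons fE gE mulrA.
Qed.

(** By Cramer's rule, [\det A] times the vector [v] is the adjugate applied to
    a vector with all entries divisible by the form. *)
Lemma det_pdvd (A : 'M[S]_n) v : v != 0 ->
  (forall i, pdvd (lform v) (der_val (A i) v)) -> pdvd (lform v) (\det A).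
Proof.
move=> v0 Av; have /all_sig [h hE] i : {h | der_val (A i) v = lform v * h}.
  by apply: cid; exact: Av.
have [j vj] : exists j, v 0 j != 0 by apply/rV0Pn.
pose c := map_mx (@mpolyC n K) v^T.
have Ac : A *m c = lform v *: \col_i h i.
  apply/colP => i; rewrite !mxE -hE; apply: eq_bigr => k _.
  by rewrite !mxE.
have /colP /(_ j) : (\det A)%:M *m c = lform v *: (\adj A *m \col_i h i).
  by rewrite -mul_adj_mx -mulmxA Ac scalemxAr.
rewrite mul_scalar_mx !mxE => dE.
exists ((\sum_k (\adj A) j k * (\col_i h i) k 0) * ((v 0 j)^-1)%:MP).
by rewrite mulrA -dE -mulrA -mpolyCM mulfV // mpolyC1 mulr1.
Qed.

Lemma mpoly_unitP f g (c : K) : c != 0 -> f * g = c%:MP ->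
  exists2 a, a != 0 & f = a%:MP.
Proof.
move=> c0 fg; have : f * g != 0 by rewrite fg mpolyC_eq0.
rewrite mulf_eq0 negb_or => /andP [f0 g0].
have := congr1 (fun p : S => msize p) fg; rewrite msizeM // msizeC c0 /= => fgE.
apply/msize_poly1P; move: f0 g0 fgE; rewrite -!msize_poly_eq0.
by move: (msize f) (msize g) => [|[|a]] [|b] //=; rewrite ?addnS.
Qed.

(** The product [Q] of the forms divides the determinant since each form does.
    Conversely the quotient [r] is a unit. For each form [v] there are
    logarithmic derivations of the form [(Q / v) *: T] with determinant
    [(Q / v) ^ n * v] up to a constant; expressing them in the generators shows
    that [r] divides [(Q / v) ^ n.-1], so that [r] has only factors from the
    arrangement, and not [v]. This holds for every [v]. *)
Theorem saito_det L (A : 'M[S]_n) : uniq L -> 0 \notin L -> nonprop L ->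
  (forall i, logder L (A i)) ->
  (forall b, logder L b -> exists c : 'I_n -> S, forall j, b j = \sum_i c i * A i j) ->
  exists2 c, c != 0 & \det A = c *: lprod L.
Proof.
move=> uL L0 LP AL Agen.
have mxgen (B : 'M[S]_n) : (forall i, logder L (B i)) -> exists C, B = C *m A.
  move=> BL; have /all_sig [c cE] i : {c : 'I_n -> S | forall j, B i j = \sum_k c k * A k j}.
    by apply: cid; exact: Agen.
  by exists (\matrix_(i, j) c i j); apply/matrixP => i j; rewrite cE !mxE;
    apply: eq_bigr => k _; rewrite mxE.
have vn0 v : v \in L -> v != 0 by move=> vL; apply: contraNneq L0 => <-.
have [r dE] : pdvd (lprod L) (\det A).
  by apply: pdvd_lprod_all => // v vL; apply: det_pdvd; [exact: vn0|move=> i; exact: AL].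
have key v : v \in L ->
    exists c g, c != 0 /\ r * g = c%:MP * lprod (rem v L) ^+ n.-1.
  move=> vL.
  have v0 := vn0 v vL; have [j0 vj0] : exists j, v 0 j != 0 by apply/rV0Pn.
  pose Q := lprod (rem v L); have LQ : lprod L = lform v * Q.
    by rewrite -lprod_cons; apply: perm_big; exact: perm_to_rem.
  (* The rows of T are v times the derivative along x_j0 and, for i != j0,
     derivations that kill v. *)
  pose T : 'M[S]_n := \matrix_(i, j)
    if i == j0 then lform v *+ (j == j0)
    else (v 0 j0)%:MP *+ (i == j) - (v 0 i)%:MP *+ (j == j0).
  have Tv i : pdvd (lform v) (der_val (T i) v).
    rewrite /der_val; have [->|ij0] := eqVneq i j0.
      exists (v 0 j0)%:MP; rewrite (bigD1 j0) //= mxE !eqxx mulr1n big1 ?addr0 // => j jj0.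
      by rewrite mxE eqxx (negPf jj0) mulr0n mul0r.
    exists 0; rewrite mulr0 (bigD1 j0) //= (bigD1 i) //= big1 => [|j /andP [jj0 ji]].
      rewrite !mxE (negPf ij0) !eqxx !mulr0n !mulr1n sub0r subr0 addr0.
      by rewrite mulNr -!mpolyCM mulrC addNr.
    by rewrite mxE (negPf ij0) (negPf jj0) eq_sym (negPf ji) !mulr0n subr0 mul0r.
  have [C CE] : exists C, Q *: T = C *m A.
    apply: mxgen => i w wL.
    have -> : der_val ((Q *: T) i) w = Q * der_val (T i) w.
      by rewrite -der_val_scale; apply: eq_bigr => j _; rewrite mxE.
    have [->|wv] := eqVneq w v; first by apply: pdvd_mull; exact: Tv.
    by apply/pdvd_mulr/pdvd_lprod_mem; rewrite mem_rem_uniq // !inE wv.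
  have detT : \det T = lform v * ((v 0 j0) ^+ n.-1)%:MP.
    rewrite (expand_det_row T j0) (bigD1 j0) //= [X in _ + X]big1 ?addr0 => [|j jj0]; last first.
      by rewrite mxE eqxx (negPf jj0) mulr0n mul0r.
    rewrite mxE !eqxx mulr1n; congr (_ * _); rewrite /cofactor addnn -signr_odd odd_double mul1r.
    have -> : row' j0 (col' j0 T) = ((v 0 j0)%:MP)%:M.
      apply/matrixP => i j; rewrite !mxE eq_sym (negPf (neq_lift _ _)).
      by rewrite [_ == j0]eq_sym (negPf (neq_lift _ _)) subr0 (inj_eq lift_inj).
    by rewrite det_scalar rmorphXn.
  have n0 : (0 < n)%N by case: (n) j0 {vj0 T Tv CE detT} => // -[].
  have L'0 : 0 \notin rem v L by apply: contraNN L0 => /mem_rem.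
  have Q0 : Q != 0 by exact: lprod_neq0.
  have lv0 : lform v != 0 by rewrite lform_eq0.
  set c := (v 0 j0) ^+ n.-1 in detT; have c0 : c != 0 by rewrite expf_neq0.
  exists c, (\det C); split=> //.
  apply: (mulfI (mulf_neq0 lv0 Q0)); rewrite -LQ mulrA -dE mulrC -det_mulmx -CE detZ detT.
  have -> : Q ^+ n = Q * Q ^+ n.-1 by rewrite -exprS prednK.
  by rewrite LQ -/Q; ring.
suff [c c0 rE] : exists2 c, c != 0 & r = c%:MP.
  by exists c => //; rewrite dE rE mulrC mul_mpolyC.
have [LE|[v vL]] : L = [::] \/ exists v, v \in L.
  by case: (L) => [|v s]; [left|right; exists v; rewrite mem_head].
  have [C CE] := mxgen 1%:M (fun i v => ltac:(by rewrite LE)).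
  move: (congr1 determinant CE); rewrite det1 det_mulmx dE LE /lprod big_nil mul1r mulrC.
  by rewrite -mpolyC1 => /esym /mpoly_unitP; apply; exact: oner_neq0.
(* By the case of any v, r divides a product of forms; by the case of each
   form w, w does not divide r. *)
have [s [c [c0 [s0 [sL [g rg]]]]]] : exists s c, c != 0 /\ 0 \notin s /\
    {subset s <= L} /\ exists g, r * g = c%:MP * lprod s.
  have [c [g [c0 rg]]] := key v vL.
  exists (flatten (nseq n.-1 (rem v L))), c; split=> //.
  have sub : {subset flatten (nseq n.-1 (rem v L)) <= L}.
    by move=> w /flattenP [t /nseqP [-> _] /mem_rem].
  split; first by apply: contraNN L0 => /sub.
  split=> //; exists g; rewrite rg; congr (_ * _).
  by elim: (n.-1) => [|k IH]; rewrite ?expr0 /lprod ?big_nil //= exprS IH /lprod big_cat.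
have [w wL|g' gE] := lprod_dvd s0 _ rg.
  move=> wr; have wLL := sL _ wL; have [c' [g' [c0' rg']]] := key w wLL.
  have : pdvd (lform w) (c'%:MP * lprod (rem w L) ^+ n.-1) by rewrite -rg'; exact: pdvd_mulr.
  case/lform_prime => [[u]|].
    move=> /(congr1 (fun p : S => msize p)) /esym /eqP.
    have [->|u0] := eqVneq u 0; first by rewrite mulr0 msize0 msizeC c0'.
    rewrite msizeM ?lform_eq0 ?vn0 // msize_lform_neq0 ?vn0 // msizeC c0' addSn /= add1n eqSS.
    by rewrite msize_poly_eq0 (negPf u0).
  have Qw : ~ pdvd (lform w) (lprod (rem w L)).
    move=> /(pdvd_lprod (vn0 w wLL)) [u]; rewrite mem_rem_uniq // !inE => /andP [uw uL'].
    by apply/negP; exact: LP.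
  elim: (n.-1) => [|k IHk]; last by rewrite exprS => /lform_prime [].
  rewrite expr0 => -[u] u1; apply: Qw; exists (u * lprod (rem w L)).
  by rewrite mulrA -u1 mul1r.
have sn0 : lprod s != 0 by exact: lprod_neq0.
apply: (@mpoly_unitP r g' c c0); apply: (mulIf sn0).
by rewrite -mulrA -gE rg.
Qed.

End Saito.

(** * Specialization to finite fields *)

Lemma finfield_root (F : finFieldType) (p : {poly F}) : (1 < size p)%N ->
  exists (F' : finFieldType) (i : {rmorphism F -> F'}) (z : F'), root (map_poly i p) z.
Proof.
move=> p1; have p0 : p != 0 by rewrite -size_poly_eq0; case: (size p) p1.
have [L [rs pE _]] := FinSplittingFieldFor p0.
have : size (map_poly (in_alg L) p) = size (\prod_(z <- rs) ('X - z%:P)) by exact: eqp_size.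
rewrite size_map_poly size_prod_XsubC => rs1.
case: rs rs1 pE => [/= e|z rs _ pE]; first by rewrite e in p1.
exists (FinFieldExtType L), (in_alg L : {rmorphism F -> L}), z.
by rewrite (eqp_root pE) root_prod_XsubC mem_head.
Qed.

(** The polynomial X^q - X + 1 has no root in a field with q elements, so that
    adjoining a root gives a larger field. *)
Lemma finfield_large (F : finFieldType) N :
  exists (F' : finFieldType) (i : {rmorphism F -> F'}), (N < #|F'|)%N.
Proof.
elim: N => [|N [F' [i NF]]]; first by exists F, idfun; apply/card_gt0P; exists 0.
pose p : {poly F'} := 'X^#|F'| - 'X + 1.
have q1 : (1 < #|F'|)%N by exact: finNzRing_gt1.
have p1 : (1 < size p)%N.
  rewrite /p -addrA size_polyDl size_polyXn ?ltnS ?(ltnW q1) //.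
  rewrite (leq_trans (size_polyD _ _)) // size_polyN size_polyX size_poly1 geq_max.
  by rewrite q1 ltnW.
have [F'' [j [z pz]]] := finfield_root p1.
exists F'', (j \o i); apply: leq_ltn_trans NF _.
rewrite -(card_codom (fmorph_inj j)) -[X in (_ < X)%N]cardsT.
rewrite -[X in (X < _)%N]cardsE; apply: proper_card; rewrite properT.
apply/eqP => /setP /(_ z); rewrite !inE => /codomP [x zx].
move: pz; rewrite zx /root horner_map /p !hornerE expf_card subrr add0r.
by rewrite rmorph1 oner_eq0.
Qed.

Section Specialization.
Variable K : fieldType.

(** A hypersurface of the affine scheme of [A] that does not contain the point
    [e] misses some point over a finite field in the closure of [e]. The
    quantifier over [G] makes the property stable under adjoining elements. *)
Definition specializable (A : comNzRingType) (e : {rmorphism A -> K}) :=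
  forall G, e G != 0 -> exists (F : finFieldType) (f : {rmorphism A -> F}),
    f G != 0 /\ forall x, e x = 0 -> f x = 0.

(** A prime larger than [G] does not divide it. *)
Lemma specializable_int : [pchar K] =i pred0 ->
  specializable (GRing.RMorphism.clone int K intr _).
Proof.
move=> /pcharf0P K0 G G0; have [p pG p_pr] := prime_above `|G|.
exists ('F_p : finFieldType), (GRing.RMorphism.clone int 'F_p intr _).
have intr_abs (R : nzRingType) (x : int) : (x%:~R == 0 :> R) = (`|x|%N%:R == 0 :> R).
  by case: x => k //=; rewrite NegzE rmorphN oppr_eq0.
rewrite /= in G0 *; split=> [|x /eqP].
  rewrite intr_abs -(dvdn_pcharf (pchar_Fp p_pr)).
  have : (`|G| != 0)%N by apply: contraNneq G0 => G0; rewrite intr_abs G0.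
  by rewrite -lt0n => G1; apply: contraTN pG => /(dvdn_leq G1); rewrite -leqNgt.
by rewrite intr_abs K0 => /eqP x0; apply/eqP; rewrite intr_abs x0.
Qed.

Section Step.
Variables (A : comNzRingType) (e : {rmorphism A -> K}) (c : K).
Hypothesis spec : specializable e.

Definition adjoin_eval : {poly A} -> K := horner_eval c \o map_poly e.
HB.instance Definition _ := GRing.RMorphism.copy adjoin_eval (horner_eval c \o map_poly e).

Lemma adjoin_evalE p : adjoin_eval p = (map_poly e p).[c].
Proof. by []. Qed.

Let e_eq (F : finFieldType) (f : {rmorphism A -> F}) :
  (forall x, e x = 0 -> f x = 0) ->
  forall p q, map_poly e p = map_poly e q -> map_poly f p = map_poly f q.
Proof.
move=> ef p q /polyP pq; apply/polyP => i; rewrite !coef_map.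
apply/eqP; rewrite -subr_eq0 -rmorphB ef //.
by have := pq i; rewrite !coef_map /= => pqi; rewrite rmorphB /= pqi subrr.
Qed.

Let size_map_leq p : (size (map_poly e p) <= size p)%N.
Proof. exact: size_poly. Qed.

Let trunc p : exists2 q, map_poly e q = map_poly e p & size (map_poly e q) = size q.
Proof.
have qE : map_poly e (take_poly (size (map_poly e p)) p) = map_poly e p.
  apply/polyP => i; rewrite coef_map coef_take_poly /=; case: ltnP => ip.
    by rewrite coef_map.
  by rewrite rmorph0 nth_default.
exists (take_poly (size (map_poly e p)) p) => //.
by apply/eqP; rewrite eqn_leq size_map_leq qE size_take_poly.
Qed.

Let lead_trunc q : size (map_poly e q) = size q -> q != 0 -> e (lead_coef q) != 0.
Proof.
by move=> sq q0; rewrite lead_coefE -coef_map -sq -lead_coefE lead_coef_eq0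
  -size_poly_eq0 sq size_poly_eq0.
Qed.

(** If [c] is transcendental over the image of [A], one may send it to any
    element of a finite field at which the reduction of [G] does not vanish;
    a root of X G + 1 in an extension is such an element. *)
Lemma specializable_transc : (forall p, adjoin_eval p = 0 -> map_poly e p = 0) ->
  specializable adjoin_eval.
Proof.
move=> trc G G0.
have [j Gj] : exists j, e G`_j != 0.
  apply/notP => Gj; case/eqP: G0; rewrite /= adjoin_evalE.
  have -> : map_poly e G = 0; last by rewrite horner0.
  by apply/polyP => j; rewrite coef_map coef0 /=; apply/eqP/negPn/negP => Gj0; apply: Gj; exists j.
have [F [f [fG fe]]] := spec Gj.
have G'0 : map_poly f G != 0.
  by apply: contraNneq fG => /polyP /(_ j); rewrite coef_map coef0 /= => ->.
have p1 : (1 < size (map_poly f G * 'X + 1)%R)%N.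
  have sM : size (map_poly f G * 'X) = (size (map_poly f G)).+1 by rewrite size_mulX.
  by rewrite size_polyDl sM ?size_poly1 ltnS size_poly_gt0.
have [F' [i [z pz]]] := finfield_root p1.
exists F', (horner_eval z \o map_poly (i \o f)); split; last first.
  move=> x /trc x0; rewrite /= /horner_eval (_ : map_poly _ x = 0) ?horner0 //.
  have := e_eq fe (etrans x0 (esym (rmorph0 (map_poly e)))).
  by rewrite rmorph0 map_poly_comp => ->; rewrite rmorph0.
move: pz; rewrite /root rmorphD rmorphM rmorph1 /= map_polyX !hornerE -map_poly_comp.
rewrite /horner_eval; apply: contraTneq => ->.
by rewrite mul0r add0r oner_eq0.
Qed.

(** If [c] is algebraic over the image of [A], take [m] of minimal degree among
    the polynomials over [A] that vanish at [c] and are nonzero over [K], and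
    send [c] to a root of the reduction of [m], at a place where the leading
    coefficient of [m] is nonzero. To keep [G] nonzero there, Euclidean division first produces a
    nonzero constant [h] among the combinations of [G] and [m]; it is enough
    that [h] reduces to a nonzero element. *)
Lemma specializable_alg p0 : adjoin_eval p0 = 0 -> map_poly e p0 != 0 ->
  specializable adjoin_eval.
Proof.
move=> p0c p00.
(* The polynomial m over A of minimal degree with root c. *)
pose Pm k := `[< exists m, [/\ adjoin_eval m = 0, map_poly e m != 0 & size (map_poly e m) = k] >].
have exm : exists k, Pm k by exists (size (map_poly e p0)); apply/asboolP; exists p0.
case: (ex_minnP exm) => km /asboolP [m1 [m1c m10 m1k]] minm.
have [m mE sm] := trunc m1.
have mc : adjoin_eval m = 0 by rewrite adjoin_evalE mE.
have em0 : map_poly e m != 0 by rewrite mE.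
have mk : size m = km by rewrite -sm mE.
have m0 : m != 0 by rewrite -size_poly_eq0 -sm size_poly_eq0.
have l0 := lead_trunc sm m0.
have small p : adjoin_eval p = 0 -> (size (map_poly e p) < size m)%N -> map_poly e p = 0.
  move=> pc; rewrite mk ltnNge => pk; apply/eqP; apply: contraNT pk => p_0.
  by apply: minm; apply/asboolP; exists p.
have m_gt1 : (1 < size m)%N.
  rewrite ltnNge; apply/negP; rewrite -sm => /size1_polyC mC.
  move: mc em0; rewrite adjoin_evalE mC hornerC => ->.
  by rewrite eqxx.
move=> G G0.
(* A polynomial H of minimal degree in the ideal of G and m, not vanishing
   at c. *)
pose inI H := exists u v, map_poly e H = map_poly e (u * G + v * m) /\ adjoin_eval H != 0.
pose PH k := `[< exists H, inI H /\ size (map_poly e H) = k >].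
have exH : exists k, PH k.
  exists (size (map_poly e G)); apply/asboolP; exists G; split=> //.
  by exists 1, 0; rewrite mul1r mul0r addr0.
case: (ex_minnP exH) => kH /asboolP [H1 [[u [v [H1E H1c]]] H1k]] minH.
have [H HE sH] := trunc H1.
have Hc : adjoin_eval H != 0 by rewrite adjoin_evalE HE.
have Hk : size H = kH by rewrite -sH HE.
rewrite -HE in H1E.
have H0 : H != 0 by apply: contraNneq Hc => ->; rewrite rmorph0.
have minH' H2 : inI H2 -> (size H <= size H2)%N.
  move=> H2I; apply: leq_trans (size_map_leq H2); rewrite Hk; apply: minH.
  by apply/asboolP; exists H2.
have sHm : (size H < size m)%N.
  rewrite ltnNge; apply/negP => mH.
  have := Pdiv.ComRing.rdivp_eq m H.
  set q := Pdiv.Ring.rdivp _ _; set r := Pdiv.Ring.rmodp _ _; set k := Pdiv.Ring.rscalp _ _ => HqE.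
  have sr : (size r < size H)%N by apply: leq_trans mH; exact: Pdiv.Ring.ltn_rmodpN0.
  have rE : r = (lead_coef m ^+ k)%:P * H - q * m by rewrite mul_polyC HqE addrC addKr.
  have /minH' : inI r; last by rewrite leqNgt sr.
  exists ((lead_coef m ^+ k)%:P * u), ((lead_coef m ^+ k)%:P * v - q); split.
    rewrite rE rmorphB rmorphM /= H1E -rmorphM -rmorphB /=; congr (map_poly e _); ring.
  rewrite rE rmorphB !rmorphM /= mc mulr0 subr0 mulf_neq0 //.
  by rewrite adjoin_evalE map_polyC hornerC /= rmorphXn expf_neq0.
(* Otherwise the remainder of m by H would vanish at c, and m would be
   divisible by H up to constants, with a quotient of smaller degree vanishing
   at c. *)
have sH1 : (size H <= 1)%N.
  rewrite leqNgt; apply/negP => H_gt1.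
  have := Pdiv.ComRing.rdivp_eq H m.
  set q := Pdiv.Ring.rdivp _ _; set r := Pdiv.Ring.rmodp _ _; set k := Pdiv.Ring.rscalp _ _ => mqE.
  have sr : (size r < size H)%N by exact: Pdiv.Ring.ltn_rmodpN0.
  have rE : r = (lead_coef H ^+ k)%:P * m - q * H by rewrite mul_polyC mqE addrC addKr.
  have rc : adjoin_eval r = 0.
    apply: contraTeq sr => rc; rewrite -leqNgt; apply: minH'.
    exists (- (q * u)), ((lead_coef H ^+ k)%:P - q * v); split=> //.
    rewrite rE rmorphB (rmorphM _ q) /= H1E -rmorphM -rmorphB /=; congr (map_poly e _); ring.
  have r0 : map_poly e r = 0.
    by apply: small rc _; apply: leq_ltn_trans (size_map_leq _) _; exact: ltn_trans sr sHm.
  have qc : adjoin_eval q = 0.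
    move: rc; rewrite rE rmorphB !rmorphM /= mc mulr0 sub0r => /eqP.
    by rewrite oppr_eq0 mulf_eq0 (negPf Hc) orbF => /eqP.
  have lH : e (lead_coef H ^+ k) != 0 by rewrite rmorphXn expf_neq0 // lead_trunc.
  have qHE : (e (lead_coef H ^+ k))%:P * map_poly e m = map_poly e q * map_poly e H.
    move/eqP: r0; rewrite rE rmorphB !rmorphM /= map_polyC /=.
    by rewrite subr_eq0 => /eqP.
  have q0 : map_poly e q != 0.
    apply: contraNneq em0 => q0; move/eqP: qHE; rewrite q0 mul0r mulf_eq0 polyC_eq0.
    by rewrite (negPf lH).
  case/eqP: q0; apply: small qc _.
  have := congr1 (fun p : {poly K} => size p) qHE.
  rewrite mul_polyC size_scale // sm => ->; rewrite size_mul //.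
    by rewrite sH; move: H_gt1; case: (size H) => [|[|h]] // _; rewrite addnS /= addnS ltnS leq_addr.
  - apply: contraNneq em0 => q0; move/eqP: qHE; rewrite q0 mul0r mulf_eq0 polyC_eq0.
    by rewrite (negPf lH).
  by rewrite -size_poly_eq0 sH size_poly_eq0.
set h := H`_0; have HC : H = h%:P := size1_polyC sH1.
have h0 : e h != 0 by move: Hc; rewrite HC adjoin_evalE map_polyC hornerC.
have lh0 : e (lead_coef m * h) != 0 by rewrite rmorphM mulf_neq0.
have [F [f [fG fe]]] := spec lh0.
move: fG; rewrite rmorphM mulf_eq0 negb_or => /andP [fl fh].
have p1 : (1 < size (map_poly f m))%N by rewrite size_map_poly_id0.
have [F' [i [z pz]]] := finfield_root p1.
pose g : {rmorphism {poly A} -> F'} := horner_eval z \o map_poly (i \o f).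
have gE p q : map_poly e p = map_poly e q -> g p = g q.
  by move=> /(e_eq fe) pq; rewrite /= /horner_eval !map_poly_comp pq.
have gm : g m = 0 by apply/eqP; rewrite /= /horner_eval map_poly_comp.
have gC a : g a%:P = i (f a) by rewrite /= /horner_eval map_polyC hornerC.
exists F', g; split=> [|p pc].
  have := gE _ _ H1E; rewrite HC gC rmorphD !rmorphM gm mulr0 addr0 => hE.
  have : i (f h) != 0 by rewrite fmorph_eq0.
  by rewrite hE mulf_eq0 negb_or => /andP [].
(* A polynomial vanishing at c is divisible by m up to a power of the
   leading coefficient, which is invertible at the chosen place. *)
have := Pdiv.ComRing.rdivp_eq m p.
set q := Pdiv.Ring.rdivp _ _; set r := Pdiv.Ring.rmodp _ _; set k := Pdiv.Ring.rscalp _ _ => pqE.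
have rE : r = (lead_coef m ^+ k)%:P * p - q * m by rewrite mul_polyC pqE addrC addKr.
have r0 : map_poly e r = map_poly e 0.
  rewrite rmorph0; apply: small.
    by rewrite rE rmorphB !rmorphM /= mc pc !mulr0 subrr.
  by apply: leq_ltn_trans (size_map_leq _) _; exact: Pdiv.Ring.ltn_rmodpN0.
move: (gE _ _ r0); rewrite rmorph0 rE rmorphB !rmorphM gm mulr0 subr0 gC => /eqP.
by rewrite mulf_eq0 fmorph_eq0 rmorphXn expf_eq0 (negPf fl) andbF => /eqP.
Qed.

Lemma specializable_adjoin : specializable adjoin_eval.
Proof.
have [trc|] := pselect (forall p, adjoin_eval p = 0 -> map_poly e p = 0).
  exact: specializable_transc.
move=> /existsNP [p /not_implyP [pc /eqP p0]]; exact: specializable_alg pc p0.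
Qed.

End Step.

(** The elements are adjoined one at a time to the ring of integers. *)
Theorem specialization (cs : seq K) : [pchar K] =i pred0 ->
  exists (A : comNzRingType) (e : {rmorphism A -> K}) (F : finFieldType)
         (f : {rmorphism A -> F}),
    (forall x, e x = 0 -> f x = 0) /\ forall c, c \in cs -> exists a, e a = c.
Proof.
move=> K0.
suff [A [e [spec csA]]] : exists (A : comNzRingType) (e : {rmorphism A -> K}),
    specializable e /\ forall c, c \in cs -> exists a, e a = c.
  have [|F [f [_ fe]]] := spec 1; first by rewrite rmorph1 oner_neq0.
  by exists A, e, F, f.
elim: cs => [|c cs [A [e [spec csA]]]].
  exists int, (GRing.RMorphism.clone int K intr _).
  by split=> //; exact: specializable_int.
exists {poly A}, (@adjoin_eval A e c); split; first exact: specializable_adjoin.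
move=> c'; rewrite inE => /predU1P [->|/csA [a <-]].
  by exists 'X; rewrite /= adjoin_evalE map_polyX hornerX.
by exists a%:P; rewrite /= adjoin_evalE map_polyC hornerC.
Qed.

End Specialization.

(** * Growth of the number of monomials *)

Section Balls.
Variable n : nat.
Local Open Scope nat_scope.

(** The number of monomials of degree at most [N], i.e., the dimension of the
    space of polynomials of degree at most [N]. *)
Definition ball N := #|{: 'X_{1..n < N.+1}}|.

Lemma ball_gt0 N : 0 < ball N.
Proof.
have z0 : mdeg (0%MM : 'X_{1..n}) < N.+1 by rewrite mdeg0.
by apply/card_gt0P; exists (BMultinom z0).
Qed.

Lemma ball_le_exp N : ball N <= N.+1 ^ n.
Proof.
have le (m : 'X_{1..n < N.+1}) i : m i < N.+1.
  by apply: leq_ltn_trans (bmdeg m); rewrite mdegE (bigD1 i) //= leq_addr.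
pose g (m : 'X_{1..n < N.+1}) : {ffun 'I_n -> 'I_N.+1} := [ffun i => Ordinal (le m i)].
have gi : injective g.
  move=> m m' /ffunP mm; apply: val_inj; apply/mnmP => i.
  by have := congr1 val (mm i); rewrite !ffunE.
by have := leq_card g gi; rewrite card_ffun !card_ord.
Qed.

Lemma bernoulli a j : a ^ j * (a + j) <= a * a.+1 ^ j.
Proof.
elim: j => [|j IH]; first by rewrite !expn0 mul1n addn0 muln1.
have h : a ^ j * (a + j) * a.+1 <= a * a.+1 ^ j.+1.
  by rewrite [a.+1 ^ _]expnSr mulnA leq_mul2r IH orbT.
apply: leq_trans h; rewrite expnSr -!mulnA leq_mul2l; apply/orP; right; nia.
Qed.

(** Iterating the hypothesis gives [a ^ k <= a' ^ k * ball (k * D)], and the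
    last factor only grows polynomially with [k]. *)
Lemma ball_growth a a' D : (forall N, a * ball N <= a' * ball (N + D)) -> a <= a'.
Proof.
move=> H; have Hk k : a ^ k <= a' ^ k * ball (k * D).
  elim: k => [|k IH]; first by rewrite !expn0 mul1n ball_gt0.
  rewrite !expnS; apply: leq_trans (_ : _ <= a * (a' ^ k * ball (k * D))) _.
    by rewrite leq_mul2l IH orbT.
  rewrite mulnCA; apply: leq_trans (_ : _ <= a' ^ k * (a' * ball (k * D + D))) _.
    by rewrite leq_mul2l H orbT.
  by rewrite mulSn addnC; lia.
rewrite leqNgt; apply/negP => aa'.
have [a0|a0] := posnP a'.
  by have := H 0; rewrite a0 mul0n leqn0 muln_eq0 (gtn_eqF (ball_gt0 _)) orbF => /eqP az; rewrite az ltn0 in aa'.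
(* With k = j (n + 1), the Bernoulli inequality gives j^(n+1) <= C j^n,
   which fails for j = C + 1. *)
pose C := a' ^ n.+1 * (n.+1 * D).+1 ^ n; pose j := C.+1.
have jk := Hk (j * n.+1).
have b1 : (a'.+1 ^ j) ^ n.+1 <= (a' ^ j) ^ n.+1 * (j * n.+1 * D).+1 ^ n.
  rewrite -!expnM; apply: leq_trans (leq_trans _ jk) _.
    by rewrite leq_exp2r // muln_gt0.
  by rewrite leq_mul2l ball_le_exp orbT.
have b2 : (a' ^ j) ^ n.+1 * (a' + j) ^ n.+1 <= (a' ^ j) ^ n.+1 * (a' ^ n.+1 * (j * n.+1 * D).+1 ^ n).
  rewrite -expnMn; apply: leq_trans (_ : _ <= (a' * a'.+1 ^ j) ^ n.+1) _.
    by rewrite leq_exp2r // bernoulli.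
  by rewrite expnMn mulnCA leq_mul2l b1 orbT.
rewrite leq_pmul2l in b2; last by rewrite !expn_gt0 a0.
have b3 : (j * n.+1 * D).+1 ^ n <= j ^ n * (n.+1 * D).+1 ^ n.
  have lexp x y k : x <= y -> x ^ k <= y ^ k by case: k => // k xy; rewrite leq_exp2r.
  rewrite -expnMn; apply: lexp.
  have -> : j * (n.+1 * D).+1 = j + j * n.+1 * D by rewrite mulnS mulnA.
  by rewrite -add1n leq_add2r.
have : j ^ n.+1 <= C * j ^ n.
  apply: leq_trans (_ : _ <= (a' + j) ^ n.+1) _; first by rewrite leq_exp2r // leq_addl.
  apply: leq_trans b2 _; rewrite /C -[X in _ <= X]mulnA leq_mul2l; apply/orP; right.
  by rewrite [X in _ <= X]mulnC.
by rewrite expnS leq_mul2r expn_eq0 /= ltnn.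
Qed.

End Balls.

Section Counting.
Variables (n : nat) (e : 'I_n -> nat).
Local Open Scope nat_scope.

Definition wt (m : 'X_{1..n}) := \sum_i m i * e i.

Lemma wtD m1 m2 : wt (m1 + m2)%MM = wt m1 + wt m2.
Proof. by rewrite -big_split; apply: eq_bigr => i _; rewrite mnmDE mulnDl. Qed.

Lemma wt0 : wt 0%MM = 0.
Proof. by rewrite /wt big1 // => i _; rewrite mnm0E. Qed.

Lemma wtU i : wt U_(i)%MM = e i.
Proof.
rewrite /wt (bigD1 i) //= mnm1E eqxx mul1n big1 ?addn0 // => j ji.
by rewrite mnm1E eq_sym (negPf ji).
Qed.

(** The number of monomials of weight at most [N]. Up to a shift of [N], this is
    [ball N] divided by the product of the weights. *)
Definition wball N := #|[pred m : 'X_{1..n < N.+1} | wt m <= N]|.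

Hypothesis e_gt0 : forall i, 0 < e i.
Let E := \prod_i e i.

Lemma mdeg_wt m : mdeg m <= wt m.
Proof. by rewrite mdegE; apply: leq_sum => i _; rewrite leq_pmulr. Qed.

Let rem_type := {dffun forall i : 'I_n, 'I_(e i)}.

Let card_rem : #|{: rem_type}| = E.
Proof. by rewrite card_dep_ffun /E foldrE big_map big_enum; apply: eq_bigr => i _; rewrite card_ord. Qed.

(** Euclidean division of the exponents by the weights is injective. *)
Lemma ball_le_wball N : ball n N <= E * wball N.
Proof.
pose quo (m : 'X_{1..n}) : 'X_{1..n} := [multinom m i %/ e i | i < n].
have wtq m : wt (quo m) <= mdeg m.
  by rewrite mdegE; apply: leq_sum => i _; rewrite mnmE leq_trunc_div.
have dq (m : 'X_{1..n < N.+1}) : mdeg (quo m) < N.+1.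
  by apply: leq_ltn_trans (mdeg_wt _) _; apply: leq_ltn_trans (wtq _) (bmdeg m).
have wq (m : 'X_{1..n < N.+1}) : wt (BMultinom (dq m)) <= N.
  by apply: leq_trans (wtq _) _; rewrite -ltnS bmdeg.
pose g (m : 'X_{1..n < N.+1}) : rem_type * {m : 'X_{1..n < N.+1} | wt m <= N} :=
  ([ffun i => Ordinal (ltn_pmod (m i) (e_gt0 i))], exist _ (BMultinom (dq m)) (wq m)).
have gi : injective g.
  move=> m m' gE; have /ffunP r := congr1 fst gE.
  have /mnmP qq := congr1 (fun u => val (val u.2)) gE.
  apply: val_inj; apply/mnmP => i.
  have := congr1 val (r i); rewrite !ffunE /= => ri.
  by have := qq i; rewrite !mnmE => qi; rewrite (divn_eq (m i) (e i)) ri qi -divn_eq.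
have -> : E * wball N = #|{: rem_type * {m : 'X_{1..n < N.+1} | wt m <= N}}|.
  by rewrite card_prod card_rem card_sig.
exact: leq_card g gi.
Qed.

(** Conversely, a quotient and remainders determine exponents. *)
Lemma wball_le_ball N : E * wball N <= ball n (N + \sum_i e i).
Proof.
pose T := {m : 'X_{1..n < N.+1} | wt m <= N}.
have dq (r : rem_type) (m : T) :
    mdeg [multinom val m i * e i + r i | i < n] < (N + \sum_i e i).+1.
  rewrite mdegE ltnS; under eq_bigr => i _ do rewrite mnmE.
  rewrite big_split leq_add ?(valP m) //; apply: leq_sum => i _; exact: ltnW.
pose g (x : rem_type * T) : 'X_{1..n < (N + \sum_i e i).+1} := BMultinom (dq x.1 x.2).
have gi : injective g.
  move=> [r m] [r' m'] /(congr1 val) /mnmP /= rm.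
  have rmi i : r i = r' i :> nat /\ val m i = val m' i :> nat.
    have := rm i; rewrite !mnmE => eqi; split.
      by have := congr1 (fun k => k %% e i) eqi; rewrite !modnMDl !modn_small.
    have := congr1 (fun k => k %/ e i) eqi.
    by rewrite !divnMDl // !divn_small // !addn0.
  congr (_, _); first by apply/ffunP => i; apply: val_inj; case: (rmi i).
  by do 2!apply: val_inj; apply/mnmP => i; case: (rmi i).
have -> : E * wball N = #|{: rem_type * T}| by rewrite card_prod card_rem card_sig.
exact: leq_card g gi.
Qed.

End Counting.

(** * Interpolation on the points of affine space over a finite field *)

Lemma mpoly_ring_ind (R : comNzRingType) n (P : {mpoly R[n]} -> Prop) :
  (forall c, P c%:MP) -> (forall i, P 'X_i) ->
  (forall f g, P f -> P g -> P (f + g)) ->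
  (forall f g, P f -> P g -> P (f * g)) -> forall f, P f.
Proof.
move=> PC PX PD PM f; rewrite [f]mpolyE; elim/big_ind: _ => //.
  by rewrite -mpolyC0.
move=> m _; rewrite -mul_mpolyC; apply: (PM) => //; rewrite mpolyXE_id.
elim/big_ind: _ => [||i _]; [by rewrite -mpolyC1|exact: PM|].
elim: (m i) => [|k IH]; first by rewrite expr0 -mpolyC1.
by rewrite exprS; apply: (PM).
Qed.

Section PointIdeal.
Variables (F : finFieldType) (n : nat).
Notation S := {mpoly F[n]}.
Notation q := #|F|.
Implicit Types (z : 'rV[F]_n) (s t : S).

Definition ev z (s : S) : F := s.@[fun i => z 0 i].
HB.instance Definition _ z := GRing.LRMorphism.copy (ev z) (meval (fun i => z 0 i)).

Lemma evX z i : ev z 'X_i = z 0 i.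
Proof. exact: mevalXU. Qed.

Lemma evC z c : ev z c%:MP = c.
Proof. exact: mevalC. Qed.

(** The function on [F] that is 1 at [a] and 0 elsewhere, by Fermat's
    theorem; its multivariate version [dirac z] is the delta function of the
    point [z]. *)
Definition dirac1 (x : S) (a : F) : S := 1 - (x - a%:MP) ^+ q.-1.
Definition dirac z : S := \prod_j dirac1 'X_j (z 0 j).

Lemma q_gt1 : (1 < q)%N.
Proof. exact: finNzRing_gt1. Qed.

Lemma expf_pred (a : F) : a ^+ q.-1 = (a != 0)%:R.
Proof.
have [->|a0] := eqVneq a 0; first by rewrite expr0n; case: (q) q_gt1 => [|[]].
apply: (mulfI a0); rewrite -exprS prednK ?(ltnW q_gt1) // mulr1.
exact: expf_card.
Qed.

Lemma frobD (x y : S) : (x + y) ^+ q = x ^+ q + y ^+ q.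
Proof.
have [p p_pr pF] := finPcharP F.
have pS : p \in [pchar S] by rewrite (pchar_lalg S).
apply: exprDn_pchar; rewrite (eq_pnat _ (pcharf_eq pS)) -cardsT.
exact: abelem_pgroup (fin_ring_pchar_abelem pF).
Qed.

Lemma ev_dirac z z' : ev z' (dirac z) = (z' == z)%:R.
Proof.
rewrite /dirac rmorph_prod /=.
have E j : ev z' (dirac1 'X_j (z 0 j)) = (z' 0 j == z 0 j)%:R.
  rewrite rmorphB rmorph1 rmorphXn rmorphB /= evX evC expf_pred subr_eq0.
  by case: eqP; rewrite ?subr0 ?subrr.
under eq_bigr => j _ do rewrite E.
have [->|zz] := eqVneq z' z; first by rewrite big1 // => j _; rewrite eqxx.
have [j zj] : exists j, z' 0 j != z 0 j.
  apply/existsP; apply: contraNT zz => /existsPn zz; apply/eqP/rowP => j.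
  by have := zz j; rewrite negbK => /eqP.
by rewrite (bigD1 j) //= (negPf zj) mul0r.
Qed.

Lemma msize_dirac z : (msize (dirac z) <= (n * q.-1).+1)%N.
Proof.
have E j : (msize (dirac1 'X_j (z 0%R j)) <= q.-1.+1)%N.
  apply: leq_trans (msizeD_le _ _) _; rewrite geq_max msize1 msizeN /=.
  rewrite -[X in (_ <= X.+1)%N]mul1n; apply: msize_exp_bound.
  apply: leq_trans (msizeD_le _ _) _; rewrite geq_max msizeX mdeg1 msizeN /=.
  by rewrite msizeC; case: (_ != _).
apply: leq_trans (msize_prod_bound _ E) _.
by rewrite sum_nat_const card_ord.
Qed.

(** An identity of polynomials and not only of functions on [F]: both sides have
    degree less than [q] and agree at the [q] elements of [F]. *)
Lemma sum_dirac1 (x : S) : \sum_a dirac1 x a = 1.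
Proof.
(* The same identity in one variable, where roots can be counted. *)
pose p : {poly F} := \sum_a (1 - ('X - a%:P) ^+ q.-1) - 1.
have sp : (size p <= q)%N.
  apply: leq_trans (size_polyD _ _) _; rewrite size_polyN size_poly1 geq_max (ltnW q_gt1) andbT.
  elim/big_ind: _ => [|u v uq vq|a _]; first by rewrite size_poly0.
    by apply: leq_trans (size_polyD _ _) _; rewrite geq_max uq.
  apply: leq_trans (size_polyD _ _) _; rewrite size_polyN size_poly1 geq_max (ltnW q_gt1) /=.
  by rewrite size_exp_XsubC prednK // (ltnW q_gt1).
have p0 : p = 0.
  apply/eqP; apply: contraTT sp => p0; rewrite -ltnNge.
  have := @max_poly_roots _ p (enum F) p0; rewrite enum_uniq -cardE; apply => //.
  apply/allP => b _; rewrite /root /p hornerD hornerN hornerC horner_sum subr_eq0.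
  rewrite (bigD1 b) //= !hornerE big1 => [|a ab].
    by rewrite subrr expf_pred eqxx subr0 addr0.
  by rewrite !hornerE expf_pred subr_eq0 eq_sym ab subrr.
have := congr1 (fun p : {poly F} => (map_poly (@mpolyC n F) p).[x]) p0.
rewrite rmorph0 horner0 rmorphB rmorph1 rmorph_sum hornerD hornerN hornerC horner_sum /=.
move/eqP; rewrite subr_eq0 => /eqP <-; apply: eq_bigr => a _.
by rewrite rmorphB rmorph1 rmorphXn rmorphB /= map_polyX map_polyC !hornerE.
Qed.

Lemma sum_dirac : \sum_z dirac z = 1.
Proof.
transitivity (\sum_(z : {ffun 'I_n -> F}) \prod_j dirac1 'X_j (z j)).
  rewrite (reindex (fun z : {ffun 'I_n -> F} => \row_j z j)) /=.
    by apply: eq_bigr => z _; apply: eq_bigr => j _; rewrite mxE.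
  exists (fun z : 'rV_n => [ffun j => z 0 j]) => z _.
    by apply/ffunP => j; rewrite ffunE mxE.
  by apply/rowP => j; rewrite mxE ffunE.
rewrite -(bigA_distr_bigA (fun j a => dirac1 'X_j a)) big1 // => j _.
exact: sum_dirac1.
Qed.

Variables (I : finType) (f : I -> S).

Definition ideal_gen (s : S) := exists w : I -> S, s = \sum_i f i * w i.

Lemma ideal_genD s t : ideal_gen s -> ideal_gen t -> ideal_gen (s + t).
Proof.
move=> [w ->] [w' ->]; exists (fun i => w i + w' i); rewrite -big_split.
by apply: eq_bigr => i _; rewrite mulrDr.
Qed.

Lemma ideal_genM s t : ideal_gen t -> ideal_gen (s * t).
Proof.
move=> [w ->]; exists (fun i => s * w i); rewrite mulr_sumr.
by apply: eq_bigr => i _; rewrite mulrCA.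
Qed.

Lemma ideal_genN s : ideal_gen s -> ideal_gen (- s).
Proof. by rewrite -mulN1r; exact: ideal_genM. Qed.

Lemma ideal_gen0 : ideal_gen 0.
Proof. by exists (fun=> 0); rewrite big1 // => i _; rewrite mulr0. Qed.

Lemma ideal_gen_mem i : ideal_gen (f i).
Proof.
exists (fun j => (j == i)%:R); rewrite (bigD1 i) //= eqxx mulr1 big1 ?addr0 // => j.
by move/negPf->; rewrite mulr0.
Qed.

Lemma ideal_gen_sum J (r : seq J) (A : pred J) (G : J -> S) :
  (forall j, A j -> ideal_gen (G j)) -> ideal_gen (\sum_(j <- r | A j) G j).
Proof. by move=> GI; elim/big_ind: _ => //; [exact: ideal_gen0|exact: ideal_genD]. Qed.

Hypothesis frob_ideal : forall j, ideal_gen ('X_j ^+ q - 'X_j).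

(** Modulo the ideal, [s] can be evaluated at [z] in front of the delta function
    of [z]. It suffices to check this for the variables: the product of
    ['X_j - z_j] and its delta function is [- ('X_j ^+ q - 'X_j)]. *)
Lemma dirac_eval z s : ideal_gen ((s - (ev z s)%:MP) * dirac z).
Proof.
elim/mpoly_ring_ind: s => [c|j|s t IHs IHt|s t IHs IHt].
- by rewrite evC subrr mul0r; exact: ideal_gen0.
- rewrite evX /dirac (bigD1 j) //= mulrA; set d := \prod_(i | _) _.
  have -> : ('X_j - (z 0 j)%:MP) * dirac1 'X_j (z 0 j) = - ('X_j ^+ q - 'X_j) :> S.
    rewrite /dirac1 mulrBr mulr1 -exprS prednK ?(ltnW q_gt1) // frobD -mpolyCN.
    by rewrite -rmorphXn /= expf_card mpolyCN; ring.
  rewrite mulNr mulrC; apply/ideal_genN/ideal_genM; exact: frob_ideal.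
- by rewrite rmorphD mpolyCD opprD addrACA mulrDl; exact: ideal_genD.
rewrite rmorphM mpolyCM.
have -> : (s * t - (ev z s)%:MP * (ev z t)%:MP) * dirac z =
    s * ((t - (ev z t)%:MP) * dirac z) + (ev z t)%:MP * ((s - (ev z s)%:MP) * dirac z).
  ring.
by apply: ideal_genD; exact: ideal_genM.
Qed.

Definition zeros : {set 'rV[F]_n} := [set z | [forall i, ev z (f i) == 0]].

Lemma dirac_ideal z : z \notin zeros -> ideal_gen (dirac z).
Proof.
rewrite inE negb_forall => /existsP [i fi].
have -> : dirac z = ((ev z (f i))^-1)%:MP *
    (dirac z * f i - (f i - (ev z (f i))%:MP) * dirac z).
  have -> : dirac z * f i - (f i - (ev z (f i))%:MP) * dirac z = (ev z (f i))%:MP * dirac z.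
    ring.
  by rewrite mulrA -mpolyCM mulVf // mpolyC1 mul1r.
apply/ideal_genM/ideal_genD; first exact/ideal_genM/ideal_gen_mem.
exact/ideal_genN/dirac_eval.
Qed.

(** The delta functions of all points sum to 1, and those of the points that
    are not zeros of the ideal belong to the ideal: some generator [f i] is a
    nonzero constant in front of them. *)
Lemma interpolation s : ideal_gen (s - \sum_(z in zeros) ev z s *: dirac z).
Proof.
have -> : s - \sum_(z in zeros) ev z s *: dirac z =
    \sum_z (s - (ev z s)%:MP) * dirac z + \sum_(z | z \notin zeros) (ev z s)%:MP * dirac z.
  have -> : \sum_z (s - (ev z s)%:MP) * dirac z = s - \sum_z (ev z s)%:MP * dirac z.
    rewrite -[X in _ = X - _]mulr1 -sum_dirac mulr_sumr -sumrB.
    by apply: eq_bigr => z _; rewrite mulrBl.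
  rewrite -addrA; congr (_ + _).
  rewrite [X in - X + _](bigID (mem zeros)) /= opprD -addrA addNr addr0.
  by congr (- _); apply: eq_bigr => z _; rewrite mul_mpolyC.
apply: ideal_genD; first by apply: ideal_gen_sum => z _; exact: dirac_eval.
by apply: ideal_gen_sum => z /dirac_ideal; exact: ideal_genM.
Qed.

End PointIdeal.

(** * Bezout: the lower bound *)

Section SpanDim.
Variables (F : fieldType) (E : lmodType F) (I J : finType) (v : I -> E) (w : J -> E).

Lemma span_dim (c : I -> J -> F) : (forall i, v i = \sum_j c i j *: w j) ->
  (forall r : I -> F, \sum_i r i *: v i = 0 -> forall i, r i = 0) -> (#|I| <= #|J|)%N.
Proof.
move=> vE vfree; rewrite leqNgt; apply/negP => JI.
pose C : 'M[F]_(#|I|, #|J|) := \matrix_(i, j) c (enum_val i) (enum_val j).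
have [r r0 rC] := ker_nontrivial C JI.
case/eqP: r0; apply/rowP => k; rewrite mxE -(enum_valK k).
apply: (vfree (fun i => r 0 (enum_rank i))).
under eq_bigr => i _ do rewrite vE scaler_sumr.
rewrite exchange_big big1 // => j _.
have /rowP /(_ (enum_rank j)) := rC; rewrite !mxE => rj.
rewrite -[RHS](scale0r (w j)) -rj scaler_suml (reindex (@enum_rank I)) /=.
  by apply: eq_bigr => i _; rewrite mxE !enum_rankK scalerA.
by exists enum_val => i _; rewrite ?enum_rankK ?enum_valK.
Qed.

End SpanDim.

Section WeightedDegree.
Variables (R : comNzRingType) (n : nat) (e : 'I_n -> nat).
Implicit Types (C D : {mpoly R[n]}).

(** Weighted degree at most [N]. Giving ['X_i] the weight [e i] makes the
    substitution of [f i] for ['X_i] compatible with degrees. *)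
Definition wle C N := forall m, m \in msupp C -> (wt e m <= N)%N.

Lemma wle_mono C N N' : (N <= N')%N -> wle C N -> wle C N'.
Proof. by move=> NN CN m /CN mN; exact: leq_trans NN. Qed.

Lemma wleD C D N : wle C N -> wle D N -> wle (C + D) N.
Proof.
by move=> CN DN m /msuppD_le; rewrite mem_cat => /orP [/CN|/DN].
Qed.

Lemma wleC c N : wle c%:MP N.
Proof.
move=> m; rewrite msuppC; case: ifP => // _; rewrite inE => /eqP ->.
by rewrite wt0.
Qed.

Lemma wleX i N : (e i <= N)%N -> wle 'X_i N.
Proof. by move=> eN m; rewrite msuppX inE => /eqP ->; rewrite wtU. Qed.

Lemma wleM C D N N' : wle C N -> wle D N' -> wle (C * D) (N + N').
Proof.
move=> CN DN m /msuppM_le /allpairsP [[m1 m2] /= [m1C m2D ->]].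
by rewrite wtD leq_add // ?CN ?DN.
Qed.

Lemma wle_sum I (r : seq I) (A : pred I) (G : I -> {mpoly R[n]}) N :
  (forall i, A i -> wle (G i) N) -> wle (\sum_(i <- r | A i) G i) N.
Proof.
move=> GN; elim/big_ind: _ => //; last by move=> *; exact: wleD.
by rewrite -mpolyC0; exact: wleC.
Qed.

Lemma wle_ex C : exists N, wle C N.
Proof.
exists (\max_(m <- msupp C) wt e m)%N => m mC.
by apply: leq_bigmax_seq.
Qed.

Lemma wle_exfin (I : finType) (G : I -> {mpoly R[n]}) : exists N, forall i, wle (G i) N.
Proof.
have /all_sig [N NG] i : {N | wle (G i) N} by apply: cid; exact: wle_ex.
exists (\max_i N i)%N => i; apply: wle_mono (NG i); exact: leq_bigmax.
Qed.

End WeightedDegree.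

Lemma sum_sub_val (V : nmodType) (T : finType) (P : pred T) (g : T -> V) :
  \sum_(x | P x) g x = \sum_(u : {x | P x}) g (val u).
Proof.
rewrite (reindex_omap val (insub : T -> option {x | P x})) /=.
  by apply: eq_bigl => u; rewrite (valP u) valK eqxx.
by move=> x Px; rewrite insubT.
Qed.

Section Bezout.
Variables (F : finFieldType) (n : nat).
Notation S := {mpoly F[n]}.
Notation q := #|F|.
Variables (e : 'I_n -> nat) (f : 'I_n -> S) (A : 'I_n -> 'I_n -> S).
Hypothesis fA : forall j, 'X_j ^+ q - 'X_j = \sum_i f i * A i j.
Hypothesis fd : forall i, (msize (f i) <= (e i).+1)%N.
Hypothesis Ad : forall i j, (msize (A i j) <= (q - e i).+1)%N.
Hypothesis e_gt0 : forall i, (0 < e i)%N.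
Hypothesis e_le : forall i, (e i <= q)%N.

Lemma frob_ideal_gen j : ideal_gen f ('X_j ^+ q - 'X_j).
Proof. by exists (fun i => A i j). Qed.

Definition subf (C : S) : S := C \mPo [tuple f i | i < n].
HB.instance Definition _ := GRing.LRMorphism.copy subf (comp_mpoly [tuple f i | i < n]).

Lemma subfX i : subf 'X_i = f i.
Proof. by rewrite /subf comp_mpolyXU -tnth_nth tnth_mktuple. Qed.

Lemma subfC c : subf c%:MP = c%:MP.
Proof. exact: comp_mpolyC. Qed.

Lemma msize_subf C N : wle e C N -> (msize (subf C) <= N.+1)%N.
Proof.
move=> CN; rewrite {1}[C]mpolyE linear_sum big_seq; apply: msize_sum_bound => m /CN mN.
rewrite linearZ /=; apply: leq_trans (msizeZ_le _ _) _.
rewrite mpolyXE_id rmorph_prod; apply: leq_trans (_ : _ <= (wt e m).+1)%N _; last by [].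
apply: msize_prod_bound => i; rewrite rmorphXn /= subfX mulnC.
exact: msize_exp_bound.
Qed.

Lemma ev_subf z C : z \in zeros f -> ev z (subf C) = C@_0%MM.
Proof.
rewrite inE => /forallP zf.
elim/mpoly_ring_ind: C => [c|i|C D IH1 IH2|C D IH1 IH2].
- by rewrite subfC evC mcoeffC eqxx mulr1.
- by rewrite subfX (eqP (zf i)) mcoeffX -mdeg_eq0 mdeg1.
- by rewrite !rmorphD /= IH1 IH2.
by rewrite !rmorphM /= IH1 IH2.
Qed.

Notation n0 := (n * q.-1)%N.
Notation B := 'X_{1..n < n0.+1}.

(** The combinations of the monomials of degree at most [n0] with coefficients
    in [F[f]] of weighted degree at most [N]. *)
Definition fspan N (s : S) := exists C : B -> S,
  (forall b, wle e (C b) N) /\ s = \sum_b subf (C b) * 'X_[b].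

Lemma fspanD N s t : fspan N s -> fspan N t -> fspan N (s + t).
Proof.
move=> [C [CN ->]] [D [DN ->]]; exists (fun b => C b + D b); split.
  by move=> b; apply: wleD.
by rewrite -big_split; apply: eq_bigr => b _; rewrite rmorphD mulrDl.
Qed.

Lemma fspanM N N' C s : wle e C N' -> fspan N s -> fspan (N + N') (subf C * s).
Proof.
move=> CN [D [DN ->]]; exists (fun b => D b * C); split.
  by move=> b; apply: wleM.
by rewrite mulr_sumr; apply: eq_bigr => b _; rewrite rmorphM /= mulrCA mulrA.
Qed.

Lemma fspan_mono N N' s : (N <= N')%N -> fspan N s -> fspan N' s.
Proof. by move=> NN [C [CN ->]]; exists C; split=> // b; exact: wle_mono (CN b). Qed.

Lemma fspan0 N : fspan N 0.
Proof.
exists (fun=> 0); split=> [b|]; first by rewrite -mpolyC0; exact: wleC.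
by rewrite big1 // => b _; rewrite rmorph0 mul0r.
Qed.

Lemma fspan_sum N I (r : seq I) (P : pred I) (G : I -> S) :
  (forall i, P i -> fspan N (G i)) -> fspan N (\sum_(i <- r | P i) G i).
Proof. by move=> GN; elim/big_ind: _ => //; [exact: fspan0|exact: fspanD]. Qed.

Lemma fspanZ N c s : fspan N s -> fspan N (c *: s).
Proof.
move=> sN; rewrite -mul_mpolyC -subfC -[N]addn0; apply: fspanM => //; exact: wleC.
Qed.

(** A monomial of degree more than [n0] is divisible by some ['X_j ^+ q], which
    equals ['X_j + \sum_i f i * A i j]; the degree bounds on [f] and [A] ensure
    that the total degree does not increase. This is where the absence of zeros
    at infinity is used. *)
Lemma fspan_all N s : (msize s <= N.+1)%N -> fspan N s.
Proof.
elim/ltn_ind: N s => N IH s sN; rewrite [s]mpolyE big_seq; apply: fspan_sum => m ms.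
apply: fspanZ; have mN : (mdeg m <= N)%N by rewrite -ltnS; apply: leq_trans sN; exact: msize_mdeg_lt.
have [mB|mB] := ltnP (mdeg m) n0.+1.
  exists (fun b : B => (m == b)%:R%:MP); split; first by move=> b; exact: wleC.
  rewrite (bigD1 (BMultinom mB)) //= eqxx subfC mpolyC1 mul1r big1 ?addr0 // => b.
  by rewrite -val_eqE eq_sym /= => /negPf ->; rewrite subfC mpolyC0 mul0r.
have [j mj] : exists j, (q <= m j)%N.
  apply/existsP; apply: contraLR mB => /existsPn mq; rewrite -leqNgt mdegE.
  rewrite -[n in (n * _)%N]card_ord -sum_nat_const; apply: leq_sum => i _.
  by have := mq i; have := q_gt1 F; lia.
pose m' := (m - U_(j) *+ q)%MM.
have mE : m = (m' + U_(j) *+ q)%MM.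
  rewrite submK //; apply/mnm_lepP => i; rewrite mulmnE mnm1E.
  by case: eqP => [<-|]; rewrite ?mul1n ?mul0n.
have dm : mdeg m = (mdeg m' + q)%N by rewrite mE mdegD mdegMn mdeg1 mul1n.
have -> : 'X_[m] = 'X_[m'] * 'X_j + \sum_i f i * (A i j * 'X_[m']) :> S.
  rewrite mE mpolyXD -mpolyXn; have /eqP := fA j; rewrite subr_eq => /eqP ->.
  rewrite mulrDr addrC; congr (_ + _); rewrite mulr_sumr.
  by apply: eq_bigr => i _; rewrite mulrC mulrA.
apply: fspanD.
  have q1 := q_gt1 F; apply: (fspan_mono (N := (mdeg m').+1)); first lia.
  apply: IH; first lia.
  by rewrite -mpolyXD msizeX mdegD mdeg1 addn1.
apply: fspan_sum => i _; have := e_le i; have := e_gt0 i => e0 eq.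
apply: (fspan_mono (N := (q - e i + mdeg m' + e i)%N)); first lia.
rewrite -(subfX i); apply: fspanM; first exact: wleX.
apply: IH; first lia.
apply: leq_trans (msizeM_bound (Ad i j) (leqnn _)) _.
by rewrite msizeX addnS.
Qed.

Notation M := (zeros f).

(** Modulo the ideal of [f], the monomials are combinations of the delta
    functions. Expanding the error in the monomials again gives a linear system
    with matrix [1 - Phi], where the entries of [Phi] are polynomials in [f]
    without constant term; multiplying by the adjugate solves it up to the
    factor [G], the determinant. *)
Lemma determinant_trick : exists (G : S) (psi : B -> 'rV[F]_n -> S), G@_0%MM = 1 /\
  forall b : B, subf G * 'X_[b] = \sum_(z in M) subf (psi b z) * dirac z.
Proof.
have /all_sig [w wE] (b : B) : {w : 'I_n -> S |
    'X_[b] - \sum_(z in M) ev z 'X_[b] *: dirac z = \sum_i f i * w i}.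
  by apply: cid; apply: interpolation; exact: frob_ideal_gen.
have /all_sig [C CE] (x : B * 'I_n) : {C : B -> S | w x.1 x.2 = \sum_b subf (C b) * 'X_[b]}.
  apply: cid; have [C [_ CE]] := fspan_all (leqnSn (msize (w x.1 x.2))).
  by exists C.
pose Phi : 'M[S]_#|{: B}| := \matrix_(a, b) \sum_i 'X_i * C (enum_val a, i) (enum_val b).
pose X : 'cV[S]_#|{: B}| := \col_b 'X_[(enum_val b : B)].
pose tau : 'cV[S]_#|{: B}| := \col_b \sum_(z in M) ev z 'X_[(enum_val b : B)] *: dirac z.
have XE : map_mx subf (1%:M - Phi) *m X = tau.
  apply/colP => a; rewrite map_mxB map_mx1 mulmxBl mul1mx [LHS]mxE [X in _ + X]mxE ![in LHS]mxE.
  apply/eqP; rewrite subr_eq addrC -subr_eq [tau _ _]mxE wE; apply/eqP.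
  transitivity (\sum_b \sum_i f i * (subf (C (enum_val a, i) b) * 'X_[b])).
    rewrite exchange_big; apply: eq_bigr => i _.
    by rewrite -mulr_sumr -(CE (enum_val a, i)).
  rewrite (reindex_onto enum_val enum_rank) /=; last by move=> b _; rewrite enum_rankK.
  rewrite (eq_bigl xpredT) => [|b]; last by rewrite enum_valK eqxx.
  apply: eq_bigr => b _; rewrite !mxE rmorph_sum mulr_suml; apply: eq_bigr => i _.
  by rewrite rmorphM /= subfX mulrA.
pose G := \det (1%:M - Phi); exists G.
exists (fun b z => \sum_a (\adj (1%:M - Phi)) (enum_rank b) a * (ev z 'X_[(enum_val a : B)])%:MP); split.
  have Phi0 : map_mx (mcoeff 0%MM) Phi = 0.
    apply/matrixP => a b; rewrite !mxE raddf_sum big1 // => i _.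
    by rewrite /= rmorphM /= mcoeffX -mdeg_eq0 mdeg1 mul0r.
  by rewrite /G -det_map_mx map_mxB map_mx1 Phi0 subr0 det1.
move=> b; have := congr1 (mulmx (\adj (map_mx subf (1%:M - Phi)))) XE.
rewrite mulmxA mul_adj_mx det_map_mx -/G mul_scalar_mx -map_mx_adj => /colP /(_ (enum_rank b)).
rewrite !mxE enum_rankK => ->.
under [RHS]eq_bigr => z _ do rewrite rmorph_sum mulr_suml.
rewrite exchange_big; apply: eq_bigr => a _; rewrite !mxE mulr_sumr.
apply: eq_bigr => z _; rewrite [X in _ = X * _]rmorphM.
by rewrite /= subfC -mulrA mul_mpolyC.
Qed.

Definition wmonomial N := {m : 'X_{1..n < N.+1} | (wt e m <= N)%N}.

Lemma card_wmonomial N : #|{: wmonomial N}| = wball e N.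
Proof. exact: card_sig. Qed.

Lemma wle_expand (C : S) N : wle e C N -> C = \sum_(t : wmonomial N) C@_(val t) *: 'X_[val t].
Proof.
move=> CN; have CS : (msize C <= N.+1)%N.
  apply: msize_supp_bound => m /CN mN; rewrite ltnS.
  exact: leq_trans (mdeg_wt e_gt0 m) mN.
rewrite {1}(mpolywE CS) -(sum_sub_val (fun m : 'X_{1..n < N.+1} => wt e m <= N)%N
  (fun m : 'X_{1..n < N.+1} => C@_m *: 'X_[m])).
rewrite [RHS]big_mkcond; apply: eq_bigr => m _; case: ifPn => // mN.
rewrite (memN_msupp_eq0 (m := m)) ?scale0r //.
by apply: contra mN => /CN.
Qed.

(** Up to the nonzero factor of [determinant_trick], the polynomials of degree at
    most [N] are combinations of the delta functions of the zeros with
    coefficients in [F[f]], of weighted degree bounded up to a constant. The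
    existence of a zero ensures that the factor is not 0. *)
Lemma bezout_lower : M != finset.set0 ->
  exists D, forall N, (ball n N <= #|M| * wball e (N + D))%N.
Proof.
move=> /set0Pn [z0 z0M]; have [G [psi [G0 GE]]] := determinant_trick.
have [D psiD] := wle_exfin e (fun x : B * 'rV[F]_n => psi x.1 x.2); exists D => N.
have sG : subf G != 0.
  apply/eqP => /(congr1 (ev z0)); rewrite ev_subf // G0 rmorph0.
  by move/eqP; rewrite oner_eq0.
pose I := 'X_{1..n < N.+1}.
pose Z := {z : 'rV[F]_n | z \in M}.
have /all_sig [c cE] (m : I) : {c : Z * wmonomial (N + D) -> F |
    subf G * 'X_[m] = \sum_x c x *: (subf 'X_[val x.2] * dirac (val x.1))}.
  apply: cid; have [|C [CN mE]] := @fspan_all N 'X_[m]; first by rewrite msizeX bmdeg.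
  pose H z := \sum_b C b * psi b z.
  have HE : subf G * 'X_[m] = \sum_(z in M) subf (H z) * dirac z.
    rewrite mE mulr_sumr; under [RHS]eq_bigr => z _ do rewrite rmorph_sum mulr_suml.
    rewrite [RHS]exchange_big; apply: eq_bigr => b _.
    rewrite mulrCA GE mulr_sumr; apply: eq_bigr => z _.
    by rewrite rmorphM /= mulrA.
  have HN z : wle e (H z) (N + D).
    by apply: wle_sum => b _; apply: wleM => //; exact: (psiD (b, z)).
  exists (fun x : Z * wmonomial (N + D) => (H (val x.1))@_(val x.2)).
  rewrite HE sum_sub_val -(pair_bigA _ (fun (z : Z) (t : wmonomial (N + D)) =>
    (H (val z))@_(val t) *: (subf 'X_[val t] * dirac (val z)))).
  apply: eq_bigr => z _; rewrite {1}(wle_expand (HN (val z))) linear_sum mulr_suml.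
  by apply: eq_bigr => t _; rewrite linearZ -scalerAl.
have := span_dim cE; rewrite card_prod card_wmonomial card_sig; apply => r r0 m.
have {}r0 : \sum_(m : I) r m *: 'X_[m] = 0 :> S.
  apply: (mulfI sG); rewrite mulr0 -[RHS]r0 mulr_sumr.
  by apply: eq_bigr => i _; rewrite scalerAr.
have := congr1 (mcoeff m) r0; rewrite mcoeff0 raddf_sum (bigD1 m) //= big1 => [|j jm].
  by rewrite mcoeffZ mcoeffX eqxx mulr1 addr0.
by move: jm; rewrite /= mcoeffZ mcoeffX -val_eqE /= => /negPf ->; rewrite mulr0.
Qed.

End Bezout.

(** * Bezout: the upper bound *)

Fact mnm_subnn n (m : 'X_{1..n}) : (m - m)%MM = 0%MM.
Proof. by rewrite -{1}[m]add0m addmK. Qed.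

Section Taylor.
Variables (F : finFieldType) (n : nat).
Notation S := {mpoly F[n]}.
Implicit Types (z : 'rV[F]_n) (s t C : S).

(** The expansion of [s] at [z + 'X * x], by powers of ['X]. *)
Definition taylor z (s : S) : {poly S} :=
  mmap (polyC \o @mpolyC n F) (fun j => ((z 0 j)%:MP)%:P + 'X * ('X_j : S)%:P) s.
HB.instance Definition _ z := GRing.RMorphism.copy (taylor z)
  (mmap (polyC \o @mpolyC n F) (fun j => ((z 0 j)%:MP)%:P + 'X * ('X_j : S)%:P)).

Definition grad z s : 'rV[F]_n := \row_l ev z (s^`M(l)).

Lemma taylorC z c : taylor z c%:MP = (c%:MP)%:P.
Proof. exact: mmapC. Qed.

Lemma taylorX z j : taylor z 'X_j = ((z 0 j)%:MP)%:P + 'X * ('X_j : S)%:P.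
Proof. by rewrite /taylor mmapX mmap1U. Qed.

Lemma taylor1 z s : exists U : {poly S},
  taylor z s = ((ev z s)%:MP)%:P + 'X * U /\ U.[0] = lform (grad z s).
Proof.
elim/mpoly_ring_ind: s => [c|j|s t [U [sE U0]] [V [tE V0]]|s t [U [sE U0]] [V [tE V0]]].
- exists 0; rewrite taylorC evC mulr0 addr0 horner0; split=> //.
  rewrite (_ : grad z _ = 0) ?lform0 //; apply/rowP => l.
  by rewrite !mxE mderivC rmorph0.
- exists ('X_j)%:P; rewrite taylorX evX hornerC; split=> //.
  rewrite -[LHS]lform_delta; congr lform; apply/rowP => l.
  rewrite !mxE eqxx mderivX mnm1E /= eq_sym; case: eqP => [->|_]; last first.
    by rewrite scale0r [RHS]rmorph0.
  rewrite mnm_subnn mpolyX0 scale1r [RHS]rmorph1.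
  by [].
- exists (U + V); split.
    by rewrite [ev z _]rmorphD rmorphD /= sE tE mpolyCD polyCD; ring.
  rewrite hornerD U0 V0 -lformD; congr lform; apply/rowP => l.
  by rewrite !mxE mderivD rmorphD.
exists (((ev z s)%:MP)%:P * V + ((ev z t)%:MP)%:P * U + 'X * U * V); split.
  by rewrite [ev z _]rmorphM rmorphM /= sE tE mpolyCM polyCM; ring.
rewrite !hornerE U0 V0 ?mul0r ?addr0 !mul_mpolyC -!lformZ -lformD.
congr lform; apply/rowP => l.
by rewrite !mxE mderivM rmorphD !rmorphM /= addrC [X in X + _]mulrC.
Qed.

Lemma taylor_at0 z s : (taylor z s).[0] = (ev z s)%:MP.
Proof.
by have [U [-> _]] := taylor1 z s; rewrite hornerD hornerC hornerM hornerX mul0r addr0.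
Qed.

Lemma mcoeff_pihomog C m : (pihomog mdeg (mdeg m) C)@_m = C@_m.
Proof.
rewrite pihomogE raddf_sum /=.
have [mC|mC] := boolP (m \in msupp C); last first.
  rewrite (memN_msupp_eq0 mC) big_seq_cond big1 // => m' /andP [m'C _].
  by rewrite mcoeffZ mcoeffX; case: eqP => [mm|_]; rewrite ?mulr0 //; rewrite mm (negPf mC) in m'C.
rewrite -big_filter (bigD1_seq m) ?mem_filter ?eqxx ?filter_uniq //=.
rewrite mcoeffZ mcoeffX eqxx mulr1 big1 ?addr0 // => m' /negPf m'm.
by rewrite mcoeffZ mcoeffX m'm mulr0.
Qed.

Variables (f : 'I_n -> S).

Definition jacobian z : 'M[F]_n := \matrix_i grad z (f i).

(** The [f i] vanish at [z], so their Taylor expansions start with their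
    differentials. The leading term of a polynomial in the [f i] is thus its
    lowest homogeneous part, evaluated at these differentials. *)
Lemma taylor_subf z C k : z \in zeros f -> (forall m, (mdeg m < k)%N -> C@_m = 0) ->
  exists G, taylor z (subf f C) = 'X^k * G /\
    G.[0] = msubst (jacobian z) (pihomog mdeg k C).
Proof.
move=> zM Ck; have /all_sig [u uE] i : {u : {poly S} |
    taylor z (f i) = 'X * u /\ u.[0] = lform (grad z (f i))}.
  apply: cid; have [u [fE u0]] := taylor1 z (f i); exists u; split=> //.
  by move: zM; rewrite inE => /forallP /(_ i) /eqP fz; rewrite fE fz mpolyC0 add0r.
pose w m := \prod_i u i ^+ m i.
exists (\sum_(m <- msupp C) (C@_m)%:MP%:P * 'X^(mdeg m - k) * w m); split.
  rewrite {1}[C]mpolyE !linear_sum rmorph_sum mulr_sumr big_seq [RHS]big_seq.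
  apply: eq_bigr => m mC; rewrite linearZ /= -mul_mpolyC rmorphM /= taylorC.
  have km : (k <= mdeg m)%N.
    rewrite leqNgt; apply/negP => mk; move: mC; rewrite mcoeff_msupp Ck //.
    by rewrite eqxx.
  rewrite [RHS](_ : _ = (C@_m)%:MP%:P * ('X^k * 'X^(mdeg m - k) * w m)); last by ring.
  congr (_ * _); rewrite mpolyXE_id !rmorph_prod /=.
  rewrite -exprD subnKC // mdegE -prodrXr -big_split.
  apply: eq_bigr => i _ /=.
  by rewrite !rmorphXn /= subfX (uE i).1 exprMn.
rewrite pihomogE horner_sum linear_sum [RHS]big_mkcond big_seq [RHS]big_seq.
apply: eq_bigr => m mC; rewrite !hornerE horner_prod.
case: eqP => [mk|mk].
  rewrite mk subnn expr0n mulr1 linearZ /= mul_mpolyC; congr (_ *: _).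
  rewrite mpolyXE_id rmorph_prod; apply: eq_bigr => i _.
  by rewrite horner_exp (uE i).2 rmorphXn /= msubstX rowK.
rewrite expr0n subn_eq0 leqNgt ltn_neqAle eq_sym.
have km : (k <= mdeg m)%N.
  rewrite leqNgt; apply/negP => mk'; move: mC; rewrite mcoeff_msupp Ck //.
  by rewrite eqxx.
by rewrite km (introN eqP mk) /= mulr0 mul0r.
Qed.

End Taylor.

Section BezoutUpper.
Variables (F : finFieldType) (n : nat).
Notation S := {mpoly F[n]}.
Notation q := #|F|.
Variables (e : 'I_n -> nat) (f : 'I_n -> S) (A : 'I_n -> 'I_n -> S).
Hypothesis fA : forall j, 'X_j ^+ q - 'X_j = \sum_i f i * A i j.
Hypothesis fd : forall i, (msize (f i) <= (e i).+1)%N.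
Hypothesis e_gt0 : forall i, (0 < e i)%N.
Notation M := (zeros f).

Lemma natr_card0 : (q%:R : F) = 0.
Proof.
have : \sum_(a : F) (a + 1) = \sum_(a : F) a by rewrite [RHS](reindex_inj (addIr (1 : F))).
by rewrite big_split /= sumr_const -[RHS]addr0 => /addrI.
Qed.

Lemma frob_deriv z (i j : 'I_n) : ev z (('X_j ^+ q - 'X_j : S)^`M(i)) = - (i == j)%:R.
Proof.
rewrite mderivB mpolyXn !mderivX mulmnE mnm1E natrM natr_card0 mulr0 scale0r sub0r rmorphN /=.
congr (- _); rewrite eq_sym; case: eqP => [->|_]; last by rewrite scale0r rmorph0.
by rewrite mnm_subnn mpolyX0 scale1r rmorph1.
Qed.

(** Differentiate [X_j ^ q - X_j = \sum_i f i * A i j] at a common zero of the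
    [f i]. *)
Lemma jacobian_mul z : z \in M ->
  (jacobian f z)^T *m (\matrix_(i, j) ev z (A i j)) = - 1%:M.
Proof.
rewrite inE => /forallP zM; apply/matrixP => l j; rewrite !mxE.
rewrite -(frob_deriv z) fA (raddf_sum (mderiv l)) (raddf_sum (ev z)); apply: eq_bigr => i _.
by rewrite !mxE /= mderivM rmorphD !rmorphM /= (eqP (zM i)) mul0r addr0.
Qed.

Lemma jacobian_unit z : z \in M -> jacobian f z \in unitmx.
Proof.
move=> zM; rewrite -unitmx_tr.
have : (jacobian f z)^T *m (- \matrix_(i, j) ev z (A i j)) = 1%:M.
  by rewrite mulmxN jacobian_mul // opprK.
by case/mulmx1_unit.
Qed.

(** The delta functions are linearly independent over [F[f]]. In the Taylor
    expansion at a zero [z0] only the delta function of [z0] has a constant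
    term; so the lowest homogeneous part of [C z0] vanishes on the
    differentials of the [f i], which are linearly independent. The induction
    is over the degree, for all the zeros at the same time. *)
Lemma zeros_indep (C : 'rV[F]_n -> S) :
  \sum_(z in M) subf f (C z) * dirac z = 0 -> forall z, z \in M -> C z = 0.
Proof.
move=> C0 z1 z1M; apply/mpolyP => m1; rewrite mcoeff0.
suff claim k : forall z m, z \in M -> mdeg m = k -> (C z)@_m = 0 by exact: claim.
elim/ltn_ind: k => k IH z0 m z0M mk.
have /all_sig [G GE] z : {G | z \in M -> taylor z0 (subf f (C z)) = 'X^k * G /\
    G.[0] = msubst (jacobian f z0) (pihomog mdeg k (C z))}.
  apply: cid; have [zM|_] := boolP (z \in M); last by exists 0.
  have [|G GE] := @taylor_subf _ _ f z0 (C z) k z0M; last by exists G.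
  by move=> m' m'k; apply: IH m'k _ _ zM erefl.
have /all_sig [t tE] z : {t : {poly S} | t = taylor z0 (dirac z)}.
  by exists (taylor z0 (dirac z)).
have t0 z : (t z).[0] = (z0 == z)%:R by rewrite tE taylor_at0 ev_dirac; case: eqP.
have G0 : \sum_(z in M) G z * t z = 0.
  apply: (mulfI (x := 'X^k)); first by rewrite -size_poly_eq0 size_polyXn.
  rewrite mulr0 -[RHS](rmorph0 (taylor z0)) -C0 rmorph_sum mulr_sumr.
  by apply: eq_bigr => z zM; rewrite rmorphM /= (GE z zM).1 -tE mulrA.
have GJ := (GE z0 z0M).2; clear tE GE.
move: (congr1 (horner_eval 0) G0); rewrite rmorph_sum rmorph0 (bigD1 z0 z0M) /=.
rewrite big1 => [|z /andP [_ zz0]]; last first.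
  by rewrite rmorphM /= /horner_eval t0 eq_sym (negPf zz0) mulr0.
rewrite addr0 rmorphM /= /horner_eval t0 eqxx mulr1 GJ => J0.
rewrite -mcoeff_pihomog mk (_ : pihomog _ _ _ = 0) ?mcoeff0 //.
by rewrite -[LHS]msubst1 -(mulmxV (jacobian_unit z0M)) -msubst_comp J0 rmorph0.
Qed.

(** The products of the delta functions of the zeros with the monomials in the
    [f i] are linearly independent by [zeros_indep], and have bounded degree. *)
Lemma bezout_upper N : (#|M| * wball e N <= ball n (N + n * q.-1))%N.
Proof.
pose Z := {z : 'rV[F]_n | z \in M}.
pose v (x : Z * wmonomial e N) := subf f 'X_[val x.2] * dirac (val x.1).
have vE x : v x = \sum_(m : 'X_{1..n < (N + n * q.-1).+1}) (v x)@_m *: 'X_[m].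
  apply: mpolywE; apply: leq_trans (_ : _ <= (N.+1 + (n * q.-1).+1).-1)%N _.
    apply: msizeM_bound (msize_dirac _); apply: (msize_subf fd).
    by move=> m; rewrite msuppX inE => /eqP ->; exact: (valP x.2).
  by rewrite addnS addSn.
have := span_dim vE; rewrite card_prod card_wmonomial card_sig; apply => r r0.
pose C z : S := \sum_(x : Z * wmonomial e N | val x.1 == z) r x *: 'X_[val x.2].
have C0 : \sum_(z in M) subf f (C z) * dirac z = 0.
  rewrite -[RHS]r0 [RHS](partition_big (fun x : Z * wmonomial e N => val x.1) (fun z => z \in M)); last first.
    by move=> x _; exact: (valP x.1).
  apply: eq_bigr => z zM; rewrite linear_sum mulr_suml; apply: eq_bigr => x /eqP xz.
  by rewrite linearZ -scalerAl /v xz.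
move=> x; have := zeros_indep C0 (valP x.1); move/(congr1 (mcoeff (val (val x.2)))).
rewrite mcoeff0 raddf_sum (bigD1 x) //= big1 => [|y /andP [/eqP yx1 yx]].
  by rewrite mcoeffZ mcoeffX eqxx mulr1 addr0.
rewrite mcoeffZ mcoeffX; case: eqP => [yx2|_]; last by rewrite mulr0.
case/eqP: yx; case: x y yx1 yx2 => [x1 x2] [y1 y2] /= yx1 yx2.
by congr (_, _); [exact: val_inj|do 2!apply: val_inj].
Qed.

End BezoutUpper.

(** A zero-dimensional form of Bezout's theorem. Both bounds compare
    [#|zeros f| * wball N] with [ball N], which is close to
    [(\prod_i e i) * wball N]; as [ball_growth] absorbs the shifts of [N], they
    force the two factors to be equal. *)
Theorem bezout_count (F : finFieldType) n (e : 'I_n -> nat) (f : 'I_n -> {mpoly F[n]})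
    (A : 'I_n -> 'I_n -> {mpoly F[n]}) :
  (forall j, 'X_j ^+ #|F| - 'X_j = \sum_i f i * A i j) ->
  (forall i, (msize (f i) <= (e i).+1)%N) ->
  (forall i j, (msize (A i j) <= (#|F| - e i).+1)%N) ->
  (forall i, (0 < e i <= #|F|)%N) -> zeros f != finset.set0 ->
  #|zeros f| = (\prod_i e i)%N.
Proof.
move=> fA fd Ad eq M0.
have e_gt0 i : (0 < e i)%N by case/andP: (eq i).
have e_le i : (e i <= #|F|)%N by case/andP: (eq i).
have [D lower] := bezout_lower fA Ad e_gt0 e_le M0.
apply/eqP; rewrite eqn_leq; apply/andP; split.
  apply: (@ball_growth n _ _ (n * #|F|.-1)) => N.
  apply: leq_trans (_ : _ <= #|zeros f| * ((\prod_i e i) * wball e N))%N _.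
    by rewrite leq_mul2l ball_le_wball ?orbT.
  by rewrite mulnCA leq_mul2l (bezout_upper fA fd) // orbT.
apply: (@ball_growth n _ _ (D + \sum_i e i)) => N.
apply: leq_trans (_ : _ <= (\prod_i e i) * (#|zeros f| * wball e (N + D)))%N _.
  by rewrite leq_mul2l lower orbT.
by rewrite mulnCA leq_mul2l addnA wball_le_ball ?orbT.
Qed.

(** * Free arrangements over a finite field *)

Section DetDegree.
Variables (K : fieldType) (n : nat).
Notation S := {mpoly K[n]}.

Lemma dhomog_prodn I (r : seq I) (G : I -> S) (d : I -> nat) :
  (forall i, G i \is (d i).-homog) -> \prod_(i <- r) G i \is (\sum_(i <- r) d i).-homog.
Proof.
move=> Gd; elim: r => [|i r IH]; first by rewrite !big_nil dhomog1.
by rewrite !big_cons; apply: dhomogM.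
Qed.

Lemma det_homog m (A : 'M[S]_m) (d : 'I_m -> nat) :
  (forall i j, A i j \is (d i).-homog) -> \det A \is (\sum_i d i).-homog.
Proof.
move=> Ad; apply: rpred_sum => s _; rewrite rpredMsign.
by apply: dhomog_prodn => i; exact: Ad.
Qed.

Lemma msize_det m (A : 'M[S]_m) (d : 'I_m -> nat) :
  (forall i j, (msize (A i j) <= (d i).+1)%N) -> (msize (\det A) <= (\sum_i d i).+1)%N.
Proof.
move=> Ad; apply: msize_sum_bound => s _; rewrite -signr_odd.
have bnd : (msize (\prod_i A i (s i)) <= (\sum_i d i).+1)%N.
  by apply: msize_prod_bound => i; exact: Ad.
by case: (odd _); rewrite ?expr1 ?expr0 ?mul1r // mulN1r msizeN.
Qed.

Lemma msize_homog (p : S) d : p \is d.-homog -> p != 0 -> msize p = d.+1.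
Proof.
move=> /dhomogP pd p0; rewrite -mlead_deg //.
by rewrite (pd _ (mlead_supp p0)).
Qed.

End DetDegree.

Section FiniteFree.
Variables (F : finFieldType) (n : nat).
Notation S := {mpoly F[n]}.
Notation q := #|F|.
Implicit Types (L : seq 'rV[F]_n) (v : 'rV[F]_n).

Lemma ev_lform (x v : 'rV[F]_n) : ev x (lform v) = \sum_i v 0 i * x 0 i.
Proof.
rewrite /lform (raddf_sum (ev x)); apply: eq_bigr => i _.
by rewrite /= -mul_mpolyC rmorphM /= evC evX.
Qed.

Lemma ev_lform_eq0 (x v : 'rV[F]_n) : (ev x (lform v) == 0) = (v <= kermx x^T)%MS.
Proof.
have -> : ev x (lform v) = (v *m x^T) 0 0.
  by rewrite ev_lform mxE; apply: eq_bigr => j _; rewrite mxE.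
by rewrite sub_kermx [in RHS](mx11_scalar (v *m x^T)) -scalemx1 scaler_eq0 oner_eq0 orbF.
Qed.

Lemma complement_lprod L x : (x \in complement L 0) = (ev x (lprod L) != 0).
Proof.
rewrite inE sub0mx /lprod rmorph_prod prodf_seq_neq0 -all_predC /=.
by apply: eq_all => v /=; rewrite ev_lform_eq0.
Qed.

(** A point outside the first hyperplanes is moved along a line transverse to
    the next one; at most one point of this line is on each hyperplane. *)
Lemma complement_neq0 L : 0 \notin L -> (size L < q)%N -> complement L 0 != finset.set0.
Proof.
move=> L0 sL; suff [x xL] : exists x : 'rV[F]_n, forall v, v \in L -> ev x (lform v) != 0.
  apply/set0Pn; exists x; rewrite complement_lprod /lprod rmorph_prod prodf_seq_neq0.
  by apply/allP => v vL; exact: xL.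
elim: L L0 sL => [|v L IH]; first by exists 0.
rewrite inE negb_or eq_sym => /andP [v0 L0] sL.
have [x xL] := IH L0 (ltnW sL); have [j vj] : exists j, v 0 j != 0 by apply/rV0Pn.
have [vx|vx] := eqVneq (ev x (lform v)) 0; last first.
  by exists x => u; rewrite inE => /predU1P [->|/xL].
pose u : 'rV[F]_n := delta_mx 0 j.
(* The parameters of the points of the line x + a u on the hyperplanes;
   0 is excluded to leave the hyperplane of v. *)
pose bad := 0 :: [seq - ev x (lform w) / ev u (lform w) | w <- L].
have [a abad] : exists a, a \notin bad.
  apply/existsP; apply: contraTT sL => /existsPn ab; rewrite -leqNgt.
  have -> : size (v :: L) = size bad by rewrite /= size_map.
  apply: leq_trans (card_size bad).
  by apply: subset_leq_card; apply/fintype.subsetP => a _; have := ab a; rewrite negbK.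
have evD w : ev (x + a *: u) (lform w) = ev x (lform w) + a * ev u (lform w).
  rewrite !ev_lform mulr_sumr -big_split; apply: eq_bigr => i _ /=.
  by rewrite !mxE; ring.
exists (x + a *: u) => w; rewrite evD inE => /predU1P [->|wL].
  have vu : ev u (lform v) = v 0 j.
    rewrite ev_lform (bigD1 j) //= !mxE !eqxx mulr1 big1 ?addr0 // => i ij.
    by rewrite mxE (negPf ij) andbF mulr0.
  by move: abad; rewrite vx add0r vu inE negb_or => /andP [a0 _]; rewrite mulf_neq0.
apply: contra abad => /eqP; have [->|wu0] := eqVneq (ev u (lform w)) 0.
  by rewrite mulr0 addr0 => wx; have := xL w wL; rewrite wx eqxx.
move/eqP; rewrite addr_eq0 => /eqP wx; rewrite inE; apply/orP; right.
apply/mapP; exists w => //; apply: (mulIf wu0).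
by rewrite divfK // wx opprK.
Qed.

Lemma frob_lform v : \sum_j ('X_j ^+ q - 'X_j : S) * (v 0 j)%:MP = lform v ^+ q - lform v.
Proof.
have -> : lform v ^+ q = \sum_j (v 0 j *: 'X_j) ^+ q.
  apply: (big_morph (fun s : S => s ^+ q)); first exact: frobD.
  by rewrite expr0n; case: (q) (q_gt1 F).
rewrite -sumrB; apply: eq_bigr => j _.
by rewrite exprZn expf_card mulrC mul_mpolyC scalerBr.
Qed.

(** The Frobenius derivation minus the Euler derivation maps every form [v] to
    [v ^ q - v]. *)
Lemma frob_logder L : logder L (fun j => 'X_j ^+ q - 'X_j).
Proof.
move=> v _; rewrite [der_val _ _]frob_lform; exists (lform v ^+ q.-1 - 1).
by rewrite mulrBr mulr1 -exprS prednK // ltnW // q_gt1.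
Qed.

(** The Frobenius derivation minus the Euler derivation is a combination of the
    rows of [A], by Cramer's rule and [frob_logder]; its coefficients [f] satisfy
    the hypotheses of [bezout_count], and their common zeros are the points
    outside the arrangement. *)
Theorem free_complement_card L (A : 'M[S]_n) (d : 'I_n -> nat) (c : F) :
  uniq L -> 0 \notin L -> nonprop L -> (forall i, logder L (A i)) ->
  (forall i j, A i j \is (d i).-homog) -> c != 0 -> \det A = c *: lprod L ->
  (forall i, (d i < q)%N) -> (size L < q)%N ->
  #|complement L 0| = (\prod_i (q - d i))%N.
Proof.
move=> uL L0 LP AL Ad c0 dA dq Lq.
have Q0 : lprod L != 0 by exact: lprod_neq0.
have dA0 : \det A != 0 by rewrite dA scaler_eq0 negb_or c0.
(* The determinant is homogeneous of degree the sum of the d i. *)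
have sizeL : size L = (\sum_i d i)%N.
  have := msize_homog (det_homog Ad) dA0; rewrite dA msizeZ // msize_lprod //.
  by case.
pose y : 'rV[S]_n := \row_j ('X_j ^+ q - 'X_j).
(* Cramer's rule: the determinant of B i is divisible by the product of
   the forms, since its rows are still logarithmic. *)
pose B i : 'M[S]_n := \matrix_(k, j) if k == i then y 0 j else A k j.
have BE i : (y *m \adj A) 0 i = \det (B i).
  rewrite (expand_det_row _ i) mxE; apply: eq_bigr => j _; rewrite [B i i j]mxE eqxx !mxE.
  congr (_ * (_ * \det _)); apply/matrixP => k l; rewrite !mxE.
  by rewrite eq_sym (negPf (neq_lift _ _)).
have /all_sig [g gE] i : {g | \det (B i) = lprod L * g}.
  apply: cid; apply: pdvd_lprod_all => // v vL; apply: det_pdvd => [|k].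
    by apply: contraNneq L0 => <-.
  have -> : der_val (B i k) v = der_val (if k == i then (fun j => 'X_j ^+ q - 'X_j) else A k) v.
    by apply: eq_bigr => j _; rewrite mxE; case: ifP => // _; rewrite mxE.
  by case: ifP => _; [exact: (frob_logder vL)|exact: AL].
pose f i := c^-1 *: g i.
have fA j : 'X_j ^+ q - 'X_j = \sum_i f i * A i j.
  have : (y *m \adj A *m A) 0 j = \det A * ('X_j ^+ q - 'X_j).
    by rewrite -mulmxA mul_adj_mx mul_mx_scalar !mxE.
  rewrite mxE; under eq_bigr => i _ do rewrite BE gE -mulrA.
  rewrite -mulr_sumr dA -scalerAl scalerAr => /(mulfI Q0) sE.
  rewrite -[LHS](scalerK c0) -sE scaler_sumr.
  by apply: eq_bigr => i _; rewrite scalerAl.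
have fd i : (msize (f i) <= (q - d i).+1)%N.
  rewrite msizeZ ?invr_neq0 //; have [->|g0] := eqVneq (g i) 0; first by rewrite msize0.
  have : (msize (\det (B i)) <= (\sum_k (if k == i then q else d k)).+1)%N.
    apply: msize_det => k j; rewrite mxE; case: eqP => [_|_].
      rewrite mxE mpolyXn; apply: leq_trans (msizeD_le _ _) _; rewrite msizeN !msizeX.
      by rewrite mdegMn mdeg1 mul1n geq_max leqnn /= ltnS ltnW // q_gt1.
    have [->|A0] := eqVneq (A k j) 0; first by rewrite msize0.
    by rewrite (msize_homog (Ad k j) A0).
  rewrite gE msizeM // msize_lprod // sizeL (bigD1 i) //= [in X in (_ <= X)%N](bigD1 i) //= eqxx.
  rewrite [X in (_ <= (q + X).+1)%N](eq_bigr d) => [|k /negPf -> //].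
  have := dq i; move: (mmeasure _ _) (\sum_(_ < n | _) _)%N (d i) (q) => a b k r; lia.
have zE : zeros f = complement L 0.
  apply/setP => x; rewrite complement_lprod.
  have dAx : \det (\matrix_(i, j) ev x (A i j)) = c * ev x (lprod L).
    have <- : ev x (\det A) = c * ev x (lprod L) by rewrite dA -mul_mpolyC rmorphM /= evC.
    rewrite -det_map_mx; congr (\det _).
    by apply/matrixP => i j; rewrite !mxE.
  apply/idP/idP => [xM|xQ].
    have : (jacobian f x)^T *m (- \matrix_(i, j) ev x (A i j)) = 1%:M.
      by rewrite mulmxN (jacobian_mul fA) // opprK.
    case/mulmx1_unit => _; rewrite -scaleN1r unitmxZ ?unitrN1 // unitmxE dAx unitfE.
    by rewrite mulf_eq0 negb_or => /andP [].
  rewrite inE; apply/forallP => i; apply/eqP.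
  have Au : \matrix_(i, j) ev x (A i j) \in unitmx by rewrite unitmxE dAx unitfE mulf_neq0.
  have : \row_i ev x (f i) *m \matrix_(i, j) ev x (A i j) = 0.
    apply/rowP => j; rewrite !mxE; under eq_bigr => k _ do rewrite !mxE -rmorphM.
    by rewrite -rmorph_sum -fA /= rmorphB rmorphXn /= evX expf_card subrr.
  move/(congr1 (mulmx^~ (invmx (\matrix_(i, j) ev x (A i j))))).
  by rewrite mulmxK // mul0mx => /rowP /(_ i); rewrite !mxE.
rewrite -zE; apply: (bezout_count fA fd) => [i j|i|].
- rewrite subKn ?(ltnW (dq i)) //.
  have [->|A0] := eqVneq (A i j) 0; first by rewrite msize0.
  by rewrite (msize_homog (Ad i j) A0).
- by rewrite subn_gt0 dq leq_subr.
by rewrite zE; exact: complement_neq0.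
Qed.

End FiniteFree.

(** * Reduction of a free arrangement to finite fields *)

Lemma map_lform (R R' : comNzRingType) (f : {rmorphism R -> R'}) n (v : 'rV[R]_n) :
  map_mpoly f (lform v) = lform (map_mx f v).
Proof.
rewrite /lform rmorph_sum; apply: eq_bigr => i _.
by rewrite /= map_mpolyZ map_mpolyX mxE.
Qed.

Lemma map_der_val (R R' : comNzRingType) (f : {rmorphism R -> R'}) n
    (b : 'I_n -> {mpoly R[n]}) (v : 'rV[R]_n) :
  map_mpoly f (der_val b v) = der_val (map_mpoly f \o b) (map_mx f v).
Proof.
rewrite /der_val rmorph_sum; apply: eq_bigr => i _.
by rewrite rmorphM /= map_mpolyC mxE.
Qed.

Section Reduction.
Variables (K : fieldType) (A : comNzRingType) (F : finFieldType).
Variables (e : {rmorphism A -> K}) (f : {rmorphism A -> F}).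
Hypothesis ef : forall x, e x = 0 -> f x = 0.
Variable cs : seq K.
Hypothesis lift : forall c, c \in cs -> exists a, e a = c.

Lemma transfer x y : e x = e y -> f x = f y.
Proof.
move=> xy; apply/eqP; rewrite -subr_eq0 -rmorphB ef //.
by rewrite rmorphB xy subrr.
Qed.

Lemma transfer_mpoly n (p q : {mpoly A[n]}) :
  map_mpoly e p = map_mpoly e q -> map_mpoly f p = map_mpoly f q.
Proof.
move=> pq; apply/mpolyP => m; rewrite !mcoeff_map_mpoly; apply: transfer.
by rewrite -!mcoeff_map_mpoly pq.
Qed.

Lemma transfer_mx m n (M N : 'M[A]_(m, n)) :
  map_mx e M = map_mx e N -> map_mx f M = map_mx f N.
Proof.
move=> /matrixP MN; apply/matrixP => i j; rewrite !mxE; apply: transfer.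
by have := MN i j; rewrite !mxE.
Qed.

Definition entries m n (M : 'M[K]_(m, n)) : seq K := [seq M i j | i <- enum 'I_m, j <- enum 'I_n].

Lemma mem_entries m n (M : 'M[K]_(m, n)) i j : M i j \in entries M.
Proof. by apply/allpairsP; exists (i, j); rewrite !mem_enum. Qed.

Lemma lift_mx m n (M : 'M[K]_(m, n)) : {subset entries M <= cs} ->
  exists M', map_mx e M' = M.
Proof.
move=> Mcs; have /all_sig [g gE] (x : 'I_m * 'I_n) : {a | e a = M x.1 x.2}.
  by apply: cid; apply/lift/Mcs/mem_entries.
exists (\matrix_(i, j) g (i, j)); apply/matrixP => i j.
by rewrite !mxE (gE (i, j)).
Qed.

Definition mcoefs n (p : {mpoly K[n]}) : seq K := [seq p@_m | m <- msupp p].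

(** The support does not grow, so that homogeneity can be transferred. *)
Lemma lift_mpoly n (p : {mpoly K[n]}) : {subset mcoefs p <= cs} ->
  exists2 p', map_mpoly e p' = p & {subset msupp p' <= msupp p}.
Proof.
move=> pcs; have /all_sig [g gE] (m : 'X_{1..n}) : {a | m \in msupp p -> e a = p@_m}.
  apply: cid; have [mp|_] := boolP (m \in msupp p); last by exists 0.
  by have [a aE] := lift (pcs _ (map_f _ mp)); exists a.
pose p' : {mpoly A[n]} := \sum_(m <- msupp p) g m *: 'X_[m].
have p'E m : p'@_m = if m \in msupp p then g m else 0.
  rewrite raddf_sum /=; case: ifPn => mp.
    rewrite (bigD1_seq m) ?msupp_uniq //= mcoeffZ mcoeffX eqxx mulr1 big1 ?addr0 // => m' /negPf m'm.
    by rewrite mcoeffZ mcoeffX m'm mulr0.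
  rewrite big_seq big1 // => m' m'p; rewrite mcoeffZ mcoeffX.
  by case: eqP => [mm|]; rewrite ?mulr0 //; rewrite -mm m'p in mp.
exists p'.
  apply/mpolyP => m; rewrite mcoeff_map_mpoly p'E; case: ifPn => [/gE //|mp].
  by rewrite memN_msupp_eq0 //; exact: (rmorph0 e).
by move=> m; rewrite mcoeff_msupp p'E; case: ifP => //; rewrite eqxx.
Qed.

End Reduction.

Section RankCertificate.
Variables (K : fieldType) (m n : nat).

(** A factorization of [M] through dimension [r] and an invertible compression
    of [M] are identities between matrices, hence transfer along ring
    morphisms, and they certify that the rank is [r]. *)
Lemma rank_certificate (M : 'M[K]_(m, n)) : exists r (C : 'M_(m, r)) (D : 'M_(r, n))
    (X : 'M_(r, m)) (Y : 'M_(n, r)),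
  [/\ r = \rank M, C *m D = M & X *m M *m Y = 1%:M].
Proof.
exists (\rank M), (col_base M), (row_base M).
have /row_fullP [X XE] := col_base_full M.
have /row_freeP [Y YE] := row_base_free M.
exists X, Y; split; rewrite ?mulmx_base //.
have -> : X *m M = X *m (col_base M *m row_base M) by rewrite mulmx_base.
by rewrite mulmxA XE mul1mx YE.
Qed.

Lemma rank_certified (M : 'M[K]_(m, n)) r (C : 'M_(m, r)) (D : 'M_(r, n))
    (X : 'M_(r, m)) (Y : 'M_(n, r)) :
  C *m D = M -> X *m M *m Y = 1%:M -> \rank M = r.
Proof.
move=> CD XMY; apply/eqP; rewrite eqn_leq -{1}CD; apply/andP; split.
  by apply: leq_trans (mxrankM_maxl _ _) _; exact: rank_leq_col.
rewrite -{1}(mxrank1 K r) -XMY; apply: leq_trans (mxrankM_maxl _ _) _.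
exact: mxrankM_maxr.
Qed.

End RankCertificate.

Section FreeReduction.
Variables (K : fieldType) (n k : nat).
Hypothesis K0 : [pchar K] =i pred0.
Variables (l : 'I_k -> 'rV[K]_n) (B : 'M[{mpoly K[n]}]_n) (d : 'I_n -> nat) (c : K).
Notation L := [seq l i | i <- enum 'I_k].
Hypothesis BL : forall i, logder L (B i).
Hypothesis Bd : forall i j, B i j \is (d i).-homog.
Hypothesis c0 : c != 0.
Hypothesis detB : \det B = c *: lprod L.

(** All the hypotheses are expressed by identities: the quotients in the
    logarithmic conditions, the certificates of the ranks, and an inverse of [c]
    are specialized along with the given data. Their coefficients form the
    finite list [cs]. *)
Theorem free_reduction N : exists (F : finFieldType) (l' : 'I_k -> 'rV[F]_n)
    (B' : 'M[{mpoly F[n]}]_n) (c' : F),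
  [/\ (N < #|F|)%N, same_ranks l l', forall i, logder [seq l' i | i <- enum 'I_k] (B' i),
      forall i j, B' i j \is (d i).-homog &
      c' != 0 /\ \det B' = c' *: lprod [seq l' i | i <- enum 'I_k]].
Proof.
have /all_sig [h hE] (x : 'I_n * 'I_k) :
    {h | der_val (B x.1) (l x.2) = lform (l x.2) * h}.
  by apply: cid; apply: BL; apply: map_f; rewrite mem_enum.
have /all_sig [r rc] T : {r | exists (C : 'M_(k, r)) (D : 'M_(r, n)) (X : 'M_(r, k)) (Y : 'M_(n, r)),
    [/\ r = \rank (sel_mx l T), C *m D = sel_mx l T & X *m sel_mx l T *m Y = 1%:M]}.
  by apply: cid; have [r H] := rank_certificate (sel_mx l T); exists r.
have /all_sig [C {}rc] T := cid (rc T).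
have /all_sig [D {}rc] T := cid (rc T).
have /all_sig [X {}rc] T := cid (rc T).
have /all_sig [Y {}rc] T := cid (rc T).
pose cs := [:: c; c^-1] ++
  flatten [seq entries (l i) | i <- enum 'I_k] ++
  flatten [seq mcoefs (B x.1 x.2) | x <- enum {: 'I_n * 'I_n}] ++
  flatten [seq mcoefs (h x) | x <- enum {: 'I_n * 'I_k}] ++
  flatten [seq entries (C T) ++ entries (D T) ++ entries (X T) ++ entries (Y T)
          | T <- enum {: {set 'I_k}}].
have [A [e [F0 [f0 [ef0 lift]]]]] := specialization cs K0.
have [F [i0 NF]] := finfield_large F0 N.
pose f : {rmorphism A -> F} := i0 \o f0.
have ef x : e x = 0 -> f x = 0 by move=> /ef0 /= ->; rewrite rmorph0.
have sub_cs (I : finType) (G : I -> seq K) (s : seq K) i :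
    {subset flatten [seq G i | i <- enum I] <= s} -> {subset G i <= s}.
  by move=> H x xG; apply: H; apply/flatten_mapP; exists i; rewrite ?mem_enum.
have cs1 : {subset [:: c; c^-1] <= cs} by move=> x xc; rewrite mem_cat xc.
have cs2 : {subset flatten [seq entries (l i) | i <- enum 'I_k] <= cs}.
  by move=> x xc; rewrite !mem_cat xc !orbT.
have cs3 : {subset flatten [seq mcoefs (B x.1 x.2) | x <- enum {: 'I_n * 'I_n}] <= cs}.
  by move=> x xc; rewrite !mem_cat xc !orbT.
have cs4 : {subset flatten [seq mcoefs (h x) | x <- enum {: 'I_n * 'I_k}] <= cs}.
  by move=> x xc; rewrite !mem_cat xc !orbT.
have cs5 : {subset flatten [seq entries (C T) ++ entries (D T) ++ entries (X T) ++ entries (Y T)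
          | T <- enum {: {set 'I_k}}] <= cs}.
  by move=> x xc; rewrite !mem_cat xc !orbT.
have [[cA cAE] [cA' cA'E]] : (exists a, e a = c) /\ (exists a, e a = c^-1).
  by split; apply/lift/cs1; rewrite !inE eqxx ?orbT.
have /all_sig [lA lAE] i : {v | map_mx e v = l i}.
  by apply: cid; apply: (lift_mx lift); exact: sub_cs cs2.
have /all_sig [BA BAE] (x : 'I_n * 'I_n) :
    {p | map_mpoly e p = B x.1 x.2 /\ {subset msupp p <= msupp (B x.1 x.2)}}.
  by apply: cid; have [p pE ps] := lift_mpoly lift (sub_cs _ _ _ x cs3); exists p.
have /all_sig [hA hAE] x : {p | map_mpoly e p = h x}.
  by apply: cid; have [p pE _] := lift_mpoly lift (sub_cs _ _ _ x cs4); exists p.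
pose BA_mx : 'M[{mpoly A[n]}]_n := \matrix_(i, j) BA (i, j).
have BA_map : map_mx (map_mpoly e) BA_mx = B.
  by apply/matrixP => i j; rewrite !mxE (BAE (i, j)).1.
pose l' i := map_mx f (lA i).
pose B' := map_mx (map_mpoly f) BA_mx.
exists F, l', B', (f cA); split=> //.
- move=> T; have [rE CD XMY] := rc T.
  have sub M : {subset M <= entries (C T) ++ entries (D T) ++ entries (X T) ++ entries (Y T)} ->
      {subset M <= cs}.
    by move=> H x /H; exact: sub_cs cs5 x.
  have [CA CAE] : exists M', map_mx e M' = C T.
    by apply: (lift_mx lift); apply: sub => x xC; rewrite mem_cat xC.
  have [DA DAE] : exists M', map_mx e M' = D T.
    by apply: (lift_mx lift); apply: sub => x xC; rewrite !mem_cat xC !orbT.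
  have [XA XAE] : exists M', map_mx e M' = X T.
    by apply: (lift_mx lift); apply: sub => x xC; rewrite !mem_cat xC !orbT.
  have [YA YAE] : exists M', map_mx e M' = Y T.
    by apply: (lift_mx lift); apply: sub => x xC; rewrite !mem_cat xC !orbT.
  pose SA : 'M[A]_(k, n) := \matrix_i (if i \in T then lA i else 0).
  have selE (R : fieldType) (g : {rmorphism A -> R}) :
      map_mx g SA = sel_mx (fun i => map_mx g (lA i)) T.
    by apply/matrixP => i j; rewrite !mxE; case: ifP; rewrite !mxE ?rmorph0.
  have SAe : map_mx e SA = sel_mx l T.
    by rewrite selE; congr sel_mx; apply/funext => i; rewrite lAE.
  rewrite -rE; apply/esym.
  apply: (@rank_certified _ _ _ _ _ (map_mx f CA) (map_mx f DA) (map_mx f XA) (map_mx f YA)).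
    rewrite -selE -map_mxM; apply: (transfer_mx ef).
    by rewrite map_mxM CAE DAE SAe.
  rewrite -selE -!map_mxM -(map_mx1 f); apply: (transfer_mx ef).
  by rewrite !map_mxM XAE YAE SAe map_mx1.
- move=> i v /mapP [j _ ->]; exists (map_mpoly f (hA (i, j))).
  have -> : der_val (B' i) (l' j) = map_mpoly f (der_val (BA_mx i) (lA j)).
    by rewrite map_der_val; apply: eq_bigr => t _; rewrite /B' [map_mx _ _ i t]mxE.
  rewrite /l' -map_lform -rmorphM; apply: (transfer_mpoly ef).
  rewrite rmorphM /= map_der_val map_lform hAE lAE -(hE (i, j)).
  by apply: eq_bigr => t _; rewrite /= !mxE (BAE (i, t)).1.
- move=> i j; apply/dhomogP => m; rewrite !mxE mcoeff_msupp mcoeff_map_mpoly => mB.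
  have mBA : m \in msupp (BA (i, j)).
    by rewrite mcoeff_msupp; apply: contraNneq mB => ->; apply/eqP; exact: (rmorph0 f).
  by have /dhomogP := Bd i j; apply; exact: (BAE (i, j)).2.
split.
  have : f (cA * cA') = 1.
    by rewrite -(rmorph1 f); apply: (transfer ef); rewrite rmorphM cAE cA'E mulfV ?rmorph1.
  rewrite rmorphM => cc; apply: contra_eq_neq cc => ->.
  by rewrite mul0r eq_sym oner_neq0.
pose LA := \prod_(i <- enum 'I_k) lform (lA i).
have LE (R : fieldType) (g : {rmorphism A -> R}) :
    map_mpoly g LA = lprod [seq map_mx g (lA i) | i <- enum 'I_k].
  by rewrite /lprod big_map rmorph_prod; apply: eq_bigr => i _; rewrite /= map_lform.
rewrite -LE -mul_mpolyC -map_mpolyC -rmorphM det_map_mx; apply: (transfer_mpoly ef).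
rewrite -det_map_mx BA_map detB rmorphM /= map_mpolyC -mul_mpolyC.
congr (_%:MP * _); first exact: esym cAE.
by rewrite [RHS]LE; congr lprod; apply: eq_map => i; rewrite lAE.
Qed.

End FreeReduction.

(** * Terao's factorization *)

Lemma poly_int_eq0 (p : {poly int}) :
  (forall N : nat, exists2 q, (N < q)%N & root p q%:R) -> p = 0.
Proof.
move=> pr; apply/eqP/negPn/negP => p0.
have [rs [urs rsp]] : exists rs : seq nat, [/\ uniq rs, all (fun q => root p q%:R) rs & (size rs = size p)%N].
  elim: (size p) => [|m [rs [urs rsp rsm]]]; first by exists [::].
  have [q qN pq] := pr (\max_(r <- rs) r)%N; exists (q :: rs); rewrite /= pq urs rsp rsm.
  split=> //; rewrite andbT; apply/negP => qrs; have := @leq_bigmax_seq nat rs predT id q qrs isT.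
  by rewrite leqNgt qN.
move=> rsm; have := @max_poly_roots _ p [seq q%:R | q <- rs] p0.
rewrite all_map rsp size_map rsm ltnn => /(_ isT) H; suff: false by [].
apply: H; rewrite map_inj_uniq // => a b /eqP.
by rewrite !natz eqz_nat => /eqP.
Qed.

Lemma horner_homogenize (p : {poly int}) m x :
  (size p <= m.+1)%N -> homogenize x 1 m p = p.[x].
Proof.
move=> pm; rewrite (horner_coef_wide _ pm); apply: eq_bigr => k _.
by rewrite expr1n mulr1 intz.
Qed.

(** Terao's factorization theorem. Both sides are homogeneous in [a] and [b],
    hence determined by integer polynomials, and these agree at the
    cardinalities of arbitrarily large finite fields to which the arrangement
    reduces: the reduction keeps the ranks, hence [chi], and the degrees. *)
Theorem chi_free (K : fieldType) n (L : seq 'rV[K]_n) (A : 'M[{mpoly K[n]}]_n)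
    (d : 'I_n -> nat) (c : K) : [pchar K] =i pred0 ->
  uniq L -> 0 \notin L -> nonprop L -> (forall i, logder L (A i)) ->
  (forall i j, A i j \is (d i).-homog) -> c != 0 -> \det A = c *: lprod L ->
  forall (R : comNzRingType) (a b : R), chi a b L 0 = \prod_i (a - (d i)%:R * b).
Proof.
move=> K0 uL L0 LP AL Ad c0 dA R a b.
pose p := chi 'X (1 : {poly int}) L 0; have [sp _] := chi_homogenize 0 (0 : int) L 0.
rewrite mxrank0 subn0 -/p in sp.
rewrite (chi_homogenize a b L 0).2 mxrank0 subn0 -homogenize_prod; congr homogenize.
apply/eqP; rewrite -subr_eq0; apply/eqP/poly_int_eq0 => N.
pose k := size L; pose l (i : 'I_k) := tnth (in_tuple L) i.
have LE : [seq l i | i <- enum 'I_k] = L by rewrite /l map_tnth_enum.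
rewrite -LE in AL dA.
have [F [l' [A' [c' [NF ll' AL' Ad' [c0' dA']]]]]] :=
  free_reduction K0 AL Ad c0 dA (N + k + \sum_i d i).
have sub T i := same_ranks_sub ll' T i.
exists #|F|; first by apply: leq_ltn_trans NF; rewrite -addnA leq_addr.
have dF i : (d i < #|F|)%N.
  apply: leq_ltn_trans NF; apply: leq_trans (leq_addl _ _).
  by rewrite (bigD1 i) //= leq_addr.
have linj : injective l by apply/injectiveP; rewrite /injectiveb /dinjectiveb LE.
(* Ranks also detect zero and proportional forms, so that the reduction is
   again an arrangement of distinct hyperplanes. *)
have pair i j : (l i <= l j)%MS = (l' i <= l' j)%MS.
  have := sub [set j]%SET i.
  by rewrite (sel_mx1 l j) (sel_mx1 l' j).
have lP i j : (l' i <= l' j)%MS -> i = j.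
  rewrite -pair => lij; apply/eqP/negPn/negP => ij.
  have /negP : ~~ (l i <= l j)%MS by apply: LP; rewrite ?mem_tnth // inj_eq.
  by [].
have l'inj : injective l' by move=> i j lij; apply: lP; rewrite lij.
set L' := [seq l' i | i <- enum 'I_k] in AL' dA'.
have cardE : #|complement L' 0| = (\prod_i (#|F| - d i))%N.
  apply: (free_complement_card _ _ _ AL' Ad' c0' dA').
  - by rewrite map_inj_uniq ?enum_uniq.
  - apply/mapP => -[i _ l'0]; have := sub finset.set0 i.
    rewrite !sel_mx0 -l'0 sub0mx => /submx0null li0.
    by move: L0; rewrite -li0 mem_tnth.
  - by move=> _ _ /mapP [i _ ->] /mapP [j _ ->] l'ij; apply/negP => /lP ij; rewrite ij eqxx in l'ij.
  - exact: dF.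
  rewrite size_map size_enum_ord; apply: leq_ltn_trans NF.
  by rewrite addnAC leq_addl.
rewrite -/p; suff pE : p.[#|F|%:R] = (\prod_i ('X - (d i)%:R%:P)).[#|F|%:R].
  by rewrite rootE hornerD hornerN pE subrr.
rewrite -(horner_homogenize _ sp).
have := (chi_homogenize (#|F|%:R : int) 1 L 0).2; rewrite mxrank0 subn0 -/p => <-.
rewrite -LE (chi_rank _ _ _ ll') -card_complement cardE natr_prod horner_prod.
by apply: eq_bigr => i _; rewrite hornerXsubC natrB // ltnW.
Qed.

(** * Logarithmic vector fields and generating series *)

Section Coordinates.
Variables (K : fieldType) (V : vectType K) (Delta : {fset 'Hom(V, K^o)}).
Notation n := (\dim {:V}).
Notation S := {mpoly K[n]}.

Definition dual_form (j : 'I_n) : 'Hom(V, K^o) := linfun (coord (vbasis {:V}) j : V -> K^o).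

Lemma coefs_dual j : coefs (dual_form j) = delta_mx 0 j.
Proof.
apply/rowP => i; rewrite !mxE lfunE /= coord_free ?eqxx //.
exact: basis_free (vbasisP _).
Qed.

Lemma linform_dual j : linform (dual_form j) = 'X_j.
Proof. by rewrite linformE coefs_dual lform_delta. Qed.

Lemma derivation_linform (theta : S -> S) a : is_derivation theta ->
  theta (linform a) = der_val (fun j => theta 'X_j) (coefs a).
Proof.
move=> [lin _]; have th0 : theta 0 = 0.
  have := lin (-1) 0 0; rewrite scaler0 addr0 scaleN1r => /esym/eqP.
  by rewrite addrC subrr eq_sym => /eqP.
have thD f g : theta (f + g) = theta f + theta g by have := lin 1 f g; rewrite !scale1r.
have thZ (c : K) f : theta (c *: f) = c *: theta f by rewrite -[c *: f]addr0 lin th0 addr0.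
rewrite linformE /lform /der_val (big_morph theta thD th0).
by apply: eq_bigr => j _; rewrite thZ mulrC mul_mpolyC.
Qed.

Definition coord_der (b : 'I_n -> S) : vfield V := fun f => \sum_j b j * mderiv j f.

Lemma coord_der_is_derivation b : is_derivation (coord_der b).
Proof.
split=> [c f g|f g]; rewrite /coord_der.
  rewrite scaler_sumr -big_split; apply: eq_bigr => j _ /=.
  by rewrite mderivD mderivZ mulrDr scalerAr.
rewrite mulr_suml mulr_sumr -big_split; apply: eq_bigr => j _ /=.
by rewrite mderivM; ring.
Qed.

Lemma coord_derX b j : coord_der b 'X_j = b j.
Proof.
rewrite /coord_der (bigD1 j) //= big1 => [|i ij]; rewrite mderivX mnm1E.
  by rewrite eqxx mnm_subnn mpolyX0 scale1r mulr1 addr0.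
by rewrite eq_sym (negPf ij) scale0r mulr0.
Qed.

Lemma Dmod_logder theta : Dmod Delta theta -> logder (forms Delta) (fun j => theta 'X_j).
Proof.
move=> [der div] _ /mapP [a aD ->]; rewrite -derivation_linform // -linformE.
exact: div.
Qed.

Lemma logder_Dmod b : logder (forms Delta) b -> Dmod Delta (coord_der b).
Proof.
move=> bL; have der := coord_der_is_derivation b; split=> // a aD.
rewrite derivation_linform // (_ : (fun _ => _) = b); last by apply/funext => j; exact: coord_derX.
by rewrite linformE; apply: bL; exact: map_f.
Qed.

(** A combination in [lspan] may repeat an element; the coefficients of equal
    elements are added. *)
Lemma lspan_range (A : nzRingType) (E : lmodType A) (I : finType) (y : I -> E) x :
  lspan (range y) x -> exists c : I -> A, x = \sum_i c i *: y i.
Proof.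
move=> [m [c [z [zy ->]]]].
have /all_sig [u uE] i : {j | z i = y j} by apply: cid; have [j _ <-] := zy i; exists j.
exists (fun j => \sum_(i | u i == j) c i); rewrite (partition_big u predT) //=.
apply: eq_bigr => j _; rewrite scaler_suml; apply: eq_bigr => i /eqP <-.
by rewrite uE.
Qed.

Definition der_mx (theta : 'I_n -> vfield V) : 'M[S]_n := \matrix_(i, j) theta i 'X_j.

Lemma der_mx_gen theta b : module_basis (Dmod Delta) (range theta) -> logder (forms Delta) b ->
  exists c : 'I_n -> S, forall j, b j = \sum_i c i * der_mx theta i j.
Proof.
move=> [_ gen _] /logder_Dmod /gen /lspan_range [c bE]; exists c => j.
rewrite -coord_derX bE; elim/big_rec2: _ => // i f g _ <-.
by rewrite mxE.
Qed.

End Coordinates.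

Section GeneratingSeries.

Lemma inv_sub1s : (1 - s_)^-1 = fpsC (fps_geom int) :> fps2.
Proof.
rewrite -[RHS](mulrK sub1s_unit) -[LHS]mul1r; congr (_ / _).
by rewrite /s_ -[X in X - _]fpsC1 -fpsCB -fpsCM fps_sub1X_geom.
Qed.

Lemma inv_sub1t : (1 - t_)^-1 = fps_geom (fps int) :> fps2.
Proof.
rewrite -[RHS](mulrK sub1t_unit) -[LHS]mul1r; congr (_ / _).
by rewrite fps_sub1X_geom.
Qed.

(** The factor of Terao's theorem at [A = (1-s)^-1] and
    [B = 1 - (1-t)^-1]. *)
Lemma series_factor (e : nat) :
  (1 - s_)^-1 - e%:R * (1 - (1 - t_)^-1) =
  (1 - s_)^-1 * (1 - t_)^-1 * (1 + (e%:R - 1 - s_ * e%:R) * t_) :> fps2.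
Proof.
have us := sub1s_unit; have ut := sub1t_unit.
apply: (mulrI us); apply: (mulrI ut).
have -> : (1 - t_) * ((1 - s_) * ((1 - s_)^-1 * (1 - t_)^-1 * (1 + (e%:R - 1 - s_ * e%:R) * t_)))
  = ((1 - t_) / (1 - t_)) * ((1 - s_) / (1 - s_)) * (1 + (e%:R - 1 - s_ * e%:R) * t_) :> fps2.
  ring.
have -> : (1 - t_) * ((1 - s_) * ((1 - s_)^-1 - e%:R * (1 - (1 - t_)^-1)))
  = (1 - t_) * ((1 - s_) / (1 - s_)) - (1 - s_) * e%:R * ((1 - t_) - (1 - t_) / (1 - t_)) :> fps2.
  ring.
by rewrite !divrr //; ring.
Qed.

End GeneratingSeries.

Lemma Poin_chi (K : fieldType) (V : vectType K) (Delta : {fset 'Hom(V, K^o)}) :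
  0 \notin Delta ->
  Poin Delta = chi (1 - s_)^-1 (1 - (1 - t_)^-1) (forms Delta) 0.
Proof.
move=> D0; rewrite inv_sub1s inv_sub1t -hilbE ?hits0 ?forms0 //.
by apply/funext => q; apply/funext => p; rewrite /Poin dimRbarE.
Qed.

Theorem corollary1p4 (K : fieldType) (V : vectType K)
    (Delta : {fset 'Hom(V, K^o)}) (d : 'I_(\dim {:V}) -> nat) :
  [pchar K] =i pred0 ->
  0 \notin Delta ->
  (forall a b, a \in Delta -> b \in Delta -> a != b ->
     forall c : K, a <> c *: b) ->
  free_arrangement Delta ->
  exponents Delta d ->
  (forall p q : int, quotient_findim (Rfilt Delta p q) (Rfilt_lower Delta p q)) /\
  Poin Delta =
    (1 - s_) ^- \dim {:V} * (1 - t_) ^- \dim {:V}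
    * \prod_(i < \dim {:V}) (1 + ((d i)%:R - 1 - s_ * (d i)%:R) * t_).
Proof.
move=> K0 D0 DP _ [theta [_ basis hom]]; split; first exact: Rbar_findim.
have uL : uniq (forms Delta) by rewrite map_inj_uniq ?fset_uniq //; exact: coefs_inj.
have L0 := forms0 D0.
have LP : nonprop (forms Delta).
  move=> _ _ /mapP [a aD ->] /mapP [b bD ->] ab; apply/negP => /sub_rVP [c].
  rewrite -coefsZ => /coefs_inj; apply: DP => //.
  by apply: contraNneq ab => ->.
have logB i : logder (forms Delta) (der_mx theta i).
  have [sub _ _] := basis.
  have := Dmod_logder (sub _ (ex_intro2 _ _ i I erefl)).
  by congr logder; apply/funext => j; rewrite mxE.
have homB i j : der_mx theta i j \is (d i).-homog.
  by rewrite mxE -linform_dual; exact: hom.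
have [c c0 detB] := saito_det uL L0 LP logB (fun b => der_mx_gen basis).
rewrite (Poin_chi D0) (chi_free K0 uL L0 LP logB homB c0 detB).
under eq_bigr do rewrite series_factor.
by rewrite !big_split /= !prodr_const !card_ord !exprVn.
Qed.
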